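(* Let $p>0$ be real, let $\sigma(t)=\frac{p+t}{p-t}$, and for each integer $j\ge 1$ let $\lambda_j$ be the root of $\tan(\pi x)=-x/p$ lying in $(j-\tfrac12,j)$. Let $\alpha,\beta>0$ with $\alpha\beta=4\pi^2$, and let $n\in\mathbb{C}$ with $\operatorname{Re}(n)>2$. Then $$\begin{aligned} &\sqrt{\alpha^n}\left(\frac{\Gamma(n)\eta_p(n)}{(2\pi)^n}+\cos\left(\frac{\pi n}{2}\right)\sum_{j=1}^{\infty}\frac{p^2+\lambda_j^2}{p\left(p+\frac1\pi\right)+\lambda_j^2}\,\frac{\lambda_j^{n-1}}{\sigma\left(\frac{\alpha\lambda_j}{2\pi}\right)e^{\alpha\lambda_j}-1}\right)\\ &=\sqrt{\beta^n}\Bigg(\cos\left(\frac{\pi n}{2}\right)\frac{\Gamma(n)\eta_p(n)}{(2\pi)^n}+\sum_{j=1}^{\infty}\frac{p^2+\lambda_j^2}{p\left(p+\frac1\pi\right)+\lambda_j^2}\,\frac{\lambda_j^{n-1}}{\sigma\left(\frac{\beta\lambda_j}{2\pi}\right)e^{\beta\lambda_j}-1}\\ &\quad-i\sin\left(\frac{\pi n}{2}\right)\mathrm{P.V.}\int_0^\infty\frac{z^{n-1}}{\sigma(z)e^{2\pi z}-1}\left(\frac{\sigma\left(-\frac{i\beta z}{2\pi}\right)e^{-i\beta z}-\sigma\left(\frac{i\beta z}{2\pi}\right)e^{i\beta z}}{\left(\sigma\left(\frac{i\beta z}{2\pi}\right)e^{i\beta z}-1\right)\left(\sigma\left(-\frac{i\beta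 z}{2\pi}\right)e^{-i\beta z}-1\right)}\right)dz\Bigg), \end{aligned}$$ where $$\eta_p(s)=\sum_{k=1}^\infty\frac{(s,2\pi p k)_k}{k^s}\ (\operatorname{Re}(s)>1),\qquad (s,\nu k)_k=\frac{1}{\Gamma(s)}\int_0^\infty e^{-x}\left(\frac{k\nu-x}{k\nu+x}\right)^k x^{s-1}\,dx.$$
   Context: There is exactly one root $\lambda_j$ of $\tan(\pi x)=-x/p$ in each interval $(j-\tfrac12,j)$, $j\ge1$. For positive reals $a$, $\sqrt{a^n}$ means $a^{n/2}=e^{(n/2)\log a}$, and $\lambda_j^{n-1}$, $z^{n-1}$ are real-logarithm powers. For $t>0$ the quantity $\frac{1}{\sigma(t)e^{c}-1}$ is understood as $\frac{p-t}{(p+t)e^{c}-(p-t)}$; in particular it is $0$ at $t=p$, where $\sigma$ has a pole. P.V. denotes the Cauchy principal value: the integrand has simple poles on the positive real axis at $z=2\pi\lambda_j/\beta$, $j\ge 1$, and the integral is taken in the principal value sense (symmetric excision) at each of them. *)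

(* Defs.v *)
From Stdlib Require Import Reals Lra ClassicalEpsilon.
From Coquelicot Require Import Coquelicot.

Open Scope C_scope.

Definition Cexp (z : C) : C := RtoC (exp (Re z)) * (cos (Im z), sin (Im z)).
Definition Ccos (z : C) : C := (Cexp (Ci * z) + Cexp (- (Ci * z))) / 2.
Definition Csin (z : C) : C := (Cexp (Ci * z) - Cexp (- (Ci * z))) / (2 * Ci).

(** [x ^ s] with the real logarithm, meaningful for [0 < x]. *)
Definition Rcpow (x : R) (s : C) : C := Cexp (s * RtoC (ln x)).

(** Complex-valued functions of a real variable are integrated, and complex
    series summed, in [C] seen as a complete normed space over [R].  [CSeries],
    [CInt_0_infty] and [PV_Int_0_infty] return the sum or integral when it
    exists, and an unspecified value otherwise. *)

Definition ex_CSeries (u : nat -> C) : Prop :=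
  ex_series (V := C_R_NormedModule) u.

Definition CSeries (u : nat -> C) : C :=
  iota (T := C_R_CompleteNormedModule) (is_series (V := C_R_NormedModule) u).

Definition is_CInt_0_infty (f : R -> C) (l : C) : Prop :=
  is_RInt_gen (V := C_R_NormedModule) f (at_right 0) (Rbar_locally p_infty) l.

Definition CInt_0_infty (f : R -> C) : C :=
  iota (T := C_R_CompleteNormedModule) (is_CInt_0_infty f).

Definition excise (f : R -> C) (a : nat -> R) (eps : R) (z : R) : C :=
  if excluded_middle_informative (exists j, (Rabs (z - a j) < eps)%R)
  then 0 else f z.

(** Principal value at all the points [a j] simultaneously: the limit, as [eps]
    tends to [0+], of the (improper) integral of [f] over [(0, +oo)] deprived of
    the intervals [(a j - eps, a j + eps)]. *)
Definition is_PV_Int_0_infty (f : R -> C) (a : nat -> R) (l : C) : Prop :=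
  exists J : R -> C,
    at_right 0 (fun eps => is_CInt_0_infty (excise f a eps) (J eps)) /\
    filterlim J (at_right 0) (locally (T := C_R_NormedModule) l).

Definition ex_PV_Int_0_infty (f : R -> C) (a : nat -> R) : Prop :=
  exists l, is_PV_Int_0_infty f a l.

Definition PV_Int_0_infty (f : R -> C) (a : nat -> R) : C :=
  iota (T := C_R_CompleteNormedModule) (is_PV_Int_0_infty f a).

(** Euler's integral, for [0 < Re s]. *)
Definition CGamma (s : C) : C :=
  CInt_0_infty (fun x => RtoC (exp (- x)) * Rcpow x (s - 1)).

(** [(s, a)_k], used with [a = nu * k]. *)
Definition kosh_symbol (s : C) (a : R) (k : nat) : C :=
  / CGamma s *
  CInt_0_infty (fun x =>
    RtoC (exp (- x)) * RtoC (((a - x) / (a + x)) ^ k) * Rcpow x (s - 1)).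

(** The sum over [k >= 1], reindexed to start at [0]; for [1 < Re s]. *)
Definition eta (p : R) (s : C) : C :=
  CSeries (fun i : nat =>
    let k := S i in
    kosh_symbol s (2 * PI * p * INR k) k / Rcpow (INR k) s).

Definition sigma (p : R) (t : C) : C := (RtoC p + t) / (RtoC p - t).

(** [1 / (sigma(t) e^c - 1)] for real [t > 0], extended to the pole [t = p] of
    [sigma] by the value [0]. *)
Definition inv_sigma_exp (p t c : R) : R :=
  ((p - t) / ((p + t) * exp c - (p - t)))%R.

Lemma inv_sigma_expE (p t c : R) :
  (0 < p)%R -> (0 < t)%R -> (0 < c)%R -> t <> p ->
  RtoC (inv_sigma_exp p t c) = / (sigma p t * Cexp (RtoC c) - 1).
Proof.
intros Hp Ht Hc Htp.
assert (He : Cexp (RtoC c) = RtoC (exp c)).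
{ unfold Cexp, RtoC, Cmult; simpl.
  rewrite cos_0, sin_0; apply injective_projections; simpl; ring. }
assert (H1 : (1 < exp c)%R) by (rewrite <- exp_0; apply exp_increasing; lra).
assert (Hd : ((p + t) * exp c - (p - t) <> 0)%R).
{ assert ((p + t) * 1 < (p + t) * exp c)%R by (apply Rmult_lt_compat_l; lra).
  lra. }
assert (Hs : (p - t <> 0)%R) by lra.
rewrite He; unfold sigma.
assert (Hd' : ((p + t) / (p - t) * exp c - 1 <> 0)%R).
{ replace ((p + t) / (p - t) * exp c - 1)%R
    with (((p + t) * exp c - (p - t)) / (p - t))%R by (field; exact Hs).
  apply Rmult_integral_contrapositive_currified;
    [exact Hd | apply Rinv_neq_0_compat; exact Hs]. }
rewrite <- RtoC_plus, <- RtoC_minus, <- RtoC_div, <- RtoC_mult, <- RtoC_minus,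
  <- RtoC_inv by assumption.
unfold inv_sigma_exp; apply f_equal; field.
repeat split; try assumption.
Qed.

Definition weight (p l : R) : R :=
  ((p ^ 2 + l ^ 2) / (p * (p + 1 / PI) + l ^ 2))%R.

(** The term attached to the root [l = lambda_j], in the sum with parameter
    [a = alpha] or [a = beta]. *)
Definition lambda_term (p a : R) (n : C) (l : R) : C :=
  RtoC (weight p l) * Rcpow l (n - 1) *
  RtoC (inv_sigma_exp p (a * l / (2 * PI)) (a * l)).

Definition pv_integrand (p beta : R) (n : C) (z : R) : C :=
  let w : C := Ci * RtoC (beta * z) in
  let u : C := sigma p (w / RtoC (2 * PI)) * Cexp w in
  let v : C := sigma p (- w / RtoC (2 * PI)) * Cexp (- w) in
  Rcpow z (n - 1) * RtoC (inv_sigma_exp p z (2 * PI * z)) *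
  ((v - u) / ((u - 1) * (v - 1))).

(* Main.v *)
Require Import Defs.
From Stdlib Require Import Reals Lra Lia ClassicalEpsilon FunctionalExtensionality.
From Coquelicot Require Import Coquelicot.

(** Put [b = beta / 2 PI], [q t = exp (- 2 PI t) (p - t) / (p + t)] and
    [G_tau = tau q / (1 - tau q)], so that [G_1 t = 1 / (sigma t * exp (2 PI t) - 1)].
    For [tau, rho < 1] the functions [z ^ (n - 1) G_tau (z) G_rho (-+ i b z)] have no pole
    in the closed first, respectively fourth, quadrant and decay there, so by Cauchy's
    theorem the integration can be rotated from the positive real axis to the imaginary one.
    On the axis where [|q| = 1], [2 G_rho + 1 = P_rho +- i Q_rho], the Poisson kernel and its
    conjugate at the angle [2 psi], [psi x = PI b x + atan (b x / p)].  A combination of the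
    two quadrants in which the conjugate kernel of the imaginary axis cancels gives
    [cos (PI n / 2) int x^(n-1) G_tau (x) (P_rho - 1) + sin (PI n / 2) int x^(n-1) G_tau (x) Q_rho
     = int y^(n-1) G_rho (b y) (P_tau - 1)].
    Let [tau -> 1-], then [rho -> 1-].  The Poisson kernels become sums over the zeros
    [lambda_j / b] of [sin psi], with masses [PI / psi' = weight p lambda_j / b], and the conjugate
    kernel becomes the principal value of [cot psi], which is the integral of the theorem.
    Expanding [G_1] in powers of [q] identifies [int x^(n-1) G_1] with
    [Gamma n * eta n / (2 PI) ^ n]; since [eta] contains [1 / Gamma n], this uses that
    [Gamma n] is not zero. *)

Open Scope R_scope.

(** * The complex exponential and complex functions of a real variable *)

(** With [tau = rho = 1] the integrand has poles on both axes, that is on the boundary of the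
    quadrants, and a double pole at the origin. The parameter [tau] clears the imaginary axis and
    [rho] the real one; they are kept independent so that each passage to the limit is singular on
    one axis only. While [tau] tends to [1], [P_rho] and [Q_rho] are bounded on the real axis; once
    it has, the imaginary axis carries a series whose terms depend regularly on [rho]. The double
    pole at the origin, against [x ^ (n - 1)], is what [2 < Re n] pays for. No contour integral and
    no residue is computed. The rotation comes from differentiating in the angle, the masses of the
    Poisson kernel stand for the residues, and the principal value arises because a primitive of the
    conjugate kernel is even about each zero. Both kernels obey the same list of estimates, so one
    limit theorem treats them together. In it [rho] tends to [1] with the excision radius fixed, and
    the radius shrinks afterwards; this order also yields the existence of the principal value. *)

Lemma Cexp_add (z w : C) : Cexp (z + w) = (Cexp z * Cexp w)%C.
Proof.
unfold Cexp; destruct z as [a b], w as [c d]; apply injective_projections; simpl;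
  rewrite exp_plus, ?cos_plus, ?sin_plus; unfold Re, Im; simpl; ring.
Qed.

Lemma Cexp_RtoC (x : R) : Cexp (RtoC x) = RtoC (exp x).
Proof.
unfold Cexp; apply injective_projections; simpl; unfold Re, Im; simpl;
  rewrite cos_0, sin_0; ring.
Qed.

Lemma Cexp_0 : Cexp 0 = 1%C.
Proof. change (Cexp (RtoC 0) = RtoC 1); now rewrite Cexp_RtoC, exp_0. Qed.

Lemma Cmod_Cexp (z : C) : Cmod (Cexp z) = exp (Re z).
Proof.
unfold Cexp; rewrite Cmod_mult, Cmod_R, Rabs_pos_eq by (left; apply exp_pos).
unfold Cmod; simpl.
replace (cos (Im z) * (cos (Im z) * 1) + sin (Im z) * (sin (Im z) * 1)) with 1
  by (generalize (sin2_cos2 (Im z)); unfold Rsqr; lra).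
rewrite sqrt_1; ring.
Qed.

Lemma Cexp_neq_0 (z : C) : Cexp z <> 0%C.
Proof. apply Cmod_gt_0; rewrite Cmod_Cexp; apply exp_pos. Qed.

Lemma Cexp_opp (z : C) : Cexp (- z) = (/ Cexp z)%C.
Proof.
assert (H : (Cexp (- z) * Cexp z = 1)%C).
{ rewrite <- Cexp_add, Cplus_comm, Cplus_opp_r; apply Cexp_0. }
rewrite <- (Cmult_1_r (Cexp (- z))), <- (Cinv_r (Cexp z)) by apply Cexp_neq_0.
now rewrite Cmult_assoc, H, Cmult_1_l.
Qed.

Lemma Cmod_Rcpow (x : R) (s : C) : Cmod (Rcpow x s) = Rpower x (Re s).
Proof.
unfold Rcpow, Rpower; rewrite Cmod_Cexp; f_equal; destruct s; simpl; ring.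
Qed.

Lemma Rcpow_neq_0 (x : R) (s : C) : Rcpow x s <> 0%C.
Proof. apply Cexp_neq_0. Qed.

Lemma Rcpow_plus (x : R) (s t : C) : Rcpow x (s + t) = (Rcpow x s * Rcpow x t)%C.
Proof. unfold Rcpow; rewrite <- Cexp_add; f_equal; ring. Qed.

Lemma Rcpow_1 (x : R) : 0 < x -> Rcpow x 1 = RtoC x.
Proof. intros H; unfold Rcpow; rewrite Cmult_1_l, Cexp_RtoC, exp_ln; auto. Qed.

Lemma Rcpow_mult_base (x y : R) (s : C) :
  0 < x -> 0 < y -> Rcpow (x * y) s = (Rcpow x s * Rcpow y s)%C.
Proof.
intros Hx Hy; unfold Rcpow; rewrite ln_mult, <- Cexp_add by assumption.
f_equal; rewrite RtoC_plus; ring.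
Qed.

Lemma Rcpow_pred (x : R) (s : C) :
  0 < x -> (RtoC x * Rcpow x (s - 1) = Rcpow x s)%C.
Proof.
intros H; rewrite <- (Rcpow_1 x H) at 1; rewrite <- Rcpow_plus; f_equal; ring.
Qed.

(** The norm of [C_R_NormedModule] is a product norm; identified with [Cmod], it makes the norm
    inequalities for integrals usable. Balls of that space remain componentwise, whence the repeated
    use of [Re_le_Cmod], [Im_le_Cmod] and [Cmod_le_sum]. *)
Lemma norm_Cmod (z : C) : norm (V := C_R_NormedModule) z = Cmod z.
Proof.
unfold norm; simpl; unfold prod_norm, Cmod; simpl.
unfold norm; simpl; unfold abs; simpl.
f_equal; rewrite !Rmult_1_r, <- !Rabs_mult, !Rabs_pos_eq by apply Rle_0_sqr; ring.
Qed.

Lemma Re_le_Cmod (z : C) : Rabs (fst z) <= Cmod z.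
Proof. eapply Rle_trans; [apply Rmax_l | apply Rmax_Cmod]. Qed.

Lemma Im_le_Cmod (z : C) : Rabs (snd z) <= Cmod z.
Proof. eapply Rle_trans; [apply Rmax_r | apply Rmax_Cmod]. Qed.

Lemma Cmod_le_sum (z : C) : Cmod z <= Rabs (fst z) + Rabs (snd z).
Proof.
replace z with (RtoC (fst z) + Ci * RtoC (snd z))%C at 1
  by (apply injective_projections; simpl; ring).
eapply Rle_trans; [apply Cmod_triangle |].
rewrite Cmod_mult, !Cmod_R, Cmod_Ci; lra.
Qed.

Lemma Cmod_minus_sym (z w : C) : Cmod (z - w) = Cmod (w - z).
Proof. rewrite <- Cmod_opp; f_equal; ring. Qed.

(** Continuity and derivatives of complex functions of one or two real variables
    are taken componentwise. *)
Definition ccont (f : R -> C) (t : R) : Prop :=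
  continuity_pt (fun x => fst (f x)) t /\ continuity_pt (fun x => snd (f x)) t.

Definition cder (f : R -> C) (t : R) (l : C) : Prop :=
  is_derive (fun x => fst (f x)) t (fst l) /\ is_derive (fun x => snd (f x)) t (snd l).

Lemma cder_ccont f t l : cder f t l -> ccont f t.
Proof.
intros [H1 H2]; split; apply continuity_pt_filterlim;
  [apply (ex_derive_continuous (fun x => fst (f x))) |
   apply (ex_derive_continuous (fun x => snd (f x)))]; eexists; eassumption.
Qed.

Lemma ccont_const c t : ccont (fun _ => c) t.
Proof. split; apply continuity_pt_const; intros x y; reflexivity. Qed.

Lemma ccont_RtoC (f : R -> R) t : continuity_pt f t -> ccont (fun x => RtoC (f x)) t.
Proof.
intros H; split; simpl; [exact H | apply continuity_pt_const; intros x y; reflexivity].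
Qed.

Lemma ccont_plus f g t : ccont f t -> ccont g t -> ccont (fun x => (f x + g x)%C) t.
Proof.
intros [H1 H2] [H3 H4]; split; simpl; [apply (continuity_pt_plus _ _ _ H1 H3) |
  apply (continuity_pt_plus _ _ _ H2 H4)].
Qed.

Lemma ccont_opp f t : ccont f t -> ccont (fun x => (- f x)%C) t.
Proof.
intros [H1 H2]; split; simpl; [apply (continuity_pt_opp _ _ H1) |
  apply (continuity_pt_opp _ _ H2)].
Qed.

Lemma ccont_minus f g t : ccont f t -> ccont g t -> ccont (fun x => (f x - g x)%C) t.
Proof. intros H1 H2; apply ccont_plus; [| apply ccont_opp]; assumption. Qed.

Lemma ccont_mult f g t : ccont f t -> ccont g t -> ccont (fun x => (f x * g x)%C) t.
Proof.
intros [H1 H2] [H3 H4]; split; simpl;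
  [apply (continuity_pt_minus _ _ _ (continuity_pt_mult _ _ _ H1 H3) (continuity_pt_mult _ _ _ H2 H4)) |
   apply (continuity_pt_plus _ _ _ (continuity_pt_mult _ _ _ H1 H4) (continuity_pt_mult _ _ _ H2 H3))].
Qed.

Lemma cder_const c t : cder (fun _ => c) t 0.
Proof. split; simpl; apply (is_derive_const (V := R_NormedModule)). Qed.

Lemma cder_RtoC (f : R -> R) t l : is_derive f t l -> cder (fun x => RtoC (f x)) t (RtoC l).
Proof. intros H; split; simpl; [exact H | apply (is_derive_const (V := R_NormedModule))]. Qed.

Lemma cder_plus f g t l m :
  cder f t l -> cder g t m -> cder (fun x => (f x + g x)%C) t (l + m).
Proof.
intros [H1 H2] [H3 H4]; split; simpl; [apply (is_derive_plus _ _ _ _ _ H1 H3) |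
  apply (is_derive_plus _ _ _ _ _ H2 H4)].
Qed.

Lemma cder_mult f g t l m :
  cder f t l -> cder g t m -> cder (fun x => (f x * g x)%C) t (l * g t + f t * m).
Proof.
intros [H1 H2] [H3 H4]; split; simpl.
- replace (_ + _) with
    ((fst l * fst (g t) + fst (f t) * fst m) - (snd l * snd (g t) + snd (f t) * snd m)) by ring.
  apply (is_derive_minus (V := R_NormedModule)); apply (is_derive_mult (K := R_AbsRing)); auto;
    intros; apply Rmult_comm.
- replace (_ + _) with
    ((fst l * snd (g t) + fst (f t) * snd m) + (snd l * fst (g t) + snd (f t) * fst m)) by ring.
  apply (is_derive_plus (V := R_NormedModule)); apply (is_derive_mult (K := R_AbsRing)); auto;
    intros; apply Rmult_comm.
Qed.

Lemma C_neq_0_sqr (z : C) : z <> 0%C -> fst z * fst z + snd z * snd z <> 0.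
Proof.
intros H E; apply H; apply injective_projections; simpl;
  apply Rsqr_0_uniq; unfold Rsqr; nra.
Qed.

Lemma is_derive_eq (f : R -> R) t l m : is_derive f t l -> l = m -> is_derive f t m.
Proof. now intros H <-. Qed.

Lemma Derive_eta (u : R -> R) t l : is_derive u t l -> Derive (fun x : R => u x) t = l.
Proof. apply is_derive_unique. Qed.

Lemma cder_inv f t l :
  cder f t l -> f t <> 0%C -> cder (fun x => (/ f x)%C) t (- l / (f t * f t)).
Proof.
intros [H1 H2] N; apply C_neq_0_sqr in N.
(* One real computation serves both components: the imaginary part of an inverse is minus the same
   quotient with the two components exchanged. *)
assert (G1 : forall u v du dv, is_derive u t du -> is_derive v t dv ->
  u t * u t + v t * v t <> 0 ->
  is_derive (fun x => u x / (u x ^ 2 + v x ^ 2)) t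
    ((du * (v t ^ 2 - u t ^ 2) - 2 * u t * v t * dv) / (u t ^ 2 + v t ^ 2) ^ 2)).
{ intros u v du dv D1 D2 E; auto_derive.
  - repeat split; try (eexists; eassumption); simpl; rewrite !Rmult_1_r; assumption.
  - rewrite (Derive_eta _ _ _ D1), (Derive_eta _ _ _ D2).
    field; simpl; rewrite !Rmult_1_r; assumption. }
split; simpl.
- eapply is_derive_eq; [exact (G1 _ _ _ _ H1 H2 N) |].
  simpl; field; repeat split; contradict N;
  first [rewrite <- N; ring | apply Rsqr_0_uniq; unfold Rsqr; rewrite <- N at 1; ring |
    apply Rsqr_0_uniq; unfold Rsqr; nra].
- apply is_derive_ext with
    (fun x => - (snd (f x) / (snd (f x) ^ 2 + fst (f x) ^ 2))).
  { intros x; match goal with |- ?u = ?v => change (@eq R u v) end.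
    unfold Rdiv; rewrite (Rplus_comm (snd (f x) ^ 2)); simpl; ring. }
  rewrite Rplus_comm in N.
  eapply is_derive_eq;
    [exact (is_derive_opp (V := R_NormedModule) _ _ _ (G1 _ _ _ _ H2 H1 N)) |].
  unfold opp; simpl; field; repeat split; contradict N;
  first [rewrite <- N; ring | apply Rsqr_0_uniq; unfold Rsqr; rewrite <- N at 1; ring |
    apply Rsqr_0_uniq; unfold Rsqr; nra].
Qed.

Lemma cder_Cexp f t l : cder f t l -> cder (fun x => Cexp (f x)) t (l * Cexp (f t)).
Proof.
intros [H1 H2].
assert (G : forall u v du dv, is_derive u t du -> is_derive v t dv ->
  is_derive (fun x => exp (u x) * cos (v x) - 0 * sin (v x)) t
    (exp (u t) * (du * cos (v t) - dv * sin (v t))) /\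
  is_derive (fun x => exp (u x) * sin (v x) + 0 * cos (v x)) t
    (exp (u t) * (du * sin (v t) + dv * cos (v t)))).
{ intros u v du dv D1 D2; split; auto_derive; repeat split; try (eexists; eassumption);
  rewrite (Derive_eta _ _ _ D1), (Derive_eta _ _ _ D2); ring. }
destruct (G _ _ _ _ H1 H2) as [G1 G2]; split; simpl; unfold Re, Im.
- apply (is_derive_eq _ _ _ _ G1); simpl; ring.
- apply (is_derive_eq _ _ _ _ G2); simpl; ring.
Qed.

Lemma cder_ext (f g : R -> C) t l : (forall x, f x = g x) -> cder f t l -> cder g t l.
Proof.
intros E [H1 H2]; split; (eapply is_derive_ext; [| eassumption]); intros; simpl; now rewrite E.
Qed.

Lemma cder_Rcpow x s : 0 < x -> cder (fun x => Rcpow x s) x (s * Rcpow x (s - 1)).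
Proof.
intros Hx; unfold Rcpow.
evar (l : C); assert (H : cder (fun x => Cexp (s * RtoC (ln x))) x l).
{ apply cder_Cexp, cder_mult; [apply cder_const |].
  apply cder_RtoC; auto_derive; [exact Hx | reflexivity]. }
replace (_ * _)%C with l; [exact H |].
unfold l; fold (Rcpow x s); fold (Rcpow x (s - 1)).
rewrite <- (Rcpow_pred x s Hx), Rmult_1_l, RtoC_inv by lra.
field; injection; lra.
Qed.

Lemma ccont_Rcpow x s : 0 < x -> ccont (fun x => Rcpow x s) x.
Proof. intros; eapply cder_ccont, cder_Rcpow; assumption. Qed.

(** * Improper integrals *)

Notation is_cint f a b l := (is_RInt (V := C_R_NormedModule) f a b l).
Notation ex_cint f a b := (ex_RInt (V := C_R_NormedModule) f a b).
Notation cint f a b := (RInt (V := C_R_CompleteNormedModule) f a b).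

Lemma cint_correct f a b : ex_cint f a b -> is_cint f a b (cint f a b).
Proof. apply (RInt_correct (V := C_R_CompleteNormedModule)). Qed.

Lemma is_cint_unique f a b l : is_cint f a b l -> cint f a b = l.
Proof. apply (is_RInt_unique (V := C_R_CompleteNormedModule)). Qed.

Lemma is_cint_pair f a b l :
  is_RInt (fun t => fst (f t)) a b (fst l) -> is_RInt (fun t => snd (f t)) a b (snd l) ->
  is_cint f a b l.
Proof.
destruct l as [l1 l2]; intros H1 H2.
apply (is_RInt_fct_extend_pair (U := R_NormedModule) (V := R_NormedModule) f a b l1 l2 H1 H2).
Qed.

Lemma is_cint_fst f a b l : is_cint f a b l -> is_RInt (fun t => fst (f t)) a b (fst l).
Proof. intros H; apply (is_RInt_fct_extend_fst (U := R_NormedModule) (V := R_NormedModule) _ _ _ _ H). Qed.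

Lemma is_cint_snd f a b l : is_cint f a b l -> is_RInt (fun t => snd (f t)) a b (snd l).
Proof. intros H; apply (is_RInt_fct_extend_snd (U := R_NormedModule) (V := R_NormedModule) _ _ _ _ H). Qed.

Lemma ex_cint_ccont f a b :
  (forall t, Rmin a b <= t <= Rmax a b -> ccont f t) -> ex_cint f a b.
Proof.
intros H.
assert (H1 : ex_RInt (fun t => fst (f t)) a b).
{ apply (ex_RInt_continuous (V := R_CompleteNormedModule)); intros t Ht.
  apply continuity_pt_filterlim, (proj1 (H t Ht)). }
assert (H2 : ex_RInt (fun t => snd (f t)) a b).
{ apply (ex_RInt_continuous (V := R_CompleteNormedModule)); intros t Ht.
  apply continuity_pt_filterlim, (proj2 (H t Ht)). }
destruct H1 as [l1 H1], H2 as [l2 H2]; exists (l1, l2); now apply is_cint_pair.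
Qed.

Lemma is_cint_ext f g a b l :
  (forall t, Rmin a b < t < Rmax a b -> f t = g t) -> is_cint f a b l -> is_cint g a b l.
Proof. apply is_RInt_ext. Qed.

Lemma is_cint_plus f g a b l m :
  is_cint f a b l -> is_cint g a b m -> is_cint (fun t => (f t + g t)%C) a b (l + m)%C.
Proof. apply (is_RInt_plus (V := C_R_NormedModule)). Qed.

(** The integral lives in a module over the reals, so a complex factor is not a [scal] and has to be
    distributed over the components. *)
Lemma is_cint_scal (c : C) f a b l :
  is_cint f a b l -> is_cint (fun t => (c * f t)%C) a b (c * l)%C.
Proof.
intros H; pose proof (is_cint_fst _ _ _ _ H) as H1; pose proof (is_cint_snd _ _ _ _ H) as H2.
apply is_cint_pair; simpl.
- apply (is_RInt_minus (V := R_NormedModule)); apply (is_RInt_scal (V := R_NormedModule)); assumption.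
- apply (is_RInt_plus (V := R_NormedModule)); apply (is_RInt_scal (V := R_NormedModule)); assumption.
Qed.

Lemma is_cint_opp f a b l :
  is_cint f a b l -> is_cint (fun t => (- f t)%C) a b (- l)%C.
Proof. apply (is_RInt_opp (V := C_R_NormedModule)). Qed.

Lemma is_cint_minus f g a b l m :
  is_cint f a b l -> is_cint g a b m -> is_cint (fun t => (f t - g t)%C) a b (l - m)%C.
Proof. intros; apply is_cint_plus; [| apply is_cint_opp]; assumption. Qed.

Lemma is_cint_Chasles f a b c l m :
  is_cint f a b l -> is_cint f b c m -> is_cint f a c (l + m)%C.
Proof. apply (is_RInt_Chasles (V := C_R_NormedModule)). Qed.

Lemma cint_Chasles f a b c :
  ex_cint f a b -> ex_cint f b c -> cint f a c = (cint f a b + cint f b c)%C.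
Proof.
intros; apply is_cint_unique; eapply is_cint_Chasles; apply cint_correct; assumption.
Qed.

Lemma cint_swap f a b : ex_cint f a b -> cint f b a = (- cint f a b)%C.
Proof.
intros; apply is_cint_unique, (is_RInt_swap (V := C_R_NormedModule)), cint_correct; assumption.
Qed.

Lemma is_cint_bound f g a b l m :
  a <= b -> (forall x, a <= x <= b -> Cmod (f x) <= g x) ->
  is_cint f a b l -> is_RInt g a b m -> Cmod l <= m.
Proof.
intros Hab H Hf Hg; rewrite <- norm_Cmod.
refine (norm_RInt_le _ _ _ _ _ _ Hab _ Hf Hg); intros; rewrite norm_Cmod; auto.
Qed.

Lemma is_cint_bound_const f K a b l :
  a <= b -> (forall x, a <= x <= b -> Cmod (f x) <= K) ->
  is_cint f a b l -> Cmod l <= K * (b - a).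
Proof.
intros Hab H Hf; rewrite <- norm_Cmod, Rmult_comm.
refine (norm_RInt_le_const _ _ _ _ _ Hab _ Hf); intros; rewrite norm_Cmod; auto.
Qed.

Lemma is_cint_derive f df a b :
  (forall x, Rmin a b <= x <= Rmax a b -> cder f x (df x)) ->
  (forall x, Rmin a b <= x <= Rmax a b -> ccont df x) ->
  is_cint df a b (f b - f a)%C.
Proof.
intros H1 H2; apply is_cint_pair.
- apply (is_RInt_derive (V := R_CompleteNormedModule) (fun t => fst (f t)) (fun t => fst (df t)));
  intros x Hx; [apply (proj1 (H1 x Hx)) | apply continuity_pt_filterlim, (proj1 (H2 x Hx))].
- apply (is_RInt_derive (V := R_CompleteNormedModule) (fun t => snd (f t)) (fun t => snd (df t)));
  intros x Hx; [apply (proj2 (H1 x Hx)) | apply continuity_pt_filterlim, (proj2 (H2 x Hx))].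
Qed.

Lemma is_cint_comp_scale f c a b l :
  c <> 0 -> is_cint f (c * a) (c * b) l -> is_cint (fun t => f (c * t)) a b (l / RtoC c)%C.
Proof.
intros Hc H.
assert (H' : is_cint (fun y => scal c (f (c * y + 0))) a b l).
{ apply (is_RInt_comp_lin (V := C_R_NormedModule)); now rewrite !Rplus_0_r. }
apply (is_cint_scal (/ RtoC c)) in H'.
unfold Cdiv; rewrite Cmult_comm; eapply is_cint_ext; [| exact H'].
intros t _; simpl; rewrite Rplus_0_r.
change (scal c (f (c * t))) with (scal (V := C_R_NormedModule) c (f (c * t))).
replace (scal (V := C_R_NormedModule) c (f (c * t))) with (RtoC c * f (c * t)%R)%C.
- rewrite Cmult_assoc, Cinv_l, Cmult_1_l; [reflexivity | injection; auto].
- apply injective_projections; simpl; unfold scal; simpl; unfold mult; simpl; ring.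
Qed.

(** The envelope [env g] has the elementary primitive [envU g], which increases
    from [0] at [0+] to [1] at [+oo]: it dominates the tails of all the improper
    integrals of the proof. *)
Definition envU (g x : R) : R := Rpower x g / (1 + Rpower x g).
Definition env (g x : R) : R := g * Rpower x (g - 1) / (1 + Rpower x g) ^ 2.

Lemma Rpower_pos x y : 0 < Rpower x y.
Proof. apply exp_pos. Qed.

Lemma env_pos g x : 0 < g -> 0 < env g x.
Proof.
intros Hg; unfold env; pose proof (Rpower_pos x g); pose proof (Rpower_pos x (g - 1)).
apply Rdiv_lt_0_compat; [nra | apply pow_lt; lra].
Qed.

Lemma envU_bounds g x : 0 < envU g x < 1.
Proof.
unfold envU; pose proof (Rpower_pos x g); split.
- apply Rdiv_lt_0_compat; lra.
- apply Rmult_lt_reg_r with (1 + Rpower x g); [lra |].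
  unfold Rdiv; rewrite Rmult_assoc, Rinv_l; lra.
Qed.

Lemma is_derive_Rpower x g : 0 < x -> is_derive (fun t => Rpower t g) x (g * Rpower x (g - 1)).
Proof.
intros Hx; unfold Rpower.
auto_derive; [exact Hx |].
replace ((g - 1) * ln x) with (g * ln x + - ln x) by ring.
rewrite exp_plus, exp_Ropp, exp_ln by exact Hx; field; lra.
Qed.

Lemma is_derive_envU g x : 0 < x -> is_derive (envU g) x (env g x).
Proof.
intros Hx; unfold envU, env.
pose proof (is_derive_Rpower x g Hx) as H; pose proof (Rpower_pos x g).
eapply is_derive_eq.
- apply is_derive_div; [exact H | | lra].
  apply (is_derive_plus (V := R_NormedModule)); [apply (is_derive_const (V := R_NormedModule)) | exact H].
- unfold plus, zero; simpl; field; lra.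
Qed.

Lemma continuous_env g x : 0 < x -> continuous (env g) x.
Proof.
intros Hx; unfold env.
apply (ex_derive_continuous (K := R_AbsRing) (V := R_NormedModule)).
pose proof (is_derive_Rpower x g Hx); pose proof (is_derive_Rpower x (g - 1) Hx).
pose proof (Rpower_pos x g).
auto_derive; repeat split; try (eexists; eassumption).
apply Rgt_not_eq, Rmult_lt_0_compat; lra.
Qed.

Lemma is_RInt_env g K x y : 0 < x -> x <= y ->
  is_RInt (fun t => K * env g t) x y (K * (envU g y - envU g x)).
Proof.
intros Hx Hxy; apply (is_RInt_scal (V := R_NormedModule)).
apply (is_RInt_derive (V := R_CompleteNormedModule)); intros t Ht;
  rewrite Rmin_left, Rmax_right in Ht by assumption.
- apply is_derive_envU; lra.
- apply continuous_env; lra.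
Qed.

Lemma Rpower_le_base x y g : 0 <= g -> 0 < x -> x <= y -> Rpower x g <= Rpower y g.
Proof. intros; apply Rle_Rpower_l; lra. Qed.

Lemma envU_le g x : envU g x <= Rpower x g.
Proof.
unfold envU; pose proof (Rpower_pos x g).
apply Rmult_le_reg_r with (1 + Rpower x g); [lra |].
unfold Rdiv; rewrite Rmult_assoc, Rinv_l; nra.
Qed.

Lemma one_minus_envU g x : 1 - envU g x <= / Rpower x g.
Proof.
unfold envU; pose proof (Rpower_pos x g).
replace (1 - _) with (/ (1 + Rpower x g)) by (field; lra).
apply Rinv_le_contravar; lra.
Qed.

(** The symmetry [envU g (1 / x) = 1 - envU g x] lets a single threshold, the [g]-th root of [eta],
    control both ends. *)
Lemma envU_ends g eta : 0 < g -> 0 < eta ->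
  exists d, 0 < d /\ (forall x, 0 < x < d -> envU g x <= eta) /\
    (forall y, / d < y -> 1 - envU g y <= eta).
Proof.
intros Hg He; exists (Rpower eta (/ g)).
assert (E : Rpower (Rpower eta (/ g)) g = eta).
{ rewrite Rpower_mult, Rinv_l, Rpower_1; lra. }
pose proof (Rpower_pos eta (/ g)) as Hd; split; [exact Hd | split].
- intros x Hx; eapply Rle_trans; [apply envU_le |].
  rewrite <- E; apply Rpower_le_base; lra.
- intros y Hy; eapply Rle_trans; [apply one_minus_envU |].
  pose proof (Rinv_0_lt_compat _ Hd).
  assert (H1 : / y <= Rpower eta (/ g)).
  { rewrite <- (Rinv_inv (Rpower eta (/ g))); apply Rinv_le_contravar; lra. }
  rewrite <- Rpower_Ropp, <- E.
  replace (Rpower y (- g)) with (Rpower (/ y) g).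
  + apply Rpower_le_base; [lra | apply Rinv_0_lt_compat; lra | exact H1].
  + unfold Rpower; rewrite ln_Rinv by lra; f_equal; ring.
Qed.

(** * Convergence and domination on the half-line *)

Definition loc_int (f : R -> C) : Prop :=
  forall x y, 0 < x -> 0 < y -> ex_cint f x y.

(** Epsilon form of [is_CInt_0_infty], with one [d] for both ends and local integrability recorded,
    so that every [cint] in it is a genuine integral. *)
Definition improper (f : R -> C) (l : C) : Prop :=
  loc_int f /\ forall eta, 0 < eta -> exists d, 0 < d /\
    forall x y, 0 < x < d -> / d < y -> Cmod (cint f x y - l) <= eta.

Lemma loc_int_ccont f : (forall x, 0 < x -> ccont f x) -> loc_int f.
Proof.
intros H x y Hx Hy; apply ex_cint_ccont; intros t [Ht _]; apply H.
eapply Rlt_le_trans; [| exact Ht]; now apply Rmin_glb_lt.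
Qed.

Lemma loc_int_ext f g : (forall x, 0 < x -> f x = g x) -> loc_int f -> loc_int g.
Proof.
intros E H x y Hx Hy; destruct (H x y Hx Hy) as [l Hl]; exists l.
eapply is_cint_ext; [| exact Hl]; intros t [Ht _]; apply E.
eapply Rlt_trans; [| exact Ht]; now apply Rmin_glb_lt.
Qed.

Lemma cint_ext_pos f g x y : (forall x, 0 < x -> f x = g x) -> loc_int f -> 0 < x -> 0 < y ->
  cint g x y = cint f x y.
Proof.
intros E H Hx Hy; apply is_cint_unique.
eapply is_cint_ext; [| apply cint_correct, H; assumption]; intros t [Ht _]; apply E.
eapply Rlt_trans; [| exact Ht]; now apply Rmin_glb_lt.
Qed.

Lemma env_const_nonneg (f : R -> C) g K : 0 < g ->
  (forall x, 0 < x -> Cmod (f x) <= K * env g x) -> 0 <= K.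
Proof.
intros Hg B; pose proof (B 1 Rlt_0_1); pose proof (env_pos g 1 Hg).
pose proof (Cmod_ge_0 (f 1)); nra.
Qed.

Lemma cint_env_bound_le f g K x y : loc_int f ->
  (forall t, x <= t <= y -> Cmod (f t) <= K * env g t) ->
  0 < x -> x <= y -> Cmod (cint f x y) <= K * (envU g y - envU g x).
Proof.
intros L B Hx Hxy; eapply (is_cint_bound f (fun t => K * env g t) x y); auto.
- apply cint_correct, L; lra.
- apply is_RInt_env; assumption.
Qed.

Lemma cint_env_bound f g K x y : 0 < g -> loc_int f ->
  (forall x, 0 < x -> Cmod (f x) <= K * env g x) ->
  0 < x -> 0 < y -> Cmod (cint f x y) <= K * Rabs (envU g y - envU g x).
Proof.
intros Hg L B Hx Hy; pose proof (env_const_nonneg f g K Hg B) as HK.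
assert (G : forall u v, 0 < u -> u <= v -> Cmod (cint f u v) <= K * Rabs (envU g v - envU g u)).
{ intros u v Hu Huv; eapply Rle_trans.
  - apply (cint_env_bound_le f g K); auto; intros; apply B; lra.
  - apply Rmult_le_compat_l; [exact HK | apply Rle_abs]. }
destruct (Rle_dec x y) as [H | H]; [now apply G |].
rewrite cint_swap by (apply L; assumption).
rewrite Cmod_opp, Rabs_minus_sym; apply G; lra.
Qed.

Lemma improper_is f l : improper f l -> is_CInt_0_infty f l.
Proof.
intros [L H] P [eps HP].
destruct (H (eps / 2)) as [d [Hd B]]; [destruct eps; simpl; lra |].
assert (N1 : at_right 0 (fun x => 0 < x < d)).
{ exists (mkposreal d Hd); intros x Hx Hx0; split; [exact Hx0 |].
  unfold ball in Hx; simpl in Hx; unfold AbsRing_ball, abs, minus, plus, opp in Hx; simpl in Hx.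
  apply Rabs_lt_between in Hx; lra. }
assert (N2 : Rbar_locally p_infty (fun y => / d < y)) by (exists (/ d); auto).
unfold filtermapi; eapply Filter_prod; [exact N1 | exact N2 |].
intros x y Hx Hy; exists (cint f x y); simpl; split.
- apply cint_correct, L; [lra | pose proof (Rinv_0_lt_compat _ Hd); lra].
- apply HP.
  assert (Hb : forall r : R, Rabs r <= Cmod (cint f x y - l) -> Rabs r < eps).
  { intros r Hr; pose proof (B x y Hx Hy); destruct eps; simpl in *; lra. }
  split; apply Hb; [apply (Re_le_Cmod (_ - _)%C) | apply (Im_le_Cmod (_ - _)%C)].
Qed.

Lemma CInt_0_infty_unique f l : is_CInt_0_infty f l -> CInt_0_infty f = l.
Proof.
intros H; unfold CInt_0_infty, is_CInt_0_infty.
change (RInt_gen (V := C_R_CompleteNormedModule) f (at_right 0) (Rbar_locally p_infty) = l).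
apply (is_RInt_gen_unique (V := C_R_CompleteNormedModule)); assumption.
Qed.

Lemma improper_CInt f l : improper f l -> CInt_0_infty f = l.
Proof. intros H; apply CInt_0_infty_unique, improper_is, H. Qed.

Lemma improper_unique f l m : improper f l -> improper f m -> l = m.
Proof. intros H1 H2; now rewrite <- (improper_CInt _ _ H1), (improper_CInt _ _ H2). Qed.

(** Two truncated integrals differ by the integrals over [[x', x]] and [[y, y']], each at most [K]
    times an increment of [envU g]; this is the Cauchy criterion. Dividing by [K + 1] instead of [K]
    covers [K = 0]. *)
Lemma improper_exists f g K : 0 < g -> loc_int f ->
  (forall x, 0 < x -> Cmod (f x) <= K * env g x) -> exists l, improper f l.
Proof.
intros Hg L B; pose proof (env_const_nonneg f g K Hg B) as HK.
set (F := filter_prod (at_right 0) (Rbar_locally p_infty)).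
set (I := fun ab : R * R => cint f (fst ab) (snd ab)).
assert (Q : forall eta, 0 < eta -> exists d, 0 < d /\ forall x y x' y', 0 < x < d -> 0 < x' < d ->
  / d < y -> / d < y' -> Cmod (cint f x' y' - cint f x y) <= eta).
{ intros eta He; destruct (envU_ends g (eta / 2 / (K + 1)) Hg) as [d [Hd [U1 U2]]].
  { apply Rdiv_lt_0_compat; lra. }
  exists d; split; [exact Hd |]; intros x y x' y' Hx Hx' Hy Hy'.
  pose proof (Rinv_0_lt_compat _ Hd).
  rewrite (cint_Chasles f x' x y'), (cint_Chasles f x y y') by (apply L; lra).
  replace (cint f x' x + (cint f x y + cint f y y') - cint f x y)%C
    with (cint f x' x + cint f y y')%C by ring.
  eapply Rle_trans; [apply Cmod_triangle |].
  pose proof (cint_env_bound f g K x' x Hg L B ltac:(lra) ltac:(lra)).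
  pose proof (cint_env_bound f g K y y' Hg L B ltac:(lra) ltac:(lra)).
  set (w := eta / 2 / (K + 1)) in *.
  assert (Hw : 0 < w) by (apply Rdiv_lt_0_compat; lra).
  assert (Ew : w * (K + 1) = eta / 2) by (unfold w; field; lra).
  assert (Rabs (envU g x - envU g x') <= w).
  { pose proof (U1 x Hx); pose proof (U1 x' Hx').
    pose proof (envU_bounds g x); pose proof (envU_bounds g x').
    apply Rabs_le; lra. }
  assert (Rabs (envU g y' - envU g y) <= w).
  { pose proof (U2 y Hy); pose proof (U2 y' Hy').
    pose proof (envU_bounds g y); pose proof (envU_bounds g y').
    apply Rabs_le; lra. }
  nra. }
destruct (proj1 (filterlim_locally_cauchy (U := C_R_CompleteNormedModule) (F := F) I)) as [l Hl].
{ intros eps; destruct (Q (eps / 2)) as [d [Hd Hq]]; [destruct eps; simpl; lra |].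
  exists (fun ab : R * R => 0 < fst ab < d /\ / d < snd ab); split.
  - apply Filter_prod with (fun x => 0 < x < d) (fun y => / d < y).
    + exists (mkposreal d Hd); intros x Hx Hx0; split; [exact Hx0 |].
      unfold ball in Hx; simpl in Hx; unfold AbsRing_ball, abs, minus, plus, opp in Hx; simpl in Hx.
      apply Rabs_lt_between in Hx; lra.
    + exists (/ d); auto.
    + auto.
  - intros [x y] [x' y'] [Hx Hy] [Hx' Hy']; simpl in *.
    specialize (Hq x y x' y' Hx Hx' Hy Hy').
    assert (Hb : forall r : R, Rabs r <= Cmod (I (x', y') - I (x, y)) -> Rabs r < eps).
    { intros r Hr; unfold I in Hr; simpl in Hr; destruct eps; simpl in *; lra. }
    split; apply Hb; [apply (Re_le_Cmod (_ - _)%C) | apply (Im_le_Cmod (_ - _)%C)]. }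
exists l; split; [exact L |]; intros eta He.
destruct (Q (eta / 2)) as [d [Hd Hq]]; [lra |].
exists d; split; [exact Hd |]; intros x y Hx Hy.
assert (He' : 0 < eta / 4) by lra.
assert (T := Hl _ (locally_ball l (mkposreal _ He'))).
assert (N : F (fun ab => 0 < fst ab < d /\ / d < snd ab)).
{ apply Filter_prod with (fun x => 0 < x < d) (fun y => / d < y).
  + exists (mkposreal d Hd); intros t Ht Ht0; split; [exact Ht0 |].
    unfold ball in Ht; simpl in Ht; unfold AbsRing_ball, abs, minus, plus, opp in Ht; simpl in Ht.
    apply Rabs_lt_between in Ht; lra.
  + exists (/ d); auto.
  + auto. }
assert (FP : ProperFilter F)
  by (apply filter_prod_proper).
assert (TN : F (fun ab => ball (M := C_R_CompleteNormedModule) l (eta / 4) (I ab) /\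
  (0 < fst ab < d /\ / d < snd ab))).
{ apply (filter_and (F := F)); [exact T | exact N]. }
destruct (filter_ex _ TN) as [[x' y'] [T' [Hx' Hy']]]; simpl in Hx', Hy'.
specialize (Hq x' y' x y Hx' Hx Hy' Hy).
replace (cint f x y - l)%C with ((cint f x y - cint f x' y') + (cint f x' y' - l))%C by ring.
eapply Rle_trans; [apply Cmod_triangle |].
pose proof (Cmod_le_sum (cint f x' y' - l)) as S.
assert (T1 : Rabs (fst (cint f x' y' - l)%C) < eta / 4) by exact (proj1 T').
assert (T2 : Rabs (snd (cint f x' y' - l)%C) < eta / 4) by exact (proj2 T').
lra.
Qed.

Lemma improper_ext f g l : (forall x, 0 < x -> f x = g x) -> improper f l -> improper g l.
Proof.
intros E [L H]; split; [now apply loc_int_ext with f |]; intros eta He.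
destruct (H eta He) as [d [Hd B]]; exists d; split; [exact Hd |]; intros x y Hx Hy.
pose proof (Rinv_0_lt_compat _ Hd).
rewrite (cint_ext_pos f g) by (auto; lra); now apply B.
Qed.

Lemma improper_plus f g l m :
  improper f l -> improper g m -> improper (fun x => (f x + g x)%C) (l + m)%C.
Proof.
intros [L1 H1] [L2 H2]; split.
- intros x y Hx Hy; eexists; apply is_cint_plus; apply cint_correct; auto.
- intros eta He; destruct (H1 (eta / 2)) as [d1 [Hd1 B1]]; [lra |].
  destruct (H2 (eta / 2)) as [d2 [Hd2 B2]]; [lra |].
  exists (Rmin d1 d2); split; [now apply Rmin_glb_lt |]; intros x y Hx Hy.
  assert (0 < Rmin d1 d2) by now apply Rmin_glb_lt.
  pose proof (Rmin_l d1 d2); pose proof (Rmin_r d1 d2).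
  assert (/ d1 <= / Rmin d1 d2) by (apply Rinv_le_contravar; lra).
  assert (/ d2 <= / Rmin d1 d2) by (apply Rinv_le_contravar; lra).
  pose proof (Rinv_0_lt_compat _ Hd1).
  specialize (B1 x y ltac:(lra) ltac:(lra)); specialize (B2 x y ltac:(lra) ltac:(lra)).
  erewrite (is_cint_unique (fun x => (f x + g x)%C));
    [| apply is_cint_plus; apply cint_correct; [apply L1 | apply L2]; lra].
  replace (_ - _)%C with ((cint f x y - l) + (cint g x y - m))%C by ring.
  eapply Rle_trans; [apply Cmod_triangle | lra].
Qed.

Lemma improper_scal c f l : improper f l -> improper (fun x => (c * f x)%C) (c * l)%C.
Proof.
intros [L1 H1]; split.
- intros x y Hx Hy; eexists; apply is_cint_scal, cint_correct; auto.
- intros eta He; destruct (H1 (eta / (Cmod c + 1))) as [d [Hd B]].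
  { apply Rdiv_lt_0_compat; [exact He | pose proof (Cmod_ge_0 c); lra]. }
  exists d; split; [exact Hd |]; intros x y Hx Hy.
  pose proof (Rinv_0_lt_compat _ Hd).
  erewrite (is_cint_unique (fun x => (c * f x)%C));
    [| apply is_cint_scal, cint_correct, L1; lra].
  replace (_ - _)%C with (c * (cint f x y - l))%C by ring.
  rewrite Cmod_mult; pose proof (Cmod_ge_0 c).
  apply Rle_trans with ((Cmod c + 1) * (eta / (Cmod c + 1))); [| right; field; lra].
  apply Rmult_le_compat; auto using Cmod_ge_0; lra.
Qed.

Lemma improper_minus f g l m :
  improper f l -> improper g m -> improper (fun x => (f x - g x)%C) (l - m)%C.
Proof.
intros H1 H2; replace (l - m)%C with (l + (- (1)) * m)%C by ring.
eapply improper_ext; [| exact (improper_plus _ _ _ _ H1 (improper_scal (- (1))%C _ _ H2))].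
intros; simpl; ring.
Qed.

Lemma improper_comp_scale f l c : 0 < c ->
  improper f l -> improper (fun x => f (c * x)%R) (l / RtoC c)%C.
Proof.
intros Hc [L H]; split.
- intros x y Hx Hy; eexists; apply is_cint_comp_scale; [lra |].
  apply cint_correct, L; apply Rmult_lt_0_compat; assumption.
- intros eta He; destruct (H (eta * c)) as [d [Hd B]]; [now apply Rmult_lt_0_compat |].
  pose proof (Rinv_0_lt_compat _ Hd); pose proof (Rinv_0_lt_compat _ Hc).
  set (e := Rmin (d / c) (d * c)).
  assert (He' : 0 < e) by (apply Rmin_glb_lt; [apply Rdiv_lt_0_compat | apply Rmult_lt_0_compat]; auto).
  exists e; split; [exact He' |]; intros x y Hx Hy.
  pose proof (Rinv_0_lt_compat _ He').
  assert (X : 0 < c * x < d).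
  { split; [apply Rmult_lt_0_compat; lra |].
    apply Rmult_lt_reg_l with (/ c); [lra |]; rewrite <- Rmult_assoc, Rinv_l, Rmult_1_l by lra.
    pose proof (Rmin_l (d / c) (d * c)); unfold e, Rdiv in *; lra. }
  assert (Y : / d < c * y).
  { apply Rmult_lt_reg_l with (/ c); [lra |]; rewrite <- (Rmult_assoc (/ c) c), Rinv_l, Rmult_1_l by lra.
    eapply Rle_lt_trans; [| exact Hy].
    rewrite <- Rinv_mult, Rmult_comm; apply Rinv_le_contravar; [exact He' | apply Rmin_r]. }
  erewrite (is_cint_unique (fun x => f (c * x)));
    [| apply is_cint_comp_scale; [lra |]; apply cint_correct, L; lra].
  assert (Hc' : RtoC c <> 0%C) by (injection; lra).
  replace (_ - _)%C with ((cint f (c * x)%R (c * y)%R - l) / RtoC c)%C by (field; exact Hc').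
  rewrite Cmod_div, Cmod_R, Rabs_pos_eq by (auto; lra).
  apply Rmult_le_reg_r with c; [lra |]; unfold Rdiv; rewrite Rmult_assoc, Rinv_l, Rmult_1_r by lra.
  now apply B.
Qed.

(** The envelope [env g] has total mass [1], so [K] itself bounds the integral. *)
Lemma improper_bound f l g K : 0 < g ->
  improper f l -> (forall x, 0 < x -> Cmod (f x) <= K * env g x) -> Cmod l <= K.
Proof.
intros Hg [L H] B; apply le_epsilon; intros eta He.
pose proof (env_const_nonneg f g K Hg B) as HK.
destruct (H eta He) as [d [Hd B']].
pose proof (Rinv_0_lt_compat _ Hd).
specialize (B' (d / 2) (/ d + 1) ltac:(lra) ltac:(lra)).
pose proof (cint_env_bound f g K (d / 2) (/ d + 1) Hg L B ltac:(lra) ltac:(lra)) as B2.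
assert (Rabs (envU g (/ d + 1) - envU g (d / 2)) <= 1).
{ pose proof (envU_bounds g (/ d + 1)); pose proof (envU_bounds g (d / 2)); apply Rabs_le; lra. }
replace l with (cint f (d / 2)%R (/ d + 1)%R - (cint f (d / 2)%R (/ d + 1)%R - l))%C by ring.
eapply Rle_trans; [apply Cmod_triangle |]; rewrite Cmod_opp; nra.
Qed.

Lemma improper_close f h l m g K : 0 < g ->
  improper f l -> improper h m -> (forall x, 0 < x -> Cmod (f x - h x) <= K * env g x) ->
  Cmod (l - m) <= K.
Proof.
intros Hg Hf Hh B; apply (improper_bound _ _ g K Hg (improper_minus _ _ _ _ Hf Hh) B).
Qed.

Lemma exp_le x y : x <= y -> exp x <= exp y.
Proof. intros [H | ->]; [left; now apply exp_increasing | apply Rle_refl]. Qed.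

Lemma Rpower_exp_bounded m c : 0 <= m -> 0 < c ->
  exists K, 0 < K /\ forall x, 0 < x -> Rpower x m * exp (- (c * x)) <= K.
Proof.
(* [ln] is bounded by the line [x / t + ln t]. The numerator [m + 1] keeps [t] positive when
   [m = 0], and [m * (x / t)] stays below [c * x]. *)
intros Hm Hc; set (t := (m + 1) / c).
assert (Ht : 0 < t) by (apply Rdiv_lt_0_compat; lra).
exists (exp (m * ln t)); split; [apply exp_pos |]; intros x Hx.
unfold Rpower; rewrite <- exp_plus; apply exp_le.
assert (L : ln x <= x / t + ln t).
{ replace x with (x / t * t) at 1 by (field; lra).
  assert (0 < x / t) by now apply Rdiv_lt_0_compat.
  rewrite ln_mult by assumption.
  pose proof (exp_ineq1_le (ln (x / t))) as E; rewrite exp_ln in E by assumption; lra. }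
assert (m * (x / t) <= c * x).
{ unfold t; replace (m * (x / ((m + 1) / c))) with (c * x * (m / (m + 1))) by (field; lra).
  rewrite <- (Rmult_1_r (c * x)) at 2; apply Rmult_le_compat_l; [nra |].
  apply Rmult_le_reg_r with (m + 1); [lra |]; unfold Rdiv; rewrite Rmult_assoc, Rinv_l; lra. }
nra.
Qed.

(** After division by [x ^ (g - 1)], the envelope leaves [(1 + X) ^ 2] with [X = x ^ g], which is at
    most [2 + 2 X ^ 2]. The two resulting powers of [x], namely [k] and [k + 2 g], are absorbed by
    the exponential and give [K1] and [K2]. *)
Lemma Rpower_exp_env g k c : 0 < g -> 0 <= k -> 0 < c ->
  exists K, 0 < K /\ forall x, 0 < x -> Rpower x (g - 1 + k) * exp (- (c * x)) <= K * env g x.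
Proof.
intros Hg Hk Hc.
destruct (Rpower_exp_bounded k c Hk Hc) as [K1 [HK1 B1]].
destruct (Rpower_exp_bounded (k + g + g) c ltac:(lra) Hc) as [K2 [HK2 B2]].
exists ((2 * K1 + 2 * K2) / g); split; [apply Rdiv_lt_0_compat; lra |]; intros x Hx.
specialize (B1 x Hx); specialize (B2 x Hx).
unfold env; pose proof (Rpower_pos x (g - 1)) as P1; pose proof (Rpower_pos x g) as P2.
pose proof (Rpower_pos x k) as P3; pose proof (exp_pos (- (c * x))) as P4.
rewrite Rpower_plus; rewrite (Rpower_plus (k + g) g x), (Rpower_plus k g x) in B2.
set (A := Rpower x (g - 1)) in *; set (X := Rpower x g) in *; set (Y := Rpower x k) in *.
set (E := exp (- (c * x))) in *.
replace ((2 * K1 + 2 * K2) / g * (g * A / (1 + X) ^ 2))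
  with (A * (2 * K1 + 2 * K2) / (1 + X) ^ 2) by (field; split; lra).
apply Rmult_le_reg_r with ((1 + X) ^ 2); [apply pow_lt; lra |].
unfold Rdiv; rewrite (Rmult_assoc _ (/ _)), Rinv_l, Rmult_1_r by (apply pow_nonzero; lra).
rewrite !Rmult_assoc; apply Rmult_le_compat_l; [lra |].
assert (0 <= Y * E) by nra.
apply Rle_trans with (2 * (Y * E) + 2 * (Y * X * X * E)); [| lra].
replace (2 * (Y * E) + 2 * (Y * X * X * E)) with (Y * E * (2 + 2 * (X * X))) by ring.
rewrite <- Rmult_assoc; apply Rmult_le_compat_l; [assumption |].
assert (0 <= (1 - X) ^ 2) by apply pow2_ge_0; lra.
Qed.


(** Near [0] the power is small and the exponential at most [1]; at infinity one spare factor [x]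
    turns boundedness into decay. Hence the minimum of two thresholds. *)
Lemma Rpower_exp_ends g c eta : 0 < g -> 0 < c -> 0 < eta -> exists d, 0 < d /\
  forall v, 0 < v -> v < d \/ / d < v -> Rpower v g * exp (- (c * v)) <= eta.
Proof.
intros Hg Hc He; destruct (Rpower_exp_bounded (g + 1) c ltac:(lra) Hc) as [K [HK B]].
exists (Rmin (Rpower eta (/ g)) (eta / K)).
assert (P1 := Rpower_pos eta (/ g)).
assert (P2 : 0 < eta / K) by (apply Rdiv_lt_0_compat; lra).
split; [now apply Rmin_glb_lt |]; intros v Hv [Hd | Hd].
- apply Rle_trans with (Rpower v g * 1).
  + apply Rmult_le_compat_l; [left; apply Rpower_pos |].
    rewrite <- exp_0; apply exp_le; nra.
  + rewrite Rmult_1_r; replace eta with (Rpower (Rpower eta (/ g)) g)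
      by (rewrite Rpower_mult, Rinv_l, Rpower_1; lra).
    apply Rpower_le_base; [lra | lra |].
    pose proof (Rmin_l (Rpower eta (/ g)) (eta / K)); lra.
- specialize (B v Hv); rewrite Rpower_plus, Rpower_1 in B by exact Hv.
  assert (Y : K / eta < v).
  { eapply Rle_lt_trans; [| exact Hd].
    replace (K / eta) with (/ (eta / K)) by (field; lra).
    apply Rinv_le_contravar; [now apply Rmin_glb_lt | apply Rmin_r]. }
  apply Rmult_le_reg_r with v; [exact Hv |].
  apply Rle_trans with K; [lra |].
  apply Rmult_lt_compat_l with (r := eta) in Y; [| exact He].
  replace (eta * (K / eta)) with K in Y by (field; lra); lra.
Qed.

(** * Rotation of the line of integration *)

(** Joint continuity in the angle and the radius is the form needed for differentiation under the
    integral sign. *)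
Definition ccont2 (F : R -> R -> C) (u v : R) : Prop :=
  continuity_2d_pt (fun a b => fst (F a b)) u v /\
  continuity_2d_pt (fun a b => snd (F a b)) u v.

Lemma ccont2_const c u v : ccont2 (fun _ _ => c) u v.
Proof. split; apply continuity_2d_pt_const. Qed.

Lemma ccont2_plus F G u v :
  ccont2 F u v -> ccont2 G u v -> ccont2 (fun a b => F a b + G a b)%C u v.
Proof. intros [H1 H2] [H3 H4]; split; simpl; apply continuity_2d_pt_plus; assumption. Qed.

Lemma ccont2_mult F G u v :
  ccont2 F u v -> ccont2 G u v -> ccont2 (fun a b => F a b * G a b)%C u v.
Proof.
intros [H1 H2] [H3 H4]; split; simpl;
  [apply continuity_2d_pt_minus | apply continuity_2d_pt_plus];
  apply continuity_2d_pt_mult; assumption.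
Qed.

Lemma ccont2_inv F u v : ccont2 F u v -> F u v <> 0%C -> ccont2 (fun a b => / F a b)%C u v.
Proof.
intros [H1 H2] N; apply C_neq_0_sqr in N.
assert (D : continuity_2d_pt (fun a b => fst (F a b) ^ 2 + snd (F a b) ^ 2) u v).
{ apply continuity_2d_pt_plus; simpl; apply continuity_2d_pt_mult; auto;
  apply continuity_2d_pt_mult; auto; apply continuity_2d_pt_const. }
assert (D' : continuity_2d_pt (fun a b => / (fst (F a b) ^ 2 + snd (F a b) ^ 2)) u v).
{ apply continuity_2d_pt_inv; [exact D | simpl; rewrite !Rmult_1_r; exact N]. }
split; simpl; apply continuity_2d_pt_mult; auto; now apply continuity_2d_pt_opp.
Qed.

Lemma ccont2_Cexp F u v : ccont2 F u v -> ccont2 (fun a b => Cexp (F a b)) u v.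
Proof.
intros [H1 H2].
assert (E : continuity_2d_pt (fun a b => exp (fst (F a b))) u v).
{ apply continuity_1d_2d_pt_comp; [apply derivable_continuous_pt, derivable_pt_exp | exact H1]. }
assert (K : continuity_2d_pt (fun a b => cos (snd (F a b))) u v).
{ apply continuity_1d_2d_pt_comp; [apply continuity_cos | exact H2]. }
assert (S : continuity_2d_pt (fun a b => sin (snd (F a b))) u v).
{ apply continuity_1d_2d_pt_comp; [apply continuity_sin | exact H2]. }
split; unfold Cexp, Re, Im; simpl; [apply continuity_2d_pt_minus | apply continuity_2d_pt_plus];
  apply continuity_2d_pt_mult; auto; apply continuity_2d_pt_const.
Qed.

Lemma ccont2_fst f u v : ccont f u -> ccont2 (fun a _ => f a) u v.
Proof.
intros [H1 H2]; split.
- apply (continuity_1d_2d_pt_comp (fun x => fst (f x)) (fun a _ => a));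
    [exact H1 | apply continuity_2d_pt_id1].
- apply (continuity_1d_2d_pt_comp (fun x => snd (f x)) (fun a _ => a));
    [exact H2 | apply continuity_2d_pt_id1].
Qed.

Lemma ccont2_snd f u v : ccont f v -> ccont2 (fun _ b => f b) u v.
Proof.
intros [H1 H2]; split.
- apply (continuity_1d_2d_pt_comp (fun x => fst (f x)) (fun _ b => b));
    [exact H1 | apply continuity_2d_pt_id2].
- apply (continuity_1d_2d_pt_comp (fun x => snd (f x)) (fun _ b => b));
    [exact H2 | apply continuity_2d_pt_id2].
Qed.

(** [s] is a sign: [1] sweeps the first quadrant and [-1] the fourth, so both rotations share one
    proof. *)
Definition ray (s theta : R) : C := (cos theta, s * sin theta).
Definition polar (s theta r : R) : C := (RtoC r * ray s theta)%C.

Lemma cder_eq f t l m : cder f t l -> l = m -> cder f t m.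
Proof. now intros H <-. Qed.

Lemma cder_ray s theta : s * s = 1 -> cder (ray s) theta (Ci * RtoC s * ray s theta).
Proof.
intros Hs; split; unfold ray; simpl.
- auto_derive; [exact I |].
  transitivity (- (s * s) * sin theta); [rewrite Hs | ]; ring.
- auto_derive; [exact I | ring].
Qed.

(** [F] behaves like a function of [z = polar s theta r] with complex derivative
    [F1]: its partial derivatives are [F1] times those of [z]. *)
Definition hol (s : R) (F F1 : R -> R -> C) (theta r : R) : Prop :=
  cder (fun a => F a r) theta (F1 theta r * (Ci * RtoC s * polar s theta r)) /\
  cder (fun b => F theta b) r (F1 theta r * ray s theta) /\
  ccont2 F theta r /\ ccont2 F1 theta r.

Lemma hol_const s c theta r : hol s (fun _ _ => c) (fun _ _ => 0%C) theta r.
Proof.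
split; [| split; [| split]]; try apply ccont2_const;
  (eapply cder_eq; [apply cder_const | ring]).
Qed.

Lemma ccont2_ray s u v : s * s = 1 -> ccont2 (fun a _ => ray s a) u v.
Proof. intros; apply ccont2_fst; eapply cder_ccont, cder_ray; assumption. Qed.

Lemma hol_id s theta r : s * s = 1 -> hol s (polar s) (fun _ _ => 1%C) theta r.
Proof.
intros Hs; unfold polar; split; [| split; [| split]].
- eapply cder_eq; [apply cder_mult; [apply cder_const | now apply cder_ray] | unfold polar; ring].
- eapply cder_eq; [apply cder_mult; [| apply cder_const] |].
  + apply cder_RtoC, (is_derive_id (K := R_AbsRing)).
  + unfold one; simpl; ring.
- apply ccont2_mult; [| now apply ccont2_ray].
  apply ccont2_snd, ccont_RtoC, derivable_continuous_pt, derivable_pt_id.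
- apply ccont2_const.
Qed.

Lemma hol_plus s F F1 G G1 theta r : hol s F F1 theta r -> hol s G G1 theta r ->
  hol s (fun a b => F a b + G a b)%C (fun a b => F1 a b + G1 a b)%C theta r.
Proof.
intros (A1 & A2 & A3 & A4) (B1 & B2 & B3 & B4); split; [| split; [| split]].
- eapply cder_eq; [apply cder_plus; eassumption | ring].
- eapply cder_eq; [apply cder_plus; eassumption | ring].
- now apply ccont2_plus.
- now apply ccont2_plus.
Qed.

Lemma hol_mult s F F1 G G1 theta r : hol s F F1 theta r -> hol s G G1 theta r ->
  hol s (fun a b => F a b * G a b)%C (fun a b => F1 a b * G a b + F a b * G1 a b)%C theta r.
Proof.
intros (A1 & A2 & A3 & A4) (B1 & B2 & B3 & B4); split; [| split; [| split]].
- eapply cder_eq; [apply (cder_mult _ _ _ _ _ A1 B1) | ring].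
- eapply cder_eq; [apply (cder_mult _ _ _ _ _ A2 B2) | ring].
- now apply ccont2_mult.
- apply ccont2_plus; now apply ccont2_mult.
Qed.

Lemma hol_inv s F F1 theta r : hol s F F1 theta r -> F theta r <> 0%C ->
  hol s (fun a b => / F a b)%C (fun a b => - (1) * F1 a b * / (F a b * F a b))%C theta r.
Proof.
intros (A1 & A2 & A3 & A4) N; split; [| split; [| split]].
- eapply cder_eq; [apply (cder_inv _ _ _ A1 N) | field; exact N].
- eapply cder_eq; [apply (cder_inv _ _ _ A2 N) | field; exact N].
- now apply ccont2_inv.
- apply ccont2_mult; [apply ccont2_mult; [apply ccont2_const | exact A4] |].
  apply ccont2_inv; [now apply ccont2_mult | now apply Cmult_neq_0].
Qed.

Lemma hol_Cexp s F F1 theta r : hol s F F1 theta r ->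
  hol s (fun a b => Cexp (F a b)) (fun a b => F1 a b * Cexp (F a b))%C theta r.
Proof.
intros (A1 & A2 & A3 & A4); split; [| split; [| split]].
- eapply cder_eq; [apply (cder_Cexp _ _ _ A1) | ring].
- eapply cder_eq; [apply (cder_Cexp _ _ _ A2) | ring].
- now apply ccont2_Cexp.
- apply ccont2_mult; [exact A4 | now apply ccont2_Cexp].
Qed.

Lemma continuity_2d_pt_slice f u v : continuity_2d_pt f u v -> continuous (f u) v.
Proof.
intros H; apply continuity_pt_filterlim; intros eps He.
destruct (H (mkposreal eps He)) as [d Hd]; exists d; split; [apply cond_pos |].
intros x [_ Hx]; apply Hd; [rewrite Rminus_diag, Rabs_R0; apply cond_pos | exact Hx].
Qed.

(** Cauchy's theorem on an annular sector, in real terms: when the angular derivative of [f] is also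
    the radial derivative of [B], the integral of [f] along a ray has as angular derivative the
    difference of [B] at the two ends. The margins [m] and [b + 1] provide the open neighbourhood
    that this differentiation requires at the boundary. *)
Lemma rotation_real (f d B : R -> R -> R) (m a b M : R) :
  0 < m -> 0 < a -> a <= b ->
  (forall u v, - m < u < PI / 2 + m -> 0 < v < b + 1 ->
     is_derive (fun u => f u v) u (d u v) /\ is_derive (fun v => B u v) v (d u v) /\
     continuity_2d_pt f u v /\ continuity_2d_pt d u v) ->
  (forall u, 0 <= u <= PI / 2 -> Rabs (B u b - B u a) <= M) ->
  Rabs (RInt (f 0) a b - RInt (f (PI / 2)) a b) <= M * (PI / 2).
Proof.
intros Hm Ha Hab H HB.
assert (Hpi := PI_RGT_0).
assert (D : forall u, 0 <= u <= PI / 2 ->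
  is_derive (fun u => RInt (fun v => f u v) a b) u (B u b - B u a)).
{ intros u Hu.
  assert (Hloc : locally u (fun y => - m < y < PI / 2 + m)).
  { exists (mkposreal m Hm); intros y Hy; unfold ball in Hy; simpl in Hy.
    unfold AbsRing_ball, abs, minus, plus, opp in Hy; simpl in Hy.
    apply Rabs_lt_between in Hy; lra. }
  eapply is_derive_eq.
  - apply (is_derive_RInt_param (fun u v => f u v) a b u).
    + eapply filter_imp; [| exact Hloc]; intros y Hy t Ht.
      rewrite Rmin_left, Rmax_right in Ht by assumption.
      eexists; apply (H y t Hy); lra.
    + intros t Ht; rewrite Rmin_left, Rmax_right in Ht by assumption.
      apply continuity_2d_pt_ext_loc with d; [| apply H; lra].
      assert (Hr : 0 < Rmin m (Rmin t (b + 1 - t))) by (repeat apply Rmin_glb_lt; lra).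
      exists (mkposreal _ Hr); simpl; intros u' t' Hu' Ht'.
      pose proof (Rmin_l m (Rmin t (b + 1 - t))); pose proof (Rmin_r m (Rmin t (b + 1 - t))).
      pose proof (Rmin_l t (b + 1 - t)); pose proof (Rmin_r t (b + 1 - t)).
      apply Rabs_lt_between in Hu'; apply Rabs_lt_between in Ht'.
      symmetry; apply is_derive_unique, H; lra.
    + eapply filter_imp; [| exact Hloc]; intros y Hy.
      apply (ex_RInt_continuous (V := R_CompleteNormedModule)); intros t Ht.
      rewrite Rmin_left, Rmax_right in Ht by assumption.
      apply (continuity_2d_pt_slice f), H; lra.
  - apply is_RInt_unique.
    apply is_RInt_ext with (fun t => d u t).
    + intros t Ht; rewrite Rmin_left, Rmax_right in Ht by assumption.
      symmetry; apply is_derive_unique, H; lra.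
    + apply (is_RInt_derive (V := R_CompleteNormedModule) (B u) (d u)); intros t Ht;
        rewrite Rmin_left, Rmax_right in Ht by assumption.
      * apply H; lra.
      * apply (continuity_2d_pt_slice d), H; lra. }
set (F := fun u => RInt (fun v => f u v) a b).
(* [bounded_variation] asks for its hypotheses on a whole interval centred at the base point;
   centring at [PI / 4] stays inside the quadrant. *)
assert (B1 : forall y, y = 0 \/ y = PI / 2 -> Rabs (F y - F (PI / 4)) <= M * (PI / 4)).
{ intros y Hy; assert (E : Rabs (y - PI / 4) = PI / 4).
  { destruct Hy as [-> | ->]; [rewrite Rabs_left by lra | rewrite Rabs_right by lra]; lra. }
  assert (G : Rabs (F y - F (PI / 4)) <= M * Rabs (y - PI / 4)).
  { apply (bounded_variation F (fun u => B u b - B u a)); intros t Ht.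
    rewrite E in Ht; apply Rabs_le_between in Ht.
    split; [apply D | apply HB]; lra. }
  now rewrite E in G. }
pose proof (B1 0 (or_introl eq_refl)) as B2; pose proof (B1 _ (or_intror eq_refl)) as B3.
change (Rabs (F 0 - F (PI / 2)) <= M * (PI / 2)).
replace (F 0 - F (PI / 2)) with ((F 0 - F (PI / 4)) - (F (PI / 2) - F (PI / 4))) by ring.
eapply Rle_trans; [apply Rabs_triang |]; rewrite Rabs_Ropp; lra.
Qed.

(** This is [z ^ (n - 1) dz / dr] on the ray: the angular exponent is [n], not [n - 1], because [dz]
    contributes one more factor [exp (i s theta)]. *)
Definition twist (s : R) (n : C) (theta r : R) : C :=
  (Rcpow r (n - 1) * Cexp (Ci * n * RtoC (s * theta)))%C.

Lemma rotation (s : R) (n : C) (F F1 : R -> R -> C) (m a b M : R) :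
  s * s = 1 -> 0 < m -> 0 < a -> a <= b ->
  (forall u v, - m < u < PI / 2 + m -> 0 < v < b + 1 -> hol s F F1 u v) ->
  (forall u v, 0 <= u <= PI / 2 -> v = a \/ v = b ->
     v * Cmod (twist s n u v * F u v) <= M) ->
  Cmod (cint (fun r => twist s n 0 r * F 0 r)%C a b -
        cint (fun r => twist s n (PI / 2)%R r * F (PI / 2)%R r)%C a b) <= 2 * PI * M.
Proof.
intros Hs Hm Ha Hab HF HB; assert (Hpi := PI_RGT_0).
set (H := fun u r => (twist s n u r * F u r)%C).
set (W := fun u r => (n * H u r + twist s n u r * (F1 u r * polar s u r))%C).
set (D := fun u r => (Ci * RtoC s * W u r)%C).
(* [r * H] is a function of [z] alone, and the angular derivative of such a function is [i s r]
   times its radial one; dividing by [r], the angular derivative of [H] is the radial derivative of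
   [i s r H]. *)
set (B := fun u r => (Ci * RtoC s * (RtoC r * H u r))%C).
assert (T1 : forall u r, cder (fun a => twist s n a r) u (Ci * n * RtoC s * twist s n u r)).
{ intros u r; unfold twist.
  eapply cder_eq; [apply cder_mult; [apply cder_const | apply cder_Cexp, cder_mult;
    [apply cder_const |]] |].
  - apply cder_RtoC, is_derive_scal, (is_derive_id (K := R_AbsRing)).
  - unfold one; simpl; rewrite Rmult_1_r; ring. }
assert (T2 : forall u r, 0 < r -> cder (fun b => RtoC b * twist s n u b)%C r (n * twist s n u r)).
{ intros u r Hr; unfold twist.
  eapply cder_eq; [apply cder_mult; [apply cder_RtoC, (is_derive_id (K := R_AbsRing)) |
    apply cder_mult; [apply cder_Rcpow, Hr | apply cder_const]] |].
  unfold one; simpl.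
  transitivity ((Rcpow r (n - 1) + (n - 1) * (RtoC r * Rcpow r (n - 1 - 1))) *
    Cexp (Ci * n * RtoC (s * u)))%C; [ring |].
  rewrite (Rcpow_pred r (n - 1) Hr); ring. }
assert (T3 : forall u r, 0 < r -> ccont2 (twist s n) u r).
{ intros u r Hr; unfold twist; apply ccont2_mult.
  - apply ccont2_snd, ccont_Rcpow, Hr.
  - apply ccont2_Cexp, ccont2_mult; [apply ccont2_const |].
    apply ccont2_fst, ccont_RtoC, continuity_pt_mult; [apply continuity_pt_const; now intros x y |].
    apply derivable_continuous_pt, derivable_pt_id. }
assert (C1 : forall u v, - m < u < PI / 2 + m -> 0 < v < b + 1 ->
  cder (fun u => H u v) u (D u v) /\ cder (fun v => B u v) v (D u v) /\
  ccont2 H u v /\ ccont2 D u v).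
{ intros u v Hu Hv; destruct (HF u v Hu Hv) as (F1' & F2' & F3' & F4').
  assert (Z : ccont2 H u v) by (apply ccont2_mult; [apply T3; lra | exact F3']).
  split; [| split; [| split]].
  - eapply cder_eq; [apply (cder_mult _ _ _ _ _ (T1 u v) F1') |].
    unfold D, W, H; ring.
  - unfold B, H; eapply cder_ext with
      (fun v => Ci * RtoC s * ((RtoC v * twist s n u v) * F u v))%C; [intros; ring |].
    eapply cder_eq; [apply cder_mult; [apply cder_const |
      apply (cder_mult _ _ _ _ _ (T2 u v ltac:(lra)) F2')] |].
    unfold D, W, H, polar; ring.
  - exact Z.
  - apply ccont2_mult; [apply ccont2_const |].
    apply ccont2_plus; apply ccont2_mult; auto using ccont2_const.
    + apply T3; lra.
    + apply ccont2_mult; [exact F4' |].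
      apply ccont2_mult; [| now apply ccont2_ray].
      apply ccont2_snd, ccont_RtoC, derivable_continuous_pt, derivable_pt_id. }
assert (HB' : forall u, 0 <= u <= PI / 2 -> Cmod (B u b - B u a) <= 2 * M).
{ assert (Hs' : Rabs s = 1).
  { assert (Rabs s * Rabs s = 1) by (rewrite <- Rabs_mult, Hs; apply Rabs_R1).
    pose proof (Rabs_pos s); nra. }
  assert (E : forall u v, 0 < v -> Cmod (B u v) = v * Cmod (twist s n u v * F u v)).
  { intros u v Hv; unfold B, H.
    rewrite (Cmod_mult (Ci * RtoC s)), (Cmod_mult Ci), Cmod_Ci, Cmod_R, Hs', (Cmod_mult (RtoC v)).
    rewrite Cmod_R, Rabs_pos_eq by lra; ring. }
  intros u Hu; eapply Rle_trans; [apply Cmod_triangle |].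
  rewrite Cmod_opp, !E by lra.
  pose proof (HB u a Hu (or_introl eq_refl)); pose proof (HB u b Hu (or_intror eq_refl)); lra. }
assert (EX : forall u, 0 <= u <= PI / 2 -> ex_cint (H u) a b).
{ intros u Hu; apply ex_cint_ccont; intros t Ht; rewrite Rmin_left, Rmax_right in Ht by assumption.
  destruct (C1 u t ltac:(lra) ltac:(lra)) as (_ & _ & [Z1 Z2] & _).
  split; apply continuity_pt_filterlim;
   [apply (continuity_2d_pt_slice _ _ _ Z1) | apply (continuity_2d_pt_slice _ _ _ Z2)]. }
pose proof (cint_correct _ _ _ (EX 0 ltac:(lra))) as I0.
pose proof (cint_correct _ _ _ (EX (PI / 2) ltac:(lra))) as I1.
eapply Rle_trans; [apply Cmod_le_sum |]; simpl.
change (Rabs (fst (cint (H 0) a b) + - fst (cint (H (PI / 2)) a b)) +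
  Rabs (snd (cint (H 0) a b) + - snd (cint (H (PI / 2)) a b)) <= 2 * PI * M).
rewrite <- (is_RInt_unique _ _ _ _ (is_cint_fst _ _ _ _ I0)),
  <- (is_RInt_unique _ _ _ _ (is_cint_fst _ _ _ _ I1)),
  <- (is_RInt_unique _ _ _ _ (is_cint_snd _ _ _ _ I0)),
  <- (is_RInt_unique _ _ _ _ (is_cint_snd _ _ _ _ I1)).
(* The two arcs contribute [2 * M] over an angle [PI / 2], once for the real and once for the
   imaginary part, which makes [2 * PI * M]. *)
assert (R1 := rotation_real (fun u v => fst (H u v)) (fun u v => fst (D u v))
  (fun u v => fst (B u v)) m a b (2 * M) Hm Ha Hab).
assert (R2 := rotation_real (fun u v => snd (H u v)) (fun u v => snd (D u v))
  (fun u v => snd (B u v)) m a b (2 * M) Hm Ha Hab).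
simpl in R1, R2; unfold Rminus in R1, R2.
assert (R1' : Rabs (RInt (fun t => fst (H 0 t)) a b + - RInt (fun t => fst (H (PI / 2) t)) a b) <=
  2 * M * (PI / 2)).
{ apply R1.
  - intros u v Hu Hv; destruct (C1 u v Hu Hv) as ([? ?] & [? ?] & [? ?] & [? ?]); auto.
  - intros u Hu; eapply Rle_trans; [apply (Re_le_Cmod (B u b - B u a)%C) | now apply HB']. }
assert (R2' : Rabs (RInt (fun t => snd (H 0 t)) a b + - RInt (fun t => snd (H (PI / 2) t)) a b) <=
  2 * M * (PI / 2)).
{ apply R2.
  - intros u v Hu Hv; destruct (C1 u v Hu Hv) as ([? ?] & [? ?] & [? ?] & [? ?]); auto.
  - intros u Hu; eapply Rle_trans; [apply (Im_le_Cmod (B u b - B u a)%C) | now apply HB']. }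
lra.
Qed.

(** On the arc of radius [v] the boundary term is at most a multiple of [v ^ Re n * exp (- c v)],
    uniformly in the angle, and this vanishes at both ends. *)
Lemma rotation_improper (s : R) (n : C) (F F1 : R -> R -> C) (c K : R) (I0 I1 : C) :
  s * s = 1 -> 0 < Re n -> 0 < c -> 0 <= K ->
  (forall b, 0 < b -> exists m, 0 < m /\
    forall u v, - m < u < PI / 2 + m -> 0 < v < b -> hol s F F1 u v) ->
  (forall u v, 0 <= u <= PI / 2 -> 0 < v ->
     Cmod (twist s n u v * F u v) <= K * (Rpower v (Re n - 1) * exp (- (c * v)))) ->
  improper (fun r => twist s n 0 r * F 0%R r)%C I0 ->
  improper (fun r => twist s n (PI / 2) r * F (PI / 2)%R r)%C I1 ->
  I0 = I1.
Proof.
intros Hs Hn Hc HK HF HB [_ H0] [_ H1]; assert (Hpi := PI_RGT_0).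
set (g := Re n) in *.
assert (HB' : forall u v, 0 <= u <= PI / 2 -> 0 < v ->
  v * Cmod (twist s n u v * F u v) <= K * (Rpower v g * exp (- (c * v)))).
{ intros u v Hu Hv; eapply Rle_trans.
  - apply Rmult_le_compat_l; [lra | apply HB; assumption].
  - right; replace g with (1 + (g - 1)) at 2 by ring.
    rewrite (Rpower_plus 1 (g - 1) v), Rpower_1 by exact Hv; ring. }
assert (Small : forall eta, 0 < eta -> exists d, 0 < d /\ forall v, 0 < v ->
  v < d \/ / d < v -> K * (Rpower v g * exp (- (c * v))) <= eta).
{ intros eta He; assert (He1 : 0 < eta / (K + 1)) by (apply Rdiv_lt_0_compat; lra).
  destruct (Rpower_exp_ends g c _ Hn Hc He1) as [d [Hd B]].
  exists d; split; [exact Hd |]; intros v Hv Hvd; specialize (B v Hv Hvd).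
  pose proof (Rpower_pos v g); pose proof (exp_pos (- (c * v))).
  apply Rle_trans with ((K + 1) * (eta / (K + 1))); [| right; field; lra].
  apply Rmult_le_compat; nra. }
assert (Z : Cmod (I0 - I1) <= 0).
{ apply le_epsilon; intros eta He; rewrite Rplus_0_l.
  (* Two truncation errors [e], and [2 * PI * e] for the arcs. *)
  set (e := eta / (2 + 2 * PI)).
  assert (He' : 0 < e) by (apply Rdiv_lt_0_compat; lra).
  destruct (H0 e He') as [d0 [Hd0 B0]], (H1 e He') as [d1 [Hd1 B1]].
  destruct (Small e He') as [d2 [Hd2 B2]].
  set (d := Rmin (Rmin d0 d1) (Rmin d2 1)).
  assert (Hd : 0 < d) by (repeat apply Rmin_glb_lt; lra).
  assert (L0 : d <= d0) by (eapply Rle_trans; [apply Rmin_l | apply Rmin_l]).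
  assert (L1 : d <= d1) by (eapply Rle_trans; [apply Rmin_l | apply Rmin_r]).
  assert (L2 : d <= d2) by (eapply Rle_trans; [apply Rmin_r | apply Rmin_l]).
  assert (L3 : d <= 1) by (eapply Rle_trans; [apply Rmin_r | apply Rmin_r]).
  pose proof (Rinv_le_contravar _ _ Hd L0); pose proof (Rinv_le_contravar _ _ Hd L1).
  pose proof (Rinv_le_contravar _ _ Hd L2); pose proof (Rinv_le_contravar _ _ Hd L3).
  rewrite Rinv_1 in *.
  set (a := d / 2); set (b := / d + 1).
  specialize (B0 a b ltac:(unfold a; lra) ltac:(unfold b; lra)).
  specialize (B1 a b ltac:(unfold a; lra) ltac:(unfold b; lra)).
  destruct (HF (b + 1) ltac:(unfold b; lra)) as [m [Hm HF']].
  assert (Hab : 0 < a <= b) by (unfold a, b; lra).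
  assert (R := rotation s n F F1 m a b e Hs Hm (proj1 Hab) (proj2 Hab) HF').
  assert (R' : Cmod (cint (fun r => twist s n 0 r * F 0%R r)%C a b -
    cint (fun r => twist s n (PI / 2) r * F (PI / 2)%R r)%C a b) <= 2 * PI * e).
  { apply R; intros u v Hu Hv; assert (Hv0 : 0 < v) by (destruct Hv as [-> | ->]; lra).
    eapply Rle_trans; [now apply HB' |]; apply B2; [exact Hv0 |].
    destruct Hv as [-> | ->]; [left; unfold a; lra | right; unfold b; lra]. }
  set (X0 := cint (fun r => twist s n 0 r * F 0%R r)%C a b) in *.
  set (X1 := cint (fun r => twist s n (PI / 2) r * F (PI / 2)%R r)%C a b) in *.
  replace (I0 - I1)%C with ((X0 - X1) + ((X1 - I1) - (X0 - I0)))%C by ring.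
  eapply Rle_trans; [apply Cmod_triangle |].
  pose proof (Cmod_triangle (X1 - I1) (- (X0 - I0))) as T; rewrite Cmod_opp in T.
  change (X1 - I1 + - (X0 - I0))%C with (X1 - I1 - (X0 - I0))%C in T.
  assert (e * (2 + 2 * PI) = eta) by (unfold e; field; lra).
  lra. }
apply Ceq_minus, Cmod_eq_0, Rle_antisym; [exact Z | apply Cmod_ge_0].
Qed.

(** The reciprocal of [sigma p w * exp (2 PI w)]: of modulus [1] on the imaginary axis and at most
    [1] to its right. Unlike [sigma] it is regular at [w = p]; its only pole is at [- p]. *)
Definition qC (p : R) (w : C) : C :=
  (Cexp (- RtoC (2 * PI) * w) * ((RtoC p - w) * / (RtoC p + w)))%C.

(** [gC p 1 w] is [1 / (sigma p w * exp (2 PI w) - 1)]; the factor [tau < 1] removes the poles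
    from the right half-plane. *)
Definition gC (p tau : R) (w : C) : C :=
  (RtoC tau * qC p w * / (1 + - RtoC tau * qC p w))%C.

Lemma Cmod_qC (p : R) (w : C) : (RtoC p + w <> 0)%C ->
  Cmod (qC p w) = exp (- (2 * PI * Re w)) * (Cmod (RtoC p - w) / Cmod (RtoC p + w)).
Proof.
intros H; unfold qC; rewrite !Cmod_mult, Cmod_inv, Cmod_Cexp by exact H.
f_equal; f_equal; destruct w; simpl; ring.
Qed.

Lemma p_plus_neq_0 p w : 0 < p -> - p < Re w -> (RtoC p + w <> 0)%C.
Proof. intros Hp Hw E; apply (f_equal fst) in E; unfold Re in *; simpl in E; lra. Qed.

Lemma Cmod_le_sqr (z w : C) :
  fst z * fst z + snd z * snd z <= fst w * fst w + snd w * snd w -> Cmod z <= Cmod w.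
Proof. intros H; unfold Cmod; apply sqrt_le_1_alt; simpl; lra. Qed.

Lemma Cmod_qC_le (p : R) (w : C) : 0 < p -> 0 <= Re w ->
  Cmod (qC p w) <= exp (- (2 * PI * Re w)).
Proof.
intros Hp Hw; assert (N := p_plus_neq_0 p w Hp ltac:(lra)).
rewrite Cmod_qC by exact N; rewrite <- (Rmult_1_r (exp _)) at 2.
apply Rmult_le_compat_l; [left; apply exp_pos |].
apply Rmult_le_reg_r with (Cmod (RtoC p + w)); [now apply Cmod_gt_0 |].
unfold Rdiv; rewrite Rmult_assoc, Rinv_l, Rmult_1_l, Rmult_1_r
  by (apply Rgt_not_eq; now apply Cmod_gt_0).
apply Cmod_le_sqr; unfold Re in Hw; simpl; nra.
Qed.

(** Rotating up to the axes needs regularity slightly beyond them, hence a strip of positive width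
    left of the imaginary axis. Since [tau < 1], the function [f] is negative at [0], so it is
    negative at some [x0 > 0], and this says that [tau] times the largest modulus expected at
    [Re w = - x0] is below [1]. *)
Lemma Cmod_qC_strip (p tau : R) : 0 < p -> 0 < tau < 1 ->
  exists x0, 0 < x0 < p /\ forall w, - x0 < Re w -> tau * Cmod (qC p w) < 1.
Proof.
intros Hp Ht; assert (Hpi := PI_RGT_0).
set (f := fun x => tau * exp (2 * PI * x) * (p + x) - (p - x)).
assert (Hf : continuity_pt f 0).
{ apply continuity_pt_filterlim, (ex_derive_continuous (V := R_NormedModule) f).
  unfold f; auto_derive; auto. }
assert (F0 : f 0 < 0) by (unfold f; rewrite Rmult_0_r, exp_0; nra).
destruct (Hf (- f 0)) as [d [Hd H]]; [lra |].
set (x0 := Rmin (d / 2) (p / 2)).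
assert (Hx0 : 0 < x0) by (apply Rmin_glb_lt; lra).
assert (x0 <= d / 2) by apply Rmin_l; assert (x0 <= p / 2) by apply Rmin_r.
assert (Fx : f x0 < 0).
{ assert (Z : Rabs (f x0 - f 0) < - f 0).
  { apply H; split; [split; [exact I | lra] |].
    change (Rabs (x0 - 0) < d); rewrite Rminus_0_r, Rabs_right; lra. }
  apply Rabs_lt_between in Z; lra. }
exists x0; split; [lra |]; intros w Hw.
assert (N := p_plus_neq_0 p w Hp ltac:(lra)).
destruct (Rle_dec 0 (Re w)) as [P | P].
{ pose proof (Cmod_qC_le p w Hp P).
  assert (exp (- (2 * PI * Re w)) <= 1) by (rewrite <- exp_0; apply exp_le; nra).
  nra. }
rewrite Cmod_qC by exact N.
assert (E1 : exp (- (2 * PI * Re w)) <= exp (2 * PI * x0)) by (apply exp_le; nra).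
(* In the strip each coordinate of [(p - x0) (p - w)] is at most, in size, that of
   [(p + x0) (p + w)]. *)
assert (E2 : Cmod (RtoC p - w) / Cmod (RtoC p + w) <= (p + x0) / (p - x0)).
{ apply Rmult_le_reg_r with ((p - x0) * Cmod (RtoC p + w)).
  { apply Rmult_lt_0_compat; [lra | now apply Cmod_gt_0]. }
  replace (Cmod (RtoC p - w) / Cmod (RtoC p + w) * ((p - x0) * Cmod (RtoC p + w)))
    with ((p - x0) * Cmod (RtoC p - w)) by (field; apply Rgt_not_eq; now apply Cmod_gt_0).
  replace ((p + x0) / (p - x0) * ((p - x0) * Cmod (RtoC p + w)))
    with ((p + x0) * Cmod (RtoC p + w)) by (field; lra).
  rewrite <- (Rabs_pos_eq (p - x0)), <- (Rabs_pos_eq (p + x0)) by lra.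
  rewrite <- !Cmod_R, <- !Cmod_mult; apply Cmod_le_sqr; unfold Re in *; simpl.
  set (u := fst w) in *; set (v := snd w) in *.
  assert (Z1 : (p - x0) * (p - u) <= (p + x0) * (p + u)) by nra.
  assert (Z2 : (p - x0) * Rabs v <= (p + x0) * Rabs v) by (pose proof (Rabs_pos v); nra).
  assert (Z3 : v * v = Rabs v * Rabs v) by (rewrite <- Rabs_mult; symmetry; apply Rabs_pos_eq; nra).
  pose proof (Rabs_pos v).
  assert (0 <= (p - x0) * (p - u)) by nra; assert (0 <= (p - x0) * Rabs v) by nra.
  replace (((p + x0) * (p + u) - 0 * (0 + v)) * ((p + x0) * (p + u) - 0 * (0 + v)) +
    ((p + x0) * (0 + v) + 0 * (p + u)) * ((p + x0) * (0 + v) + 0 * (p + u))) with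
    (((p + x0) * (p + u)) * ((p + x0) * (p + u)) + ((p + x0) * (p + x0)) * (v * v)) by ring.
  replace (((p - x0) * (p + - u) - 0 * (0 + - v)) * ((p - x0) * (p + - u) - 0 * (0 + - v)) +
    ((p - x0) * (0 + - v) + 0 * (p + - u)) * ((p - x0) * (0 + - v) + 0 * (p + - u))) with
    (((p - x0) * (p - u)) * ((p - x0) * (p - u)) + ((p - x0) * (p - x0)) * (v * v)) by ring.
  apply Rplus_le_compat; [apply Rmult_le_compat; assumption |].
  apply Rmult_le_compat_r; nra. }
assert (Hy : 0 < p - x0) by lra.
apply Rle_lt_trans with (tau * (exp (2 * PI * x0) * ((p + x0) / (p - x0)))).
- apply Rmult_le_compat_l; [lra |]; apply Rmult_le_compat; auto; [left; apply exp_pos |].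
  apply Rmult_le_pos; [apply Cmod_ge_0 | left; apply Rinv_0_lt_compat; now apply Cmod_gt_0].
- apply Rmult_lt_reg_r with (p - x0); [exact Hy |].
  unfold f in Fx.
  replace (tau * (exp (2 * PI * x0) * ((p + x0) / (p - x0))) * (p - x0))
    with (tau * exp (2 * PI * x0) * (p + x0)) by (field; lra); lra.
Qed.

Lemma one_minus_neq_0 (tau : R) (z : C) : 0 <= tau -> tau * Cmod z < 1 ->
  (1 + - RtoC tau * z <> 0)%C.
Proof.
intros Ht H E.
assert (E' : (RtoC tau * z = 1)%C).
{ replace (RtoC tau * z)%C with (1 - (1 + - RtoC tau * z))%C by ring.
  rewrite E; ring. }
apply (f_equal Cmod) in E'; rewrite Cmod_mult, Cmod_R, Rabs_pos_eq, Cmod_1 in E' by lra; lra.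
Qed.

Lemma Cmod_one_minus_ge (tau : R) (z : C) : 0 <= tau ->
  1 - tau * Cmod z <= Cmod (1 + - RtoC tau * z).
Proof.
intros Ht; pose proof (Cmod_triangle (1 + - RtoC tau * z) (RtoC tau * z)) as T.
replace (1 + - RtoC tau * z + RtoC tau * z)%C with (RtoC 1) in T by ring.
rewrite Cmod_1, Cmod_mult, Cmod_R, (Rabs_pos_eq tau) in T by lra; lra.
Qed.

Lemma Cmod_gC_le (p tau : R) (w : C) : 0 < p -> 0 < tau < 1 -> 0 <= Re w ->
  Cmod (gC p tau w) <= exp (- (2 * PI * Re w)) / (1 - tau).
Proof.
intros Hp Ht Hw; assert (Hpi := PI_RGT_0).
pose proof (Cmod_qC_le p w Hp Hw) as Q.
assert (E : exp (- (2 * PI * Re w)) <= 1) by (rewrite <- exp_0; apply exp_le; nra).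
pose proof (Cmod_ge_0 (qC p w)).
pose proof (Cmod_one_minus_ge tau (qC p w) ltac:(lra)).
assert (N : (1 + - RtoC tau * qC p w <> 0)%C) by (apply one_minus_neq_0; nra).
unfold gC; rewrite !Cmod_mult, Cmod_inv, Cmod_R, Rabs_pos_eq by (exact N || lra).
assert (0 < / (1 - tau)) by (apply Rinv_0_lt_compat; lra).
apply Rmult_le_compat; [nra | | nra | apply Rinv_le_contravar; [lra | nra]].
left; apply Rinv_0_lt_compat, Cmod_gt_0, N.
Qed.

Lemma hol_ext s (F G F1 : R -> R -> C) theta r : (forall a b, F a b = G a b) ->
  hol s F F1 theta r -> hol s G F1 theta r.
Proof.
intros E (A1 & A2 & [A3 A3'] & A4); split; [| split; [| split]].
- eapply cder_ext; [| exact A1]; intros; apply E.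
- eapply cder_ext; [| exact A2]; intros; apply E.
- split; [apply continuity_2d_pt_ext with (2 := A3) | apply continuity_2d_pt_ext with (2 := A3')];
  intros; simpl; now rewrite E.
- exact A4.
Qed.

(** The derivative stays existential and is assembled by unification from the rules for [hol]. It is
    chosen before [theta] and [r], so that it is a single function on the whole domain. *)
Lemma hol_gC s p tau (c : C) : s * s = 1 -> exists F1, forall theta r,
  (RtoC p + c * polar s theta r <> 0)%C ->
  (1 + - RtoC tau * qC p (c * polar s theta r) <> 0)%C ->
  hol s (fun a b => gC p tau (c * polar s a b)) F1 theta r.
Proof.
intros Hs.
assert (L : forall c0 k : C, exists F1, forall theta r,
  hol s (fun a b => c0 + k * polar s a b)%C F1 theta r).
{ intros c0 k; eexists; intros theta r.
  apply hol_plus; [apply hol_const | apply hol_mult; [apply hol_const | now apply hol_id]]. }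
destruct (L (RtoC p) (- c)%C) as [N1 HN].
destruct (L (RtoC p) c) as [D1 HD].
destruct (L 0%C (- RtoC (2 * PI) * c)%C) as [E1 HE].
assert (Q : exists Q1, forall theta r, (RtoC p + c * polar s theta r <> 0)%C ->
  hol s (fun a b => qC p (c * polar s a b)) Q1 theta r).
{ eexists; intros theta r Hz; unfold qC.
  apply hol_ext with (fun a b => Cexp (0 + - RtoC (2 * PI) * c * polar s a b) *
    ((RtoC p + - c * polar s a b) * / (RtoC p + c * polar s a b)))%C.
  { intros a b; f_equal; f_equal; ring. }
  apply hol_mult; [apply hol_Cexp, HE |].
  apply hol_mult; [apply HN | apply hol_inv; [apply HD | exact Hz]]. }
destruct Q as [Q1 HQ].
eexists; intros theta r H1 H2; unfold gC.
apply hol_mult; [apply hol_mult; [apply hol_const | apply HQ, H1] |].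
apply hol_inv; [| exact H2].
apply hol_plus; [apply hol_const | apply hol_mult; [apply hol_const | apply HQ, H1]].
Qed.

Lemma sin_ge_margin m u : 0 < m < 1 -> - m < u < PI / 2 + m -> - m <= sin u.
Proof.
intros Hm Hu; assert (Hpi := PI_RGT_0); assert (P2 := PI2_1).
destruct (Rle_dec 0 u) as [P | P].
- assert (0 <= sin u) by (apply sin_ge_0; lra); lra.
- destruct (Req_dec u 0) as [-> | N]; [rewrite sin_0; lra |].
  pose proof (sin_lt_x (- u) ltac:(lra)) as Z; rewrite sin_neg in Z; lra.
Qed.

Lemma cos_plus_sin_ge_1 u : 0 <= u <= PI / 2 -> 0 <= cos u /\ 0 <= sin u /\ 1 <= cos u + sin u.
Proof.
intros Hu; assert (Hpi := PI_RGT_0).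
assert (0 <= cos u) by (apply cos_ge_0; lra).
assert (0 <= sin u) by (apply sin_ge_0; lra).
pose proof (sin2_cos2 u) as E; unfold Rsqr in E.
repeat split; nra.
Qed.

(** Multiplication by [- i s] sends the quadrant swept by [polar s] into the right half-plane, where
    both factors are controlled. The factor [1] gives the first argument the shape expected by
    [hol_gC]. *)
Definition reg_integrand (p tau rho b s : R) (u v : R) : C :=
  (gC p tau (1 * polar s u v) * gC p rho ((- Ci * RtoC (s * b)) * polar s u v))%C.

Lemma Re_rot s b u v : s * s = 1 ->
  Re (- Ci * RtoC (s * b) * polar s u v)%C = b * (v * sin u).
Proof.
intros Hs; unfold Re, polar, ray; simpl.
transitivity ((s * s) * b * (v * sin u)); [ring | rewrite Hs; ring].
Qed.

Lemma Re_one_polar s u v : Re (1 * polar s u v)%C = v * cos u.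
Proof. unfold Re, polar, ray; simpl; ring. Qed.

(** A sector widens linearly with the radius while the strips have fixed width, so the angular
    margin [m] must shrink like [x0 / X]. The factor [1 + b] serves the two arguments [z] and
    [- i s b z] at once. *)
Lemma hol_reg_integrand p tau rho b s : 0 < p -> 0 < tau < 1 -> 0 < rho < 1 -> 0 < b -> s * s = 1 ->
  exists F1, forall X, 0 < X -> exists m, 0 < m /\
    forall u v, - m < u < PI / 2 + m -> 0 < v < X -> hol s (reg_integrand p tau rho b s) F1 u v.
Proof.
intros Hp Ht Hr Hb Hs.
destruct (hol_gC s p tau 1%C Hs) as [F1 H1].
destruct (hol_gC s p rho (- Ci * RtoC (s * b))%C Hs) as [F2 H2].
eexists; intros X HX.
destruct (Cmod_qC_strip p tau Hp Ht) as [x1 [Hx1 S1]].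
destruct (Cmod_qC_strip p rho Hp Hr) as [x2 [Hx2 S2]].
set (x0 := Rmin x1 x2).
assert (Hx0 : 0 < x0) by (apply Rmin_glb_lt; lra).
assert (L1 : x0 <= x1) by apply Rmin_l; assert (L2 : x0 <= x2) by apply Rmin_r.
set (m := Rmin (1 / 2) (x0 / ((1 + b) * X))).
assert (HY : 0 < (1 + b) * X) by (apply Rmult_lt_0_compat; lra).
assert (Hm : 0 < m) by (apply Rmin_glb_lt; [lra | now apply Rdiv_lt_0_compat]).
assert (M1 : m <= 1 / 2) by apply Rmin_l.
assert (M2 : m * ((1 + b) * X) <= x0).
{ apply Rle_trans with (x0 / ((1 + b) * X) * ((1 + b) * X)).
  - apply Rmult_le_compat_r; [lra | apply Rmin_r].
  - right; field; split; lra. }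
exists m; split; [exact Hm |]; intros u v Hu Hv.
assert (Sn : - m <= sin u) by (apply sin_ge_margin; lra).
assert (Cs : - m <= cos u) by (rewrite <- sin_shift; apply sin_ge_margin; lra).
assert (V1 : - x0 < v * cos u).
{ apply Rlt_le_trans with (- (m * X)); [| nra].
  assert (m * X < m * ((1 + b) * X)) by (apply Rmult_lt_compat_l; nra); lra. }
assert (V2 : - x0 < b * (v * sin u)).
{ apply Rlt_le_trans with (- (m * (b * X))).
  - assert (m * (b * X) < m * ((1 + b) * X)) by (apply Rmult_lt_compat_l; nra); lra.
  - assert (v * sin u >= - (m * X)) by nra; nra. }
rewrite <- Re_one_polar with s _ _ in V1; rewrite <- (Re_rot s) in V2 by exact Hs.
apply hol_mult; [apply H1 | apply H2];
  try (apply p_plus_neq_0; lra);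
  (apply one_minus_neq_0; [lra |]); [apply S1 | apply S2]; lra.
Qed.

(** One factor decays with [v cos u], the other with [b v sin u]. Because [cos u + sin u >= 1] on
    the quadrant, the product decays at the rate [Rmin 1 b] in every direction. *)
Lemma Cmod_reg_integrand_le p tau rho b s u v :
  0 < p -> 0 < tau < 1 -> 0 < rho < 1 -> 0 < b -> s * s = 1 -> 0 <= u <= PI / 2 -> 0 < v ->
  Cmod (reg_integrand p tau rho b s u v) <= exp (- (Rmin 1 b * v)) / ((1 - tau) * (1 - rho)).
Proof.
intros Hp Ht Hr Hb Hs Hu Hv; destruct (cos_plus_sin_ge_1 u Hu) as [Hc [Hn Hcs]].
assert (P2 := PI2_1).
pose proof (Cmod_gC_le p tau (1 * polar s u v)%C Hp Ht) as B1.
pose proof (Cmod_gC_le p rho (- Ci * RtoC (s * b) * polar s u v)%C Hp Hr) as B2.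
rewrite Re_one_polar in B1; rewrite Re_rot in B2 by exact Hs.
assert (V1 : 0 <= v * cos u) by nra; assert (V2 : 0 <= v * sin u) by nra.
assert (V3 : 0 <= b * (v * sin u)) by nra.
specialize (B1 V1); specialize (B2 V3).
unfold reg_integrand; rewrite Cmod_mult.
eapply Rle_trans; [apply Rmult_le_compat; [apply Cmod_ge_0 | apply Cmod_ge_0 | exact B1 | exact B2] |].
replace (exp (- (2 * PI * (v * cos u))) / (1 - tau) * (exp (- (2 * PI * (b * (v * sin u)))) / (1 - rho)))
  with (exp (- (2 * PI * (v * cos u)) + - (2 * PI * (b * (v * sin u)))) * / ((1 - tau) * (1 - rho)))
  by (rewrite exp_plus; field; split; lra).
apply Rmult_le_compat_r; [left; apply Rinv_0_lt_compat; nra |].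
apply exp_le.
assert (Z1 : Rmin 1 b <= 1) by apply Rmin_l; assert (Z2 : Rmin 1 b <= b) by apply Rmin_r.
assert (Z3 : 0 < Rmin 1 b) by (apply Rmin_glb_lt; lra).
assert (Rmin 1 b * (v * cos u) <= 1 * (v * cos u)) by (apply Rmult_le_compat_r; lra).
assert (Rmin 1 b * (v * sin u) <= b * (v * sin u)) by (apply Rmult_le_compat_r; lra).
assert (v <= v * cos u + v * sin u) by nra.
assert (Rmin 1 b * v <= Rmin 1 b * (v * cos u) + Rmin 1 b * (v * sin u)) by nra.
nra.
Qed.

Lemma Cmod_twist s n u v : s * s = 1 -> 0 <= u <= PI / 2 ->
  Cmod (twist s n u v) <= Rpower v (Re n - 1) * exp (Rabs (Im n) * (PI / 2)).
Proof.
intros Hs Hu; unfold twist; rewrite Cmod_mult, Cmod_Rcpow, Cmod_Cexp.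
replace (Re (n - 1)%C) with (Re n - 1) by (destruct n; simpl; ring).
apply Rmult_le_compat_l; [left; apply Rpower_pos |]; apply exp_le.
replace (Re (Ci * n * RtoC (s * u))%C) with (- (s * Im n) * u)
  by (destruct n; simpl; ring).
assert (Hs' : Rabs s = 1).
{ assert (Rabs s * Rabs s = 1) by (rewrite <- Rabs_mult, Hs; apply Rabs_R1).
  pose proof (Rabs_pos s); nra. }
eapply Rle_trans; [apply Rle_abs |].
rewrite Rabs_mult, Rabs_Ropp, Rabs_mult, Hs', Rmult_1_l, (Rabs_pos_eq u) by lra.
apply Rmult_le_compat_l; [apply Rabs_pos | lra].
Qed.

Lemma loc_int_ray s n F F1 u :
  (forall X, 0 < X -> exists m, 0 < m /\
    forall u v, - m < u < PI / 2 + m -> 0 < v < X -> hol s F F1 u v) ->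
  0 <= u <= PI / 2 -> loc_int (fun r => twist s n u r * F u r)%C.
Proof.
intros H Hu; apply loc_int_ccont; intros x Hx; apply ccont_mult.
- apply ccont_mult; [now apply ccont_Rcpow | apply ccont_const].
- destruct (H (x + 1) ltac:(lra)) as [m [Hm HF]].
  destruct (HF u x ltac:(lra) ltac:(lra)) as (_ & D & _).
  apply (cder_ccont _ _ _ D).
Qed.

Lemma rotation_reg_integrand p tau rho b s n : 0 < p -> 0 < tau < 1 -> 0 < rho < 1 -> 0 < b ->
  s * s = 1 -> 2 < Re n -> exists I,
  improper (fun r => twist s n 0 r * reg_integrand p tau rho b s 0%R r)%C I /\
  improper (fun r => twist s n (PI / 2) r * reg_integrand p tau rho b s (PI / 2)%R r)%C I.
Proof.
intros Hp Ht Hr Hb Hs Hn; assert (Hpi := PI_RGT_0).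
destruct (hol_reg_integrand p tau rho b s Hp Ht Hr Hb Hs) as [F1 HF].
set (K := exp (Rabs (Im n) * (PI / 2)) / ((1 - tau) * (1 - rho))).
set (c := Rmin 1 b).
assert (Hc : 0 < c) by (apply Rmin_glb_lt; lra).
assert (HK : 0 < K) by (apply Rdiv_lt_0_compat; [apply exp_pos | nra]).
assert (B : forall u v, 0 <= u <= PI / 2 -> 0 < v ->
  Cmod (twist s n u v * reg_integrand p tau rho b s u v) <= K * (Rpower v (Re n - 1) * exp (- (c * v)))).
{ intros u v Hu Hv; rewrite Cmod_mult.
  eapply Rle_trans; [apply Rmult_le_compat; [apply Cmod_ge_0 | apply Cmod_ge_0 |
    now apply Cmod_twist | now apply Cmod_reg_integrand_le] |].
  right; unfold K, c; field; split; lra. }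
set (g := Re n - 2).
destruct (Rpower_exp_env g 2 c ltac:(unfold g; lra) ltac:(lra) Hc) as [K' [HK' BK']].
assert (EX : forall u, 0 <= u <= PI / 2 -> exists I,
  improper (fun r => twist s n u r * reg_integrand p tau rho b s u r)%C I).
{ intros u Hu; apply (improper_exists _ g (K * K')); [unfold g; lra | |].
  - apply (loc_int_ray s n _ F1); auto.
  - intros x Hx; eapply Rle_trans; [now apply B |].
    rewrite Rmult_assoc; apply Rmult_le_compat_l; [lra |].
    replace (Re n - 1) with (g - 1 + 2) by (unfold g; ring); now apply BK'. }
destruct (EX 0 ltac:(lra)) as [I0 H0]; destruct (EX (PI / 2) ltac:(lra)) as [I1 H1].
exists I0; split; [exact H0 |].
replace I0 with I1; [exact H1 | symmetry].
apply (rotation_improper s n (reg_integrand p tau rho b s) F1 c K); auto; try lra.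
Qed.

(** * The regularised identity *)

Definition q (p t : R) : R := exp (- (2 * PI * t)) * ((p - t) / (p + t)).
Definition G (p tau t : R) : R := tau * q p t / (1 - tau * q p t).
(** Half the argument of [qC p (- i y)]. Taking it to be a multiple of [PI] is the equation
    [tan (PI y) = - y / p] in continuous form. *)
Definition phase (p y : R) : R := PI * y + atan (y / p).

(** The squared modulus of [1 - rho * exp (2 i y)]. Over it, [Pk] and [Qk] are the Poisson kernel
    and its conjugate at the angle [2 y]. *)
Definition kden (rho y : R) : R := (1 - rho) ^ 2 + 4 * rho * (sin y) ^ 2.
Definition Pk (rho y : R) : R := (1 - rho ^ 2) / kden rho y.
Definition Qk (rho y : R) : R := 4 * rho * (sin y * cos y) / kden rho y.

Lemma kden_pos rho y : 0 < rho < 1 -> 0 < kden rho y.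
Proof.
intros H; unfold kden; pose proof (pow2_ge_0 (sin y)).
assert (0 < (1 - rho) ^ 2) by (apply pow_lt; lra); nra.
Qed.

Lemma q_abs_lt p t : 0 < p -> 0 < t -> Rabs (q p t) <= exp (- (2 * PI * t)).
Proof.
intros Hp Ht; unfold q; rewrite Rabs_mult, Rabs_pos_eq by (left; apply exp_pos).
rewrite <- (Rmult_1_r (exp _)) at 2; apply Rmult_le_compat_l; [left; apply exp_pos |].
unfold Rdiv; rewrite Rabs_mult, Rabs_inv, (Rabs_pos_eq (p + t)) by lra.
apply Rmult_le_reg_r with (p + t); [lra |]; rewrite Rmult_assoc, Rinv_l by lra.
assert (Rabs (p - t) <= p + t) by (apply Rabs_le; lra); lra.
Qed.

Lemma exp_neg_lt_1 t : 0 < t -> exp (- (2 * PI * t)) < 1.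
Proof.
intros Ht; rewrite <- exp_0; apply exp_increasing; pose proof PI_RGT_0; nra.
Qed.

Lemma one_minus_q_pos p tau t : 0 < p -> 0 <= tau <= 1 -> 0 < t ->
  1 - exp (- (2 * PI * t)) <= 1 - tau * q p t /\ 0 < 1 - tau * q p t.
Proof.
intros Hp Htau Ht; pose proof (q_abs_lt p t Hp Ht) as Q; pose proof (exp_neg_lt_1 t Ht).
pose proof (Rle_abs (q p t)); pose proof (exp_pos (- (2 * PI * t))).
assert (tau * q p t <= exp (- (2 * PI * t))).
{ destruct (Rle_dec 0 (q p t)); nra. }
lra.
Qed.

Lemma qC_real p t : 0 < p -> 0 < t -> qC p (RtoC t) = RtoC (q p t).
Proof.
intros Hp Ht; unfold qC, q.
replace (- RtoC (2 * PI) * RtoC t)%C with (RtoC (- (2 * PI * t)))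
  by (rewrite RtoC_opp, !RtoC_mult; ring).
rewrite Cexp_RtoC, RtoC_mult, RtoC_div, RtoC_minus, RtoC_plus by lra; reflexivity.
Qed.

Lemma gC_real p tau t : 0 < p -> 0 <= tau <= 1 -> 0 < t ->
  gC p tau (RtoC t) = RtoC (G p tau t).
Proof.
intros Hp Htau Ht; destruct (one_minus_q_pos p tau t Hp Htau Ht) as [_ N].
unfold gC, G; rewrite qC_real by assumption.
rewrite RtoC_div, RtoC_minus, RtoC_mult by lra.
unfold Cdiv; f_equal; f_equal; ring.
Qed.

Lemma sqrt_atan_identity u : 0 < 1 + u * u -> sqrt (1 + u²) * sqrt (1 + u²) = 1 + u * u.
Proof. intros; rewrite sqrt_sqrt; unfold Rsqr; lra. Qed.

Lemma qC_imag p y : 0 < p ->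
  qC p (- Ci * RtoC y) = (cos (2 * phase p y), sin (2 * phase p y)).
Proof.
intros Hp; unfold qC, phase.
set (a := atan (y / p)).
assert (M : ((RtoC p - - Ci * RtoC y) * / (RtoC p + - Ci * RtoC y) = (cos (2 * a), sin (2 * a)))%C).
{ rewrite cos_2a, sin_2a; unfold a; rewrite cos_atan, sin_atan.
  set (s := sqrt (1 + (y / p)²)).
  assert (Hpos : 0 < 1 + y / p * (y / p)) by nra.
  assert (S : s * s = 1 + y / p * (y / p)) by (apply sqrt_atan_identity; exact Hpos).
  assert (Hs : s <> 0) by (intros Z; rewrite Z in S; lra).
  assert (Hd : p * p + y * y <> 0) by nra.
  assert (S1 : 1 / s * (1 / s) = p * p / (p * p + y * y)).
  { replace (1 / s * (1 / s)) with (/ (s * s)) by (field; exact Hs).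
    rewrite S; field; repeat split; try lra; nra. }
  apply injective_projections; simpl.
  - replace (1 / s * (1 / s) - y / p / s * (y / p / s)) with
      (1 / s * (1 / s) * (1 - y / p * (y / p))) by (field; lra).
    rewrite S1; field; repeat split; nra.
  - replace (2 * (y / p / s) * (1 / s)) with (1 / s * (1 / s) * (2 * (y / p))) by (field; lra).
    rewrite S1; field; repeat split; nra. }
rewrite M.
replace (- RtoC (2 * PI) * (- Ci * RtoC y))%C with (0, 2 * (PI * y))
  by (apply injective_projections; simpl; ring).
rewrite Rmult_plus_distr_l, cos_plus, sin_plus; unfold Cexp; simpl; rewrite exp_0.
apply injective_projections; simpl; ring.
Qed.

Lemma gC_imag p rho y : 0 < p -> 0 < rho < 1 ->
  gC p rho (- Ci * RtoC y) =
  ((Pk rho (phase p y) - 1) / 2, Qk rho (phase p y) / 2).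
Proof.
intros Hp Hr; unfold gC; rewrite qC_imag by exact Hp.
set (f := phase p y); pose proof (kden_pos rho f Hr) as K.
rewrite cos_2a_sin, sin_2a.
unfold Pk, Qk.
assert (E : (1 + - rho * (1 - 2 * sin f * sin f)) * (1 + - rho * (1 - 2 * sin f * sin f)) +
  (rho * (2 * sin f * cos f)) * (rho * (2 * sin f * cos f)) = kden rho f).
{ pose proof (sin2_cos2 f) as T; unfold Rsqr in T.
  assert (C2 : cos f * cos f = 1 - sin f * sin f) by lra.
  unfold kden.
  replace (rho * (2 * sin f * cos f) * (rho * (2 * sin f * cos f)))
    with (4 * rho * rho * (sin f * sin f) * (cos f * cos f)) by ring.
  rewrite C2; ring. }
assert (T : cos f * cos f = 1 - sin f * sin f)
  by (pose proof (sin2_cos2 f) as T; unfold Rsqr in T; lra).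
assert (I : (/ (1 + - RtoC rho * (1 - 2 * sin f * sin f, 2 * sin f * cos f)%R))%C =
  ((1 + - rho * (1 - 2 * sin f * sin f)) / kden rho f, rho * (2 * sin f * cos f) / kden rho f)).
{ apply injective_projections; simpl; rewrite <- E; field;
    repeat split; try (rewrite ?Rmult_1_r in *; intros Z; apply (Rgt_not_eq _ _ K); rewrite <- E, <- Z; ring). }
rewrite I; apply injective_projections; simpl.
- apply Rmult_eq_reg_r with (kden rho f); [| lra].
  transitivity (rho * (1 - 2 * sin f * sin f) * (1 + - rho * (1 - 2 * sin f * sin f)) -
    rho * (rho * 4 * sin f * sin f * (cos f * cos f))); [field; lra |].
  transitivity ((1 - rho ^ 2 - kden rho f) / 2); [| field; lra].
  rewrite T; unfold kden; field.
- apply Rmult_eq_reg_r with (kden rho f); [| lra].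
  field; lra.
Qed.

Lemma phase_opp p y : phase p (- y) = - phase p y.
Proof.
unfold phase; replace (- y / p) with (- (y / p)) by (unfold Rdiv; ring); rewrite atan_opp; ring.
Qed.

Lemma kden_opp rho y : kden rho (- y) = kden rho y.
Proof. unfold kden; rewrite sin_neg; ring. Qed.

Lemma Pk_opp rho y : Pk rho (- y) = Pk rho y.
Proof. unfold Pk; now rewrite kden_opp. Qed.

Lemma Qk_opp rho y : Qk rho (- y) = - Qk rho y.
Proof. unfold Qk; rewrite kden_opp, sin_neg, cos_neg; unfold Rdiv; ring. Qed.

Lemma regularised_identity p tau rho b n :
  0 < p -> 0 < tau < 1 -> 0 < rho < 1 -> 0 < b -> 2 < Re n -> exists I,
  improper (fun x => Rcpow x (n - 1) * RtoC (G p tau x) *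
    (Ccos (RtoC PI * n / 2) * RtoC (Pk rho (phase p (b * x)) - 1) +
     Csin (RtoC PI * n / 2) * RtoC (Qk rho (phase p (b * x)))))%C I /\
  improper (fun y => Rcpow y (n - 1) * RtoC (G p rho (b * y)) *
    RtoC (Pk tau (phase p y) - 1))%C I.
Proof.
intros Hp Ht Hr Hb Hn.
destruct (rotation_reg_integrand p tau rho b 1 n Hp Ht Hr Hb ltac:(lra) Hn) as [I1 [A1 B1]].
destruct (rotation_reg_integrand p tau rho b (-1) n Hp Ht Hr Hb ltac:(lra) Hn) as [I2 [A2 B2]].
set (e := Cexp (Ci * (RtoC PI * n / 2))%C).
assert (He : e <> 0%C) by apply Cexp_neq_0.
(* At the angles [PI / 2] and [- PI / 2] the twist acquires [e] and [/ e]; the weights undo them,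
   and on the imaginary axis two conjugate values of [gC] add up to [Pk tau - 1]. On the real axis
   the weights stay and combine into the cosine and the sine. *)
exists (/ e * I1 + e * I2)%C.
assert (P0 : forall s r, polar s 0 r = RtoC r).
{ intros; unfold polar, ray; rewrite cos_0, sin_0; apply injective_projections; simpl; ring. }
assert (P1 : forall s r, polar s (PI / 2) r = (Ci * RtoC (s * r))%C).
{ intros; unfold polar, ray; rewrite cos_PI2, sin_PI2; apply injective_projections; simpl; ring. }
assert (T0 : forall s r, twist s n 0 r = Rcpow r (n - 1)).
{ intros; unfold twist; rewrite Rmult_0_r; replace (Ci * n * 0)%C with (RtoC 0) by ring.
  rewrite Cexp_0; ring. }
assert (T1 : forall r, twist 1 n (PI / 2) r = (Rcpow r (n - 1) * e)%C).
{ intros; unfold twist, e; f_equal; f_equal; rewrite Rmult_1_l, RtoC_div by lra.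
  field; injection; lra. }
assert (Cm1 : RtoC (-1) = (- (1))%C) by (apply injective_projections; simpl; ring).
assert (T2 : forall r, twist (-1) n (PI / 2) r = (Rcpow r (n - 1) * / e)%C).
{ intros; unfold twist, e; rewrite <- Cexp_opp; f_equal; f_equal.
  rewrite RtoC_mult, RtoC_div, Cm1 by lra.
  field; injection; lra. }
assert (EC : Ccos (RtoC PI * n / 2) = ((e + / e) / 2)%C).
{ unfold Ccos, e; now rewrite Cexp_opp. }
assert (ES : Csin (RtoC PI * n / 2) = ((e - / e) / (2 * Ci))%C).
{ unfold Csin, e; now rewrite Cexp_opp. }
assert (CC : forall x y : R, (x, y) = (RtoC x + Ci * RtoC y)%C).
{ intros; apply injective_projections; simpl; ring. }
assert (C2 : RtoC 2 <> 0%C) by (injection; lra).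
assert (Ci0 : Ci <> 0%C) by (injection; lra).
assert (CI : (Ci * Ci = - (1))%C) by (apply injective_projections; simpl; ring).
split.
- eapply improper_ext; [| apply improper_plus; apply improper_scal; [exact A1 | exact A2]].
  intros x Hx; simpl; unfold reg_integrand; rewrite !T0, !P0.
  rewrite Cmult_1_l, gC_real by lra.
  replace (- Ci * RtoC (1 * b) * RtoC x)%C with (- Ci * RtoC (b * x))%C
    by (rewrite !RtoC_mult; ring).
  replace (- Ci * RtoC (-1 * b) * RtoC x)%C with (- Ci * RtoC (- (b * x)))%C
    by (rewrite RtoC_opp, !RtoC_mult, Cm1; ring).
  rewrite !gC_imag by assumption.
  rewrite phase_opp, Pk_opp, Qk_opp, !CC, EC, ES.
  set (f := phase p (b * x)).
  rewrite !RtoC_div, RtoC_opp by lra.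
  set (P := RtoC (Pk rho f - 1)); set (Q := RtoC (Qk rho f)).
  replace ((e - / e) / (2 * Ci))%C with (- Ci * (e - / e) / 2)%C.
  2:{ replace (- Ci)%C with (/ Ci)%C.
      - field; repeat split; assumption.
      - apply injective_projections; simpl; field. }
  field; repeat split; assumption.
- eapply improper_ext; [| apply improper_plus; apply improper_scal; [exact B1 | exact B2]].
  intros x Hx; simpl; unfold reg_integrand; rewrite !P1, T1, T2.
  replace (1 * (Ci * RtoC (1 * x)))%C with (- Ci * RtoC (- x))%C
    by (rewrite !RtoC_mult, RtoC_opp; ring).
  replace (1 * (Ci * RtoC (-1 * x)))%C with (- Ci * RtoC x)%C
    by (rewrite !RtoC_mult, Cm1; ring).
  replace (- Ci * RtoC (1 * b) * (Ci * RtoC (1 * x)))%C with (RtoC (b * x))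
    by (apply injective_projections; simpl; ring).
  replace (- Ci * RtoC (-1 * b) * (Ci * RtoC (-1 * x)))%C with (RtoC (b * x))
    by (apply injective_projections; simpl; ring).
  rewrite !gC_imag, !gC_real by (try lra; apply Rmult_lt_0_compat; lra).
  rewrite phase_opp, Pk_opp, Qk_opp, !CC.
  set (f := phase p x).
  rewrite !RtoC_div, RtoC_opp by lra.
  set (P := RtoC (Pk tau f - 1)); set (Q := RtoC (Qk tau f)).
  field; repeat split; assumption.
Qed.

(** * Kernels concentrating at the zeros of the sine *)

Lemma x_cos_le_sin x : 0 <= x <= PI / 2 -> x * cos x <= sin x.
Proof.
intros Hx; assert (P := PI2_1).
destruct (Req_dec x 0) as [-> | N]; [rewrite sin_0; lra |].
destruct (MVT_cor2 (fun t => sin t - t * cos t) (fun t => t * sin t) 0 x ltac:(lra)) as [c [E Hc]].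
- intros c Hc; apply is_derive_Reals; auto_derive; [exact I | ring].
- rewrite sin_0 in E; assert (0 <= sin c) by (apply sin_ge_0; lra).
  assert (0 <= c * sin c * (x - 0)) by (apply Rmult_le_pos; nra); lra.
Qed.

(** From [sin y = 2 sin (y / 2) cos (y / 2) >= y * cos (y / 2) ^ 2] for [0 <= y <= 3 PI / 4]. The
    bound [3 PI / 4] is how far, in phase, a cell extends from its zero. *)
Definition c0 : R := cos (3 * PI / 8) ^ 2.

Lemma c0_pos : 0 < c0 <= 1.
Proof.
assert (P := PI_RGT_0); unfold c0; split.
- apply pow_lt, cos_gt_0; lra.
- pose proof (COS_bound (3 * PI / 8)); nra.
Qed.

Lemma sin_lower y : Rabs y <= 3 * PI / 4 -> c0 * Rabs y <= Rabs (sin y).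
Proof.
assert (P := PI_RGT_0).
assert (G : forall y, 0 <= y <= 3 * PI / 4 -> c0 * y <= sin y).
{ intros t Ht; replace t with (2 * (t / 2)) at 2 by field; rewrite sin_2a.
  pose proof (x_cos_le_sin (t / 2) ltac:(lra)) as H.
  assert (C1 : cos (3 * PI / 8) <= cos (t / 2)) by (apply cos_decr_1; lra).
  assert (C2 : 0 < cos (3 * PI / 8)) by (apply cos_gt_0; lra).
  apply Rle_trans with (2 * (t / 2 * cos (t / 2)) * cos (t / 2)).
  - unfold c0; assert (cos (3 * PI / 8) ^ 2 <= cos (t / 2) * cos (t / 2)) by nra; nra.
  - apply Rmult_le_compat_r; lra. }
intros Hy; destruct (Rcase_abs y) as [N | N].
- rewrite Rabs_left in * by exact N.
  rewrite <- Rabs_Ropp, <- sin_neg; eapply Rle_trans; [apply G; lra | apply Rle_abs].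
- rewrite Rabs_right in * by exact N.
  eapply Rle_trans; [apply G; lra | apply Rle_abs].
Qed.

Lemma sin_shift_sqr j y : sin (y + INR j * PI) ^ 2 = sin y ^ 2.
Proof.
induction j as [| j IH]; [simpl INR; f_equal; f_equal; ring |].
rewrite S_INR, Rmult_plus_distr_r, Rmult_1_l, <- Rplus_assoc, neg_sin, <- IH; ring.
Qed.

Lemma sin_lower_shift j y : Rabs (y - INR j * PI) <= 3 * PI / 4 ->
  c0 * Rabs (y - INR j * PI) <= Rabs (sin y).
Proof.
intros H; eapply Rle_trans; [apply sin_lower, H |].
right; apply Rsqr_eq_abs_0; unfold Rsqr.
pose proof (sin_shift_sqr j (y - INR j * PI)) as E.
replace (y - INR j * PI + INR j * PI) with y in E by ring; lra.
Qed.

Definition kint (k : R -> R) (a b : R) : R := RInt (V := R_CompleteNormedModule) k a b.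

(** A kernel [k rho], singular in the limit [rho -> 1-] at the zeros of the sine:
    away from them it tends to [k1], and near each of them it acts as the mass [c]
    plus the principal value of [k1]. *)
Record is_kernel (k : R -> R -> R) (k1 : R -> R) (c : R) : Prop := {
  ker_cont : forall rho y, 0 < rho < 1 -> continuity_pt (k rho) y;
  ker_cont1 : forall y, sin y <> 0 -> continuity_pt k1 y;
  ker_bounded : forall rho y, 0 < rho < 1 -> Rabs (k rho y) <= 4 / (1 - rho) ^ 2;
  ker_sin : forall rho y, 1 / 2 <= rho < 1 -> Rabs (k rho y) * Rabs (sin y) <= 1;
  ker_sin1 : forall y, Rabs (k1 y) * Rabs (sin y) <= 1;
  ker_diff : forall rho y, 1 / 2 <= rho < 1 ->
    Rabs (k rho y - k1 y) * Rabs (sin y) ^ 3 <= 2 * (1 - rho);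
  ker_mass : exists C, 0 <= C /\ forall j rho u v w, 1 / 2 <= rho < 1 ->
    0 < w -> w <= u <= 1 -> w <= v <= 1 ->
    Rabs (kint (k rho) (INR j * PI - v) (INR j * PI + u) - c) <=
      C * (Rabs (u - v) * (u + v) / w ^ 2 + (1 - rho) / w)
}.

Lemma is_derive_cont (f : R -> R) x l : is_derive f x l -> continuity_pt f x.
Proof.
intros H; apply continuity_pt_filterlim, (ex_derive_continuous (V := R_NormedModule) f).
now exists l.
Qed.

Lemma Pk_cont rho y : 0 < rho < 1 -> continuity_pt (Pk rho) y.
Proof.
intros H; pose proof (kden_pos rho y H) as K; unfold Pk, kden in *.
eapply is_derive_cont; auto_derive; [| reflexivity].
apply Rgt_not_eq; simpl in *; lra.
Qed.

Lemma Qk_cont rho y : 0 < rho < 1 -> continuity_pt (Qk rho) y.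
Proof.
intros H; pose proof (kden_pos rho y H) as K; unfold Qk, kden in *.
eapply is_derive_cont; auto_derive; [| reflexivity].
apply Rgt_not_eq; simpl in *; lra.
Qed.

Lemma kden_ge1 rho y : 0 < rho < 1 -> (1 - rho) ^ 2 <= kden rho y.
Proof. intros H; unfold kden; pose proof (pow2_ge_0 (sin y)); nra. Qed.

Lemma kden_ge2 rho y : 0 < rho < 1 -> 4 * rho * sin y ^ 2 <= kden rho y.
Proof. intros H; unfold kden; pose proof (pow2_ge_0 (1 - rho)); lra. Qed.

Lemma Rabs_div_le x y z : 0 < y -> Rabs x <= z * y -> Rabs (x / y) <= z.
Proof.
intros Hy H; unfold Rdiv; rewrite Rabs_mult, Rabs_inv, (Rabs_pos_eq y) by lra.
apply Rmult_le_reg_r with y; [exact Hy |]; rewrite Rmult_assoc, Rinv_l; lra.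
Qed.

Lemma Rabs_sin_sqr y : Rabs (sin y) ^ 2 = sin y ^ 2.
Proof. rewrite <- !Rsqr_pow2; symmetry; apply Rsqr_abs. Qed.

Lemma Rabs_sin_le_1 y : 0 <= Rabs (sin y) <= 1.
Proof. split; [apply Rabs_pos | apply Rabs_le, SIN_bound]. Qed.

Lemma Rabs_cos_le_1 y : 0 <= Rabs (cos y) <= 1.
Proof. split; [apply Rabs_pos | apply Rabs_le, COS_bound]. Qed.

Lemma Pk_eq rho j y : Pk rho (y + INR j * PI) = Pk rho y.
Proof. unfold Pk, kden; now rewrite sin_shift_sqr. Qed.

Lemma x_le_tan x : 0 < x < PI / 2 -> x <= tan x.
Proof.
intros H; unfold tan; assert (0 < cos x) by (apply cos_gt_0; lra).
apply Rmult_le_reg_r with (cos x); [assumption |].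
unfold Rdiv; rewrite Rmult_assoc, Rinv_l, Rmult_1_r by lra.
apply x_cos_le_sin; lra.
Qed.

Lemma atan_le_x x : 0 <= x -> atan x <= x.
Proof.
intros H; destruct (Req_dec x 0) as [-> | N]; [rewrite atan_0; lra |].
pose proof (atan_bound x); pose proof (atan_increasing 0 x ltac:(lra)) as A.
rewrite atan_0 in A; rewrite <- (tan_atan x) at 2; apply x_le_tan; lra.
Qed.

(** Around a zero, [atan (m * tan y)] with [m = (1 + rho) / (1 - rho)] is a primitive. It climbs
    from nearly [- PI / 2] to nearly [PI / 2], which gives the mass [PI]; each end falls short by at
    most [(1 - rho) / w]. *)
Lemma Pk_kernel : is_kernel Pk (fun _ => 0) PI.
Proof.
assert (P2 := PI2_1).
split.
- intros; now apply Pk_cont.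
- intros; apply continuity_pt_const; now intros a b.
- intros rho y H; pose proof (kden_pos rho y H) as K; pose proof (kden_ge1 rho y H).
  unfold Pk; apply Rabs_div_le; [exact K |].
  rewrite Rabs_pos_eq by nra.
  apply Rle_trans with (4 / (1 - rho) ^ 2 * (1 - rho) ^ 2).
  + replace (4 / (1 - rho) ^ 2 * (1 - rho) ^ 2) with 4 by (field; lra); nra.
  + apply Rmult_le_compat_l; [| assumption].
    left; apply Rdiv_lt_0_compat; [lra | apply pow_lt; lra].
- intros rho y H; pose proof (kden_pos rho y ltac:(lra)) as K.
  rewrite <- Rabs_mult; unfold Pk.
  replace ((1 - rho ^ 2) / kden rho y * sin y) with ((1 - rho ^ 2) * sin y / kden rho y)
    by (field; lra).
  apply Rabs_div_le; [exact K |]; rewrite Rmult_1_l, Rabs_mult, (Rabs_pos_eq (1 - rho ^ 2)) by nra.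
  unfold kden; rewrite <- Rabs_sin_sqr; pose proof (Rabs_sin_le_1 y).
  set (s := Rabs (sin y)) in *.
  (* The product [2 (1 - rho) s] is at most [(1 - rho) ^ 2 + s ^ 2], and [rho >= 1 / 2] lets
     [4 rho s ^ 2] absorb what is needed. *)
  assert (0 <= (1 - rho - s) ^ 2) by apply pow2_ge_0.
  assert (0 <= (2 * rho - 1) * s ^ 2) by (apply Rmult_le_pos; [lra | apply pow2_ge_0]).
  nra.
- intros; rewrite Rabs_R0; lra.
- intros rho y H; pose proof (kden_pos rho y ltac:(lra)) as K.
  rewrite Rminus_0_r.
  replace (Rabs (Pk rho y) * Rabs (sin y) ^ 3) with
    (Rabs (sin y) * Rabs ((1 - rho ^ 2) * sin y ^ 2 / kden rho y)).
  2:{ unfold Pk; replace ((1 - rho ^ 2) * sin y ^ 2 / kden rho y) with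
        ((1 - rho ^ 2) / kden rho y * sin y ^ 2) by (field; lra).
      rewrite (Rabs_mult _ (sin y ^ 2)), <- RPow_abs; ring. }
  assert (Z : Rabs ((1 - rho ^ 2) * sin y ^ 2 / kden rho y) <= 2 * (1 - rho)).
  { apply Rabs_div_le; [exact K |]; pose proof (pow2_ge_0 (sin y)).
    rewrite Rabs_pos_eq by (apply Rmult_le_pos; nra).
    pose proof (kden_ge2 rho y ltac:(lra)).
    apply Rle_trans with (2 * (1 - rho) * (4 * rho * sin y ^ 2)); [| nra].
    assert (0 <= (1 - rho) * sin y ^ 2) by nra; nra. }
  pose proof (Rabs_sin_le_1 y); pose proof (Rabs_pos ((1 - rho ^ 2) * sin y ^ 2 / kden rho y)); nra.
- exists 2; split; [lra |]; intros j rho u v w H Hw Hu Hv.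
  set (m := (1 + rho) / (1 - rho)).
  assert (Hm : 0 < m) by (apply Rdiv_lt_0_compat; lra).
  set (A := fun y => atan (m * tan (y - INR j * PI))).
  assert (I : is_RInt (Pk rho) (INR j * PI - v) (INR j * PI + u)
    (A (INR j * PI + u) - A (INR j * PI - v))).
  { apply (is_RInt_derive (V := R_CompleteNormedModule) A); intros x Hx;
      rewrite Rmin_left, Rmax_right in Hx by lra.
    - assert (Cx : cos (x - INR j * PI) <> 0) by (apply Rgt_not_eq, cos_gt_0; lra).
      replace (Pk rho x) with (Pk rho (x - INR j * PI)).
      2:{ rewrite <- (Pk_eq rho j); f_equal; ring. }
      unfold A, tan; set (d := x - INR j * PI) in *.
      pose proof (kden_pos rho d ltac:(lra)) as K.
      auto_derive; fold d.
      + exact Cx.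
      + unfold Pk, kden in *; pose proof (sin2_cos2 d) as T; unfold Rsqr in T.
        unfold m; fold d; change (x + - (INR j * PI)) with d.
        assert (E : (1 - rho) ^ 2 + 4 * rho * sin d ^ 2 =
          (1 - rho) ^ 2 * (cos d * cos d) + (1 + rho) ^ 2 * (sin d * sin d)).
        { replace (cos d * cos d) with (1 - sin d * sin d) by lra; ring. }
        rewrite E in *.
        replace (1 - rho ^ 2) with ((1 + rho) * (1 - rho) * (sin d * sin d + cos d * cos d))
          by (rewrite T; ring).
        field; repeat split; try lra; simpl in *; try nra.
    - apply continuity_pt_filterlim, Pk_cont; lra. }
  unfold kint; rewrite (is_RInt_unique _ _ _ _ I).
  unfold minus, plus, opp, A; simpl.
  replace (INR j * PI + u - INR j * PI) with u by ring.
  replace (INR j * PI - v - INR j * PI) with (- v) by ring.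
  rewrite tan_neg, <- Ropp_mult_distr_r, atan_opp.
  (* The defect is [atan] of the inverse, hence at most that inverse, and
     [m * tan t >= w / (1 - rho)]. *)
  assert (G : forall t, w <= t <= 1 -> 0 <= PI / 2 - atan (m * tan t) <= (1 - rho) / w).
  { intros t Ht; pose proof (x_le_tan t ltac:(lra)).
    assert (0 < m * tan t) by (apply Rmult_lt_0_compat; lra).
    split; [pose proof (atan_bound (m * tan t)); lra |].
    rewrite <- atan_inv by assumption.
    eapply Rle_trans; [apply atan_le_x; left; now apply Rinv_0_lt_compat |].
    replace ((1 - rho) / w) with (/ (w / (1 - rho))) by (field; lra).
    apply Rinv_le_contravar; [apply Rdiv_lt_0_compat; lra |].
    unfold m; apply Rmult_le_reg_r with (1 - rho); [lra |].
    replace (w / (1 - rho) * (1 - rho)) with w by (field; lra).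
    replace ((1 + rho) / (1 - rho) * tan t * (1 - rho)) with ((1 + rho) * tan t) by (field; lra).
    nra. }
  pose proof (G u Hu); pose proof (G v Hv).
  assert (0 <= Rabs (u - v) * (u + v) / w ^ 2).
  { apply Rmult_le_pos; [apply Rmult_le_pos; [apply Rabs_pos | lra] |].
    left; apply Rinv_0_lt_compat, pow_lt; lra. }
  simpl in *; apply Rabs_le; lra.
Qed.

Lemma ln_diff_le X Y m : 0 < m -> m <= X -> m <= Y -> Rabs (ln X - ln Y) <= Rabs (X - Y) / m.
Proof.
assert (G : forall X Y, 0 < m -> m <= X -> m <= Y -> X <= Y -> ln Y - ln X <= (Y - X) / m).
{ intros U V Hm HU HV HUV; rewrite <- ln_div by lra.
  assert (0 < V / U) by (apply Rdiv_lt_0_compat; lra).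
  pose proof (exp_ineq1_le (ln (V / U))) as E; rewrite exp_ln in E by assumption.
  apply Rle_trans with (V / U - 1); [lra |].
  replace (V / U - 1) with ((V - U) * / U) by (field; lra).
  apply Rmult_le_compat_l; [lra | apply Rinv_le_contravar; lra]. }
intros Hm HX HY; destruct (Rle_dec X Y) as [L | L].
- assert (ln X <= ln Y) by (apply ln_le; lra).
  rewrite Rabs_left1, (Rabs_left1 (X - Y)) by lra.
  replace (- (ln X - ln Y)) with (ln Y - ln X) by ring.
  replace (- (X - Y)) with (Y - X) by ring; now apply G.
- assert (ln Y <= ln X) by (apply ln_le; lra).
  rewrite !Rabs_pos_eq by lra; apply G; lra.
Qed.

(** Half the logarithm of [kden] is a primitive and is even about every zero, so the mass over a
    symmetric interval is [0]; the asymmetry of the interval alone produces the error. Away from the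
    zeros, [Qk rho - cot] equals [- (1 - rho) ^ 2 * cot / kden], where [kden] dominates a multiple
    of [sin ^ 2]. *)
Lemma Qk_kernel : is_kernel Qk (fun y => cos y / sin y) 0.
Proof.
assert (P2 := PI2_1).
split.
- intros; now apply Qk_cont.
- intros y Hy; eapply is_derive_cont; auto_derive; [exact Hy | reflexivity].
- intros rho y H; pose proof (kden_pos rho y H) as K; pose proof (kden_ge1 rho y H).
  unfold Qk; apply Rabs_div_le; [exact K |].
  pose proof (Rabs_sin_le_1 y); pose proof (Rabs_cos_le_1 y).
  apply Rle_trans with 4.
  + rewrite !Rabs_mult, (Rabs_pos_eq 4), (Rabs_pos_eq rho) by lra.
    assert (Rabs (sin y) * Rabs (cos y) <= 1) by nra.
    assert (0 <= Rabs (sin y) * Rabs (cos y)) by nra; nra.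
  + apply Rle_trans with (4 / (1 - rho) ^ 2 * (1 - rho) ^ 2); [right; field; lra |].
    apply Rmult_le_compat_l; [| assumption].
    left; apply Rdiv_lt_0_compat; [lra | apply pow_lt; lra].
- intros rho y H; pose proof (kden_pos rho y ltac:(lra)) as K.
  rewrite <- Rabs_mult; unfold Qk.
  replace (4 * rho * (sin y * cos y) / kden rho y * sin y) with
    (4 * rho * sin y ^ 2 * cos y / kden rho y) by (field; lra).
  pose proof (pow2_ge_0 (sin y)).
  apply Rabs_div_le; [exact K |]; rewrite Rmult_1_l, Rabs_mult, Rabs_pos_eq by nra.
  pose proof (kden_ge2 rho y ltac:(lra)); pose proof (Rabs_cos_le_1 y); nra.
- intros y; destruct (Req_dec (sin y) 0) as [E | N].
  + rewrite E, Rabs_R0; lra.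
  + rewrite <- Rabs_mult; replace (cos y / sin y * sin y) with (cos y) by (field; exact N).
    apply Rabs_cos_le_1.
- intros rho y H; pose proof (kden_pos rho y ltac:(lra)) as K.
  destruct (Req_dec (sin y) 0) as [E | N].
  { rewrite E, Rabs_R0; simpl; lra. }
  rewrite RPow_abs, <- Rabs_mult.
  replace ((Qk rho y - cos y / sin y) * sin y ^ 3) with
    (- ((1 - rho) ^ 2 * cos y * sin y ^ 2 / kden rho y)).
  2:{ unfold Qk, kden in *; field; split; [exact N |].
      apply Rgt_not_eq; simpl in *; lra. }
  rewrite Rabs_Ropp; apply Rabs_div_le; [exact K |].
  pose proof (pow2_ge_0 (sin y)); pose proof (pow2_ge_0 (1 - rho)).
  rewrite !Rabs_mult, (Rabs_pos_eq ((1 - rho) ^ 2)), (Rabs_pos_eq (sin y ^ 2)) by assumption.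
  pose proof (kden_ge2 rho y ltac:(lra)); pose proof (Rabs_cos_le_1 y).
  apply Rle_trans with ((1 - rho) * (2 * rho * sin y ^ 2)); [| nra].
  assert ((1 - rho) ^ 2 * Rabs (cos y) * sin y ^ 2 <= (1 - rho) ^ 2 * 1 * sin y ^ 2).
  { apply Rmult_le_compat_r; [assumption |]; apply Rmult_le_compat_l; lra. }
  assert (0 <= (1 - rho) * sin y ^ 2) by nra.
  nra.
- assert (C0 := c0_pos).
  assert (C2 : 0 < c0 ^ 2) by (apply pow_lt; lra).
  exists (/ c0 ^ 2); split; [left; now apply Rinv_0_lt_compat |].
  intros j rho u v w H Hw Hu Hv; rewrite Rminus_0_r.
  set (A := fun y => / 2 * ln (kden rho y)).
  assert (I : is_RInt (Qk rho) (INR j * PI - v) (INR j * PI + u)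
    (A (INR j * PI + u) - A (INR j * PI - v))).
  { apply (is_RInt_derive (V := R_CompleteNormedModule) A); intros x Hx.
    - pose proof (kden_pos rho x ltac:(lra)) as K; unfold A, Qk, kden in *.
      auto_derive; simpl in *; [lra |]; field; lra.
    - apply continuity_pt_filterlim, Qk_cont; lra. }
  unfold kint; rewrite (is_RInt_unique _ _ _ _ I); unfold A.
  assert (E1 : kden rho (INR j * PI + u) = kden rho u).
  { unfold kden; now rewrite (Rplus_comm (INR j * PI) u), sin_shift_sqr. }
  assert (E2 : kden rho (INR j * PI - v) = kden rho v).
  { rewrite <- (kden_opp rho v); unfold kden.
    replace (INR j * PI - v) with (- v + INR j * PI) by ring; now rewrite sin_shift_sqr. }
  rewrite E1, E2.
  replace (/ 2 * ln (kden rho u) - / 2 * ln (kden rho v)) with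
    (/ 2 * (ln (kden rho u) - ln (kden rho v))) by ring.
  rewrite Rabs_mult, (Rabs_pos_eq (/ 2)) by lra.
  assert (SL : forall t, w <= t <= 1 -> 4 * rho * (c0 ^ 2 * w ^ 2) <= kden rho t).
  { intros t Ht; eapply Rle_trans; [| apply kden_ge2; lra].
    apply Rmult_le_compat_l; [lra |].
    pose proof (sin_lower t) as SLt; rewrite !(Rabs_pos_eq t) in SLt by lra.
    specialize (SLt ltac:(lra)); rewrite <- Rabs_sin_sqr, <- Rpow_mult_distr.
    apply pow_incr; split; [apply Rmult_le_pos; lra |].
    apply Rle_trans with (c0 * t); [apply Rmult_le_compat_l; lra | exact SLt]. }
  assert (W2 : 0 < w ^ 2) by (apply pow_lt; lra).
  assert (M : 0 < 4 * rho * (c0 ^ 2 * w ^ 2)) by (apply Rmult_lt_0_compat; [lra | now apply Rmult_lt_0_compat]).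
  pose proof (ln_diff_le _ _ _ M (SL u Hu) (SL v Hv)) as L.
  (* The difference of the squared sines factors; this is the source of [Rabs (u - v) * (u + v)] in
     [ker_mass]. *)
  assert (D : Rabs (kden rho u - kden rho v) <= 4 * rho * (Rabs (u - v) * (u + v))).
  { unfold kden; replace (_ - _) with (4 * rho * ((sin u - sin v) * (sin u + sin v))) by ring.
    rewrite !Rabs_mult, (Rabs_pos_eq 4), (Rabs_pos_eq rho) by lra.
    apply Rmult_le_compat_l; [lra |].
    apply Rmult_le_compat; try apply Rabs_pos.
    - rewrite <- (Rmult_1_l (Rabs (u - v))).
      apply (bounded_variation sin cos 1 v u); intros t _; split.
      + auto_derive; [exact Logic.I | ring].
      + apply Rabs_cos_le_1.
    - eapply Rle_trans; [apply Rabs_triang |].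
      apply Rplus_le_compat; (rewrite Rabs_pos_eq; [left; apply sin_lt_x; lra | apply sin_ge_0; lra]). }
  apply Rle_trans with (/ 2 * (4 * rho * (Rabs (u - v) * (u + v)) / (4 * rho * (c0 ^ 2 * w ^ 2)))).
  { apply Rmult_le_compat_l; [lra |]; eapply Rle_trans; [exact L |].
    apply Rmult_le_compat_r; [left; now apply Rinv_0_lt_compat | exact D]. }
  replace (4 * rho * (Rabs (u - v) * (u + v)) / (4 * rho * (c0 ^ 2 * w ^ 2)))
    with (/ c0 ^ 2 * (Rabs (u - v) * (u + v) / w ^ 2)) by (field; repeat split; lra).
  rewrite <- Rmult_assoc, (Rmult_comm (/ 2)), Rmult_assoc.
  apply Rmult_le_compat_l; [left; now apply Rinv_0_lt_compat |].
  assert (0 <= Rabs (u - v) * (u + v) / w ^ 2).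
  { apply Rmult_le_pos; [apply Rmult_le_pos; [apply Rabs_pos | lra] |].
    left; now apply Rinv_0_lt_compat. }
  assert (0 <= (1 - rho) / w) by (apply Rmult_le_pos; [lra | left; now apply Rinv_0_lt_compat]).
  lra.
Qed.

(** * The phase and its cells *)

Definition psi (p b x : R) : R := phase p (b * x).
Definition dpsi (p b x : R) : R := b * (PI + p / (p ^ 2 + (b * x) ^ 2)).

Lemma psi_den_pos p y : 0 < p -> 0 < p ^ 2 + y ^ 2.
Proof. intros Hp; pose proof (pow2_ge_0 y); pose proof (pow_lt p 2 Hp); lra. Qed.

Lemma is_derive_psi p b x : 0 < p -> is_derive (psi p b) x (dpsi p b x).
Proof.
intros Hp; pose proof (psi_den_pos p (b * x) Hp) as D; unfold psi, phase, dpsi.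
assert (0 < 1 + b * x * / p * (b * x * / p)) by nra.
auto_derive; [exact I |].
simpl in *; field; repeat split; try lra.
Qed.

Lemma dpsi_frac_bounds p y : 0 < p -> 0 < p / (p ^ 2 + y ^ 2) <= / p.
Proof.
intros Hp; pose proof (psi_den_pos p y Hp) as D; split.
- now apply Rdiv_lt_0_compat.
- apply Rmult_le_reg_r with (p ^ 2 + y ^ 2); [exact D |].
  unfold Rdiv; rewrite Rmult_assoc, Rinv_l, Rmult_1_r by lra.
  rewrite Rmult_plus_distr_l; replace (/ p * p ^ 2) with p by (field; lra).
  pose proof (pow2_ge_0 y); pose proof (Rinv_0_lt_compat p Hp); nra.
Qed.

Lemma dpsi_bounds p b x : 0 < p -> 0 < b -> PI * b <= dpsi p b x <= b * (PI + / p).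
Proof. intros Hp Hb; pose proof (dpsi_frac_bounds p (b * x) Hp); unfold dpsi; nra. Qed.

Lemma dpsi_pos p b x : 0 < p -> 0 < b -> 0 < dpsi p b x.
Proof. intros Hp Hb; pose proof (dpsi_bounds p b x Hp Hb); pose proof PI_RGT_0; nra. Qed.

Lemma dpsi_lipschitz p b x y : 0 < p -> 0 < b ->
  Rabs (dpsi p b x - dpsi p b y) <= b ^ 2 / p ^ 2 * Rabs (x - y).
Proof.
intros Hp Hb; unfold dpsi; set (s := b * x); set (t := b * y).
pose proof (psi_den_pos p s Hp) as Ds; pose proof (psi_den_pos p t Hp) as Dt.
replace (b * (PI + p / (p ^ 2 + s ^ 2)) - b * (PI + p / (p ^ 2 + t ^ 2))) with
  (b * ((t - s) * (p * (s + t) / ((p ^ 2 + s ^ 2) * (p ^ 2 + t ^ 2))))) by (field; lra).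
rewrite !(Rabs_mult b), (Rabs_pos_eq b), Rabs_mult by lra.
replace (b ^ 2 / p ^ 2 * Rabs (x - y)) with (b * (Rabs (t - s) * / p ^ 2)).
2:{ unfold s, t; replace (b * y - b * x) with (b * (y - x)) by ring.
    rewrite Rabs_mult, (Rabs_pos_eq b), Rabs_minus_sym by lra; field; lra. }
apply Rmult_le_compat_l; [lra |]; apply Rmult_le_compat_l; [apply Rabs_pos |].
assert (P2 := pow_lt p 2 Hp).
apply Rabs_div_le; [now apply Rmult_lt_0_compat |].
rewrite Rabs_mult, (Rabs_pos_eq p) by lra.
apply Rle_trans with (p * (Rabs s + Rabs t)); [apply Rmult_le_compat_l; [lra | apply Rabs_triang] |].
replace (s ^ 2) with (Rabs s ^ 2) by apply pow2_abs.
replace (t ^ 2) with (Rabs t ^ 2) by apply pow2_abs.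
pose proof (Rabs_pos s); pose proof (Rabs_pos t).
set (S := Rabs s) in *; set (T := Rabs t) in *.
replace (/ p ^ 2 * ((p ^ 2 + S ^ 2) * (p ^ 2 + T ^ 2))) with
  (p ^ 2 + S ^ 2 + T ^ 2 + / p ^ 2 * (S ^ 2 * T ^ 2)) by (field; lra).
assert (0 <= / p ^ 2 * (S ^ 2 * T ^ 2)).
{ apply Rmult_le_pos; [left; now apply Rinv_0_lt_compat | nra]. }
pose proof (pow2_ge_0 (p / 2 - S)); pose proof (pow2_ge_0 (p / 2 - T)); nra.
Qed.

Lemma psi_increment p b x y : 0 < p -> 0 < b -> x <= y ->
  PI * b * (y - x) <= psi p b y - psi p b x <= b * (PI + / p) * (y - x).
Proof.
intros Hp Hb [H | ->]; [| split; right; ring].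
destruct (MVT_cor2 (psi p b) (dpsi p b) x y H) as [c [E Hc]].
{ intros c _; apply is_derive_Reals, is_derive_psi, Hp. }
pose proof (dpsi_bounds p b c Hp Hb); rewrite E; split; apply Rmult_le_compat_r; lra.
Qed.

(** Excision is symmetric in [x], whereas the conjugate kernel cancels over intervals symmetric in
    the phase. The mismatch is of order [e ^ 2], so after multiplication by [u + v] and division by
    [w ^ 2] it still leaves an error of order [e]. *)
Lemma psi_second_difference p b x e : 0 < p -> 0 < b -> 0 <= e ->
  Rabs (psi p b (x + e) + psi p b (x - e) - 2 * psi p b x) <= 2 * (b ^ 2 / p ^ 2) * e ^ 2.
Proof.
intros Hp Hb He; set (L := b ^ 2 / p ^ 2).
assert (HL : 0 <= L) by (left; apply Rdiv_lt_0_compat; apply pow_lt; assumption).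
set (g := fun t => psi p b (x + t) + psi p b (x - t)).
assert (Z : Rabs (g e - g 0) <= L * (2 * e) * Rabs (e - 0)).
{ apply (bounded_variation g (fun t => dpsi p b (x + t) - dpsi p b (x - t))).
  intros t Ht; rewrite !Rminus_0_r, (Rabs_pos_eq e) in Ht by lra; split.
  - unfold g; pose proof (is_derive_psi p b (x + t) Hp); pose proof (is_derive_psi p b (x - t) Hp).
    auto_derive; [repeat split; eexists; eassumption |].
    rewrite !(Derive_eta _ _ _ (is_derive_psi p b _ Hp)); unfold Rminus; ring.
  - eapply Rle_trans; [now apply dpsi_lipschitz |]; fold L.
    apply Rmult_le_compat_l; [exact HL |].
    replace (x + t - (x - t)) with (2 * t) by ring.
    rewrite Rabs_mult, Rabs_pos_eq by lra; lra. }
unfold g in Z; rewrite !Rminus_0_r, Rplus_0_r, (Rabs_pos_eq e) in Z by lra.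
replace (psi p b (x + e) + psi p b (x - e) - 2 * psi p b x) with
  (psi p b (x + e) + psi p b (x - e) - (psi p b x + psi p b x)) by ring.
eapply Rle_trans; [exact Z | right; ring].
Qed.

(** The zero of phase [(i + 1) PI] lies at [b x] in [(i + 1 / 2, i + 1)], at least [1 / 4] away from
    both ends of its cell. The shift [1 / 4] also keeps the phase within [3 PI / 4] of that of the
    zero: [PI b x] moves by at most [PI / 4] to the right and [3 PI / 4] to the left, and [atan]
    adds between [0] and [PI / 2]. *)
Definition cell (b : R) (i : nat) : R := (INR i + 1 / 4) / b.

Lemma cell_S b i : 0 < b -> cell b (S i) = cell b i + / b.
Proof. intros; unfold cell; rewrite S_INR; field; lra. Qed.

Lemma cell_mult b i : 0 < b -> b * cell b i = INR i + 1 / 4.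
Proof. intros; unfold cell; field; lra. Qed.

Lemma cell_pos b i : 0 < b -> 0 < cell b i.
Proof. intros; unfold cell; pose proof (pos_INR i); apply Rdiv_lt_0_compat; lra. Qed.

Lemma cell_le b i j : 0 < b -> (i <= j)%nat -> cell b i <= cell b j.
Proof.
intros Hb H; unfold cell; apply Rmult_le_compat_r; [left; now apply Rinv_0_lt_compat |].
apply le_INR in H; lra.
Qed.

Lemma sin_psi_cell p b i mu x : 0 < p -> 0 < b -> psi p b mu = INR (S i) * PI ->
  cell b i <= x <= cell b (S i) ->
  c0 * PI * b * Rabs (x - mu) <= Rabs (sin (psi p b x)).
Proof.
intros Hp Hb Hmu Hx; assert (P := PI_RGT_0); assert (C0 := c0_pos).
pose proof (cell_mult b i Hb) as E1; pose proof (cell_mult b (S i) Hb) as E2.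
pose proof (cell_pos b i Hb); rewrite S_INR in *.
assert (X1 : INR i + 1 / 4 <= b * x) by (rewrite <- E1; apply Rmult_le_compat_l; lra).
assert (X2 : b * x <= INR i + 1 + 1 / 4) by (rewrite <- E2; apply Rmult_le_compat_l; lra).
assert (A : 0 < atan (b * x / p) < PI / 2).
{ split; [| apply atan_bound].
  rewrite <- atan_0; apply atan_increasing, Rdiv_lt_0_compat; [| exact Hp].
  pose proof (pos_INR i); lra. }
assert (R : Rabs (psi p b x - INR (S i) * PI) <= 3 * PI / 4).
{ rewrite S_INR; unfold psi, phase; apply Rabs_le; nra. }
eapply Rle_trans; [| apply sin_lower_shift, R].
rewrite S_INR, <- Hmu, !Rmult_assoc; apply Rmult_le_compat_l; [lra |]; rewrite <- Rmult_assoc.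
destruct (Rle_dec mu x) as [L | L].
- pose proof (psi_increment p b mu x Hp Hb L) as [I _].
  rewrite !Rabs_pos_eq; [exact I | | lra]; eapply Rle_trans; [| exact I].
  apply Rmult_le_pos; nra.
- pose proof (psi_increment p b x mu Hp Hb ltac:(lra)) as [I _].
  rewrite Rabs_minus_sym, (Rabs_minus_sym (psi p b x)).
  rewrite !Rabs_pos_eq; [exact I | | lra]; eapply Rle_trans; [| exact I].
  apply Rmult_le_pos; nra.
Qed.

(** [psi] also vanishes at [0], on the edge of the domain and outside every cell. The linear lower
    bound lets a kernel of size [1 / x] be integrated there against an amplitude of size [x ^ g]. *)
Lemma sin_psi_zero p b x : 0 < p -> 0 < b -> 0 < x <= cell b 0 ->
  c0 * PI * b * x <= Rabs (sin (psi p b x)).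
Proof.
intros Hp Hb Hx; assert (P := PI_RGT_0); assert (C0 := c0_pos).
pose proof (cell_mult b 0 Hb) as E1; simpl INR in E1.
assert (X0 : 0 < b * x) by (apply Rmult_lt_0_compat; lra).
assert (X1 : b * x <= 1 / 4) by (apply Rle_trans with (b * cell b 0); [apply Rmult_le_compat_l; lra | lra]).
assert (A : 0 < atan (b * x / p) < PI / 2).
{ split; [| apply atan_bound].
  rewrite <- atan_0; now apply atan_increasing, Rdiv_lt_0_compat. }
assert (R : 0 <= psi p b x <= 3 * PI / 4) by (unfold psi, phase; nra).
eapply Rle_trans; [| apply sin_lower; rewrite Rabs_pos_eq; lra].
rewrite Rabs_pos_eq, !Rmult_assoc by lra; apply Rmult_le_compat_l; [lra |].
unfold psi, phase; lra.
Qed.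

Lemma is_cint_RtoC f a b l : is_RInt f a b l -> is_cint (fun x => RtoC (f x)) a b (RtoC l).
Proof.
intros H; apply is_cint_pair; simpl; [exact H |].
refine (eq_ind _ (is_RInt _ a b) (is_RInt_const (V := R_NormedModule) a b 0) 0 _).
unfold scal; simpl; unfold mult; simpl; ring.
Qed.

Lemma continuity_pt_psi p b x : 0 < p -> continuity_pt (psi p b) x.
Proof. intros; eapply is_derive_cont; now apply is_derive_psi. Qed.

Lemma continuity_pt_dpsi p b x : 0 < p -> continuity_pt (dpsi p b) x.
Proof.
intros Hp; pose proof (psi_den_pos p (b * x) Hp); unfold dpsi.
eapply is_derive_cont; auto_derive; [| reflexivity]; simpl in *; lra.
Qed.

Lemma continuity_pt_kpsi (k : R -> R) p b x : 0 < p -> continuity_pt k (psi p b x) ->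
  continuity_pt (fun x => k (psi p b x)) x.
Proof. intros; apply (continuity_pt_comp (psi p b) k); [now apply continuity_pt_psi | assumption]. Qed.

Lemma kernel_psi_mass k p b x y : 0 < p -> (forall t, continuity_pt k t) ->
  is_RInt (fun t => dpsi p b t * k (psi p b t)) x y (kint k (psi p b x) (psi p b y)).
Proof.
intros Hp Hk; apply (is_RInt_comp (V := R_CompleteNormedModule) k (psi p b) (dpsi p b)).
- intros t _; apply continuity_pt_filterlim, Hk.
- intros t _; split; [now apply is_derive_psi |].
  apply continuity_pt_filterlim; now apply continuity_pt_dpsi.
Qed.

(** The cell is cut at [mu - e] and [mu + e]. Outside, [k rho] is replaced by its limit [k1];
    inside, [F / dpsi] is frozen at [mu], so that only the mass of the kernel in the phase variable
    remains. [C1] does not depend on [e] while [K1] does, which forces [rho -> 1-] before [e -> 0].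
    The bound is linear in [B], so estimates for successive cells can be summed. [E] is constrained
    on this cell only, which suits an excised function. *)
Lemma cell_estimate k k1 c p b : is_kernel k k1 c -> 0 < p -> 0 < b ->
  exists C1 (K1 : R -> R), 0 <= C1 /\ (forall e, 0 < e -> 0 <= K1 e) /\
  forall (F E : R -> C) (i : nat) (mu B e rho : R),
  0 < e -> e < / (4 * b) -> b * (PI + / p) * e <= 1 -> 1 / 2 <= rho < 1 ->
  cell b i + / (4 * b) <= mu <= cell b (S i) - / (4 * b) ->
  psi p b mu = INR (S i) * PI ->
  (forall x, cell b i <= x <= cell b (S i) -> ccont F x /\ Cmod (F x) <= B /\
     Cmod (F x / RtoC (dpsi p b x) - F mu / RtoC (dpsi p b mu)) <= B * Rabs (x - mu)) ->
  (forall x, cell b i <= x <= cell b (S i) -> Rabs (x - mu) < e -> E x = 0%C) ->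
  (forall x, cell b i <= x <= cell b (S i) -> e <= Rabs (x - mu) ->
     E x = (F x * RtoC (k1 (psi p b x)))%C) ->
  ex_cint E (cell b i) (cell b (S i)) /\
  Cmod (cint (fun x => F x * RtoC (k rho (psi p b x)))%C (cell b i) (cell b (S i)) -
    cint E (cell b i) (cell b (S i)) - RtoC c * (F mu / RtoC (dpsi p b mu))) <=
  B * (C1 * e + K1 e * (1 - rho)).
Proof.
intros KK Hp Hb; assert (P := PI_RGT_0); assert (C0 := c0_pos).
destruct (ker_mass _ _ _ KK) as [CM [HCM MASS]].
set (Dm := b * (PI + / p)); set (k0 := c0 * PI * b); set (L := b ^ 2 / p ^ 2).
assert (Hip : 0 < / p) by now apply Rinv_0_lt_compat.
assert (HDm : 0 < Dm) by (apply Rmult_lt_0_compat; lra).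
assert (Hk0 : 0 < k0) by (apply Rmult_lt_0_compat; [apply Rmult_lt_0_compat |]; lra).
assert (HL : 0 <= L) by (left; apply Rdiv_lt_0_compat; apply pow_lt; assumption).
assert (Hpb : 0 < PI * b) by now apply Rmult_lt_0_compat.
exists (2 * Dm / k0 + / (PI * b) * CM * (4 * L * Dm / (PI * b) ^ 2)).
exists (fun e => 2 * (2 / (k0 * e) ^ 3 * / b) + / (PI * b) * CM * / (PI * b * e)).
split; [| split].
- apply Rplus_le_le_0_compat.
  + left; apply Rdiv_lt_0_compat; lra.
  + apply Rmult_le_pos; [apply Rmult_le_pos; [left; now apply Rinv_0_lt_compat | exact HCM] |].
    assert (0 <= L * Dm) by (apply Rmult_le_pos; lra).
    apply Rmult_le_pos; [lra | left; apply Rinv_0_lt_compat, pow_lt, Hpb].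
- intros e He; assert (0 < k0 * e) by now apply Rmult_lt_0_compat.
  apply Rplus_le_le_0_compat.
  + apply Rmult_le_pos; [lra |]; apply Rmult_le_pos;
      [left; apply Rdiv_lt_0_compat; [lra | now apply pow_lt] | left; now apply Rinv_0_lt_compat].
  + apply Rmult_le_pos; [apply Rmult_le_pos; [left; now apply Rinv_0_lt_compat | exact HCM] |].
    left; apply Rinv_0_lt_compat; now apply Rmult_lt_0_compat.
- intros F E i mu B e rho He He4 HDe Hr Hmu Hpsi HF HE0 HE1.
  set (a := cell b i) in *; set (a' := cell b (S i)) in *.
  assert (Haa : a' = a + / b) by now apply cell_S.
  assert (Hib : 0 < / b) by now apply Rinv_0_lt_compat.
  assert (H4b : / (4 * b) = / 4 * / b) by (field; lra).
  assert (O1 : a < mu - e) by lra; assert (O2 : mu + e < a') by lra.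
  assert (SL : forall x, a <= x <= a' -> k0 * Rabs (x - mu) <= Rabs (sin (psi p b x)))
    by (intros; now apply sin_psi_cell with i).
  assert (KR : forall t, continuity_pt (k rho) t) by (intros; apply (ker_cont _ _ _ KK); lra).
  set (X := fun x => (F x * RtoC (k rho (psi p b x)))%C).
  set (Y := fun x => (F x * RtoC (k1 (psi p b x)))%C).
  assert (CX : forall x, a <= x <= a' -> ccont X x).
  { intros x Hx; apply ccont_mult; [now apply HF |].
    apply ccont_RtoC, continuity_pt_kpsi; [exact Hp | apply KR]. }
  assert (CY : forall x, a <= x <= a' -> e <= Rabs (x - mu) -> ccont Y x).
  { intros x Hx Hxe; apply ccont_mult; [now apply HF |].
    apply ccont_RtoC, continuity_pt_kpsi; [exact Hp |].
    apply (ker_cont1 _ _ _ KK); intros Z; pose proof (SL x Hx) as S.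
    rewrite Z, Rabs_R0 in S; assert (0 < k0 * Rabs (x - mu)) by (apply Rmult_lt_0_compat; lra); lra. }
  assert (A1 : forall x, x <= mu - e -> e <= Rabs (x - mu)) by (intros; rewrite Rabs_left1; lra).
  assert (A2 : forall x, mu + e <= x -> e <= Rabs (x - mu)) by (intros; rewrite Rabs_pos_eq; lra).
  assert (IX : forall u v, a <= u <= v -> v <= a' -> is_cint X u v (cint X u v)).
  { intros u v Hu Hv; apply cint_correct, ex_cint_ccont; intros t Ht.
    rewrite Rmin_left, Rmax_right in Ht by lra; apply CX; lra. }
  assert (IY1 : is_cint Y a (mu - e) (cint Y a (mu - e))).
  { apply cint_correct, ex_cint_ccont; intros t Ht.
    rewrite Rmin_left, Rmax_right in Ht by lra; apply CY; [| apply A1]; lra. }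
  assert (IY2 : is_cint Y (mu + e) a' (cint Y (mu + e) a')).
  { apply cint_correct, ex_cint_ccont; intros t Ht.
    rewrite Rmin_left, Rmax_right in Ht by lra; apply CY; [| apply A2]; lra. }
  assert (IE : is_cint E a a' (cint Y a (mu - e) + 0 + cint Y (mu + e) a')%C).
  { apply is_cint_Chasles with (mu + e); [apply is_cint_Chasles with (mu - e) |].
    - eapply is_cint_ext; [| exact IY1]; intros t Ht.
      rewrite Rmin_left, Rmax_right in Ht by lra; symmetry; apply HE1; [| apply A1]; lra.
    - apply is_cint_ext with (fun _ => RtoC 0).
      + intros t Ht; rewrite Rmin_left, Rmax_right in Ht by lra; symmetry; apply HE0; [lra |].
        apply Rabs_def1; lra.
      + refine (eq_ind _ (is_RInt (V := C_R_NormedModule) _ _ _)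
          (is_RInt_const (V := C_R_NormedModule) (mu - e) (mu + e) (RtoC 0)) (RtoC 0) _).
        apply injective_projections; unfold scal; simpl; unfold scal; simpl; unfold mult; simpl; ring.
    - eapply is_cint_ext; [| exact IY2]; intros t Ht.
      rewrite Rmin_left, Rmax_right in Ht by lra; symmetry; apply HE1; [| apply A2]; lra. }
  split; [eexists; exact IE |].
  rewrite (is_cint_unique _ _ _ _ IE); fold X.
  rewrite (cint_Chasles X a (mu + e) a'), (cint_Chasles X a (mu - e) (mu + e))
    by (eexists; apply IX; lra).
  set (Q := (2 / (k0 * e) ^ 3 * (1 - rho))).
  assert (Hke : 0 < k0 * e) by now apply Rmult_lt_0_compat.
  assert (HB : 0 <= B) by (destruct (HF a ltac:(lra)) as (_ & HB & _); pose proof (Cmod_ge_0 (F a)); lra).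
  (* At distance at least [e] from [mu] the sine is at least [k0 * e], so [ker_diff] costs its
     inverse cube. *)
  assert (OUT : forall x, a <= x <= a' -> e <= Rabs (x - mu) -> Cmod (X x - Y x) <= B * Q).
  { intros x Hx Hxe; unfold X, Y.
    replace (_ - _)%C with (F x * RtoC (k rho (psi p b x) - k1 (psi p b x)))%C
      by (rewrite RtoC_minus; ring).
    rewrite Cmod_mult, Cmod_R.
    apply Rmult_le_compat; [apply Cmod_ge_0 | apply Rabs_pos | now apply HF |].
    pose proof (ker_diff _ _ _ KK rho (psi p b x) Hr) as D.
    assert (S : (k0 * e) ^ 3 <= Rabs (sin (psi p b x)) ^ 3).
    { apply pow_incr; split; [lra |]; eapply Rle_trans; [| apply SL, Hx].
      apply Rmult_le_compat_l; lra. }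
    assert (P3 : 0 < (k0 * e) ^ 3) by now apply pow_lt.
    unfold Q; apply Rmult_le_reg_r with ((k0 * e) ^ 3); [exact P3 |].
    replace (2 / (k0 * e) ^ 3 * (1 - rho) * (k0 * e) ^ 3) with (2 * (1 - rho)) by (field; lra).
    eapply Rle_trans; [| exact D]; apply Rmult_le_compat_l; [apply Rabs_pos | exact S]. }
  assert (HQ : 0 <= Q).
  { unfold Q; apply Rmult_le_pos; [left; apply Rdiv_lt_0_compat; [lra | now apply pow_lt] | lra]. }
  assert (J1 : Cmod (cint X a (mu - e) - cint Y a (mu - e)) <= B * Q * / b).
  { eapply Rle_trans.
    - eapply (is_cint_bound_const (fun x => X x - Y x)%C (B * Q) a (mu - e)); [lra | |].
      + intros x Hx; apply OUT; [| apply A1]; lra.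
      + apply is_cint_minus; [apply IX; lra | exact IY1].
    - apply Rmult_le_compat_l; [now apply Rmult_le_pos | lra]. }
  assert (J2 : Cmod (cint X (mu + e) a' - cint Y (mu + e) a') <= B * Q * / b).
  { eapply Rle_trans.
    - eapply (is_cint_bound_const (fun x => X x - Y x)%C (B * Q) (mu + e) a'); [lra | |].
      + intros x Hx; apply OUT; [| apply A2]; lra.
      + apply is_cint_minus; [apply IX; lra | exact IY2].
    - apply Rmult_le_compat_l; [now apply Rmult_le_pos | lra]. }
  set (h := fun x => (F x / RtoC (dpsi p b x))%C).
  set (M := kint (k rho) (psi p b (mu - e)) (psi p b (mu + e))).
  assert (IM : is_cint (fun x => h mu * RtoC (dpsi p b x * k rho (psi p b x)))%C (mu - e) (mu + e)
    (h mu * RtoC M)%C).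
  { apply is_cint_scal, is_cint_RtoC; now apply kernel_psi_mass. }
  (* Freezing costs a factor [Rabs (x - mu)], which cancels the singularity: the kernel is at most
     [1 / (k0 * Rabs (x - mu))]. The integrand is then bounded over a length [2 * e]. *)
  assert (J3 : Cmod (cint X (mu - e) (mu + e) - h mu * RtoC M) <= B * (Dm / k0) * (2 * e)).
  { replace (2 * e) with (mu + e - (mu - e)) by ring.
    eapply (is_cint_bound_const (fun x => X x - h mu * RtoC (dpsi p b x * k rho (psi p b x)))%C);
      [lra | | apply is_cint_minus; [apply IX; lra | exact IM]].
    intros x Hx; assert (Hx' : a <= x <= a') by lra.
    pose proof (dpsi_bounds p b x Hp Hb) as DB; fold Dm in DB.
    replace (_ - _)%C with ((h x - h mu) * RtoC (dpsi p b x * k rho (psi p b x)))%C.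
    2:{ unfold X, h; rewrite RtoC_mult; field; split; injection;
        apply Rgt_not_eq, dpsi_pos; assumption. }
    rewrite Cmod_mult, Cmod_R, Rabs_mult, (Rabs_pos_eq (dpsi p b x)) by lra.
    destruct (HF x Hx') as (_ & _ & Hh); fold (h x) (h mu) in Hh.
    apply Rle_trans with (B * Rabs (x - mu) * (Dm * Rabs (k rho (psi p b x)))).
    - apply Rmult_le_compat; [apply Cmod_ge_0 | | exact Hh |].
      + apply Rmult_le_pos; [lra | apply Rabs_pos].
      + apply Rmult_le_compat_r; [apply Rabs_pos | lra].
    - replace (B * Rabs (x - mu) * (Dm * Rabs (k rho (psi p b x)))) with
        (B * (Dm / k0) * (k0 * Rabs (x - mu) * Rabs (k rho (psi p b x)))) by (field; lra).
      rewrite <- (Rmult_1_r (B * (Dm / k0))) at 2.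
      apply Rmult_le_compat_l.
      { apply Rmult_le_pos; [exact HB | left; now apply Rdiv_lt_0_compat]. }
      eapply Rle_trans; [| apply (ker_sin _ _ _ KK rho (psi p b x) Hr)].
      rewrite Rmult_comm; apply Rmult_le_compat_l; [apply Rabs_pos | now apply SL]. }
  (* In the phase variable the inner interval extends by [u] and [v] around [INR (S i) * PI], both
     at least [w = PI * b * e]; the assumption [b * (PI + / p) * e <= 1] keeps them below [1], as
     [ker_mass] requires. *)
  assert (J4 : Cmod (h mu * RtoC M - RtoC c * h mu) <=
    B * / (PI * b) * (CM * (4 * L * Dm / (PI * b) ^ 2 * e + (1 - rho) / (PI * b * e)))).
  { replace (_ - _)%C with (h mu * RtoC (M - c))%C by (rewrite RtoC_minus; ring).
    rewrite Cmod_mult, Cmod_R.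
    apply Rmult_le_compat; [apply Cmod_ge_0 | apply Rabs_pos | |].
    - unfold h; pose proof (dpsi_bounds p b mu Hp Hb) as DB.
      rewrite Cmod_div, Cmod_R, Rabs_pos_eq by (try lra; injection; lra).
      destruct (HF mu ltac:(lra)) as (_ & HFB & _).
      apply Rmult_le_compat; [apply Cmod_ge_0 | left; apply Rinv_0_lt_compat; lra | exact HFB |].
      apply Rinv_le_contravar; lra.
    - unfold M.
      pose proof (psi_increment p b mu (mu + e) Hp Hb ltac:(lra)) as U; fold Dm in U.
      pose proof (psi_increment p b (mu - e) mu Hp Hb ltac:(lra)) as V; fold Dm in V.
      replace (mu + e - mu) with e in U by ring; replace (mu - (mu - e)) with e in V by ring.
      pose proof (psi_second_difference p b mu e Hp Hb ltac:(lra)) as S2; fold L in S2.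
      set (u := psi p b (mu + e) - psi p b mu) in *.
      set (v := psi p b mu - psi p b (mu - e)) in *.
      replace (psi p b (mu - e)) with (INR (S i) * PI - v) by (unfold v; rewrite Hpsi; ring).
      replace (psi p b (mu + e)) with (INR (S i) * PI + u) by (unfold u; rewrite Hpsi; ring).
      assert (UV : Rabs (u - v) <= 2 * L * e ^ 2).
      { replace (u - v) with (psi p b (mu + e) + psi p b (mu - e) - 2 * psi p b mu)
          by (unfold u, v; ring); exact S2. }
      assert (Hw : 0 < PI * b * e) by now apply Rmult_lt_0_compat.
      eapply Rle_trans; [apply (MASS (S i) rho u v (PI * b * e)); lra |].
      apply Rmult_le_compat_l; [exact HCM |]; apply Rplus_le_compat_r.
      replace (4 * L * Dm / (PI * b) ^ 2 * e) with
        (2 * L * e ^ 2 * (2 * (Dm * e)) / (PI * b * e) ^ 2) by (field; lra).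
      apply Rmult_le_compat_r; [left; apply Rinv_0_lt_compat, pow_lt, Hw |].
      apply Rmult_le_compat; [apply Rabs_pos | lra | exact UV | lra]. }
  replace (_ - _ - _)%C with
    ((cint X a (mu - e) - cint Y a (mu - e)) + (cint X (mu + e) a' - cint Y (mu + e) a') +
     (cint X (mu - e) (mu + e) - h mu * RtoC M) + (h mu * RtoC M - RtoC c * h mu))%C
    by (unfold h; ring).
  eapply Rle_trans; [apply Cmod_triangle |].
  eapply Rle_trans; [apply Rplus_le_compat_r, Cmod_triangle |].
  eapply Rle_trans; [apply Rplus_le_compat_r, Rplus_le_compat_r, Cmod_triangle |].
  apply Rle_trans with (B * Q * / b + B * Q * / b + B * (Dm / k0) * (2 * e) +
    B * / (PI * b) * (CM * (4 * L * Dm / (PI * b) ^ 2 * e + (1 - rho) / (PI * b * e)))); [lra |].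
  right; unfold Q; field; repeat split; try lra.
Qed.

(** * Complex series *)

(** The last index is excluded, unlike in [sum_n]: [csum u N] matches the [N] cells below
    [cell b N]. *)
Fixpoint csum (u : nat -> C) (N : nat) : C :=
  match N with O => 0%C | S N => (csum u N + u N)%C end.

Notation is_cseries u l := (is_series (V := C_R_NormedModule) u l).

Lemma sum_n_csum (u : nat -> C) N : sum_n (G := C_R_NormedModule) u N = csum u (S N).
Proof.
induction N as [| N IH].
- rewrite sum_O; simpl; ring.
- rewrite sum_Sn, IH; reflexivity.
Qed.

Lemma is_cseries_close u l : is_cseries u l -> forall eta, 0 < eta ->
  exists N, forall n, (N <= n)%nat -> Cmod (csum u n - l) <= eta.
Proof.
intros H eta He; assert (He' : 0 < eta / 2) by lra.
destruct (H _ (locally_ball (l : C_R_NormedModule) (mkposreal _ He'))) as [N HN].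
exists (S N); intros n Hn; destruct n as [| n]; [lia |].
destruct (HN n ltac:(lia)) as [H1 H2]; rewrite sum_n_csum in H1, H2.
pose proof (Cmod_le_sum (csum u (S n) - l)) as HS.
change (Rabs (fst (csum u (S n) - l)%C) < eta / 2) in H1.
change (Rabs (snd (csum u (S n) - l)%C) < eta / 2) in H2.
lra.
Qed.

Lemma is_cseries_intro u l : (forall eta, 0 < eta ->
  exists N, forall n, (N <= n)%nat -> Cmod (csum u n - l) <= eta) -> is_cseries u l.
Proof.
intros H P [eps HP].
destruct (H (eps / 2)) as [N HN]; [destruct eps; simpl; lra |].
exists N; intros n Hn; apply HP; rewrite sum_n_csum.
specialize (HN (S n) ltac:(lia)).
assert (Hb : forall r : R, Rabs r <= Cmod (csum u (S n) - l) -> Rabs r < eps).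
{ intros r Hr; destruct eps; simpl in *; lra. }
split; apply Hb; [apply (Re_le_Cmod (_ - _)%C) | apply (Im_le_Cmod (_ - _)%C)].
Qed.

Lemma is_cseries_unique u l m : is_cseries u l -> is_cseries u m -> l = m.
Proof.
intros H1 H2; apply (filterlim_locally_unique (F := eventually) (V := C_R_NormedModule) _ _ _ H1 H2).
Qed.

Lemma CSeries_unique u l : is_cseries u l -> CSeries u = l.
Proof.
intros H; unfold CSeries.
apply (iota_unique (V := C_R_CompleteNormedModule)); [| exact H].
intros y Hy; exact (is_cseries_unique u y l Hy H).
Qed.

Lemma csum_scal c u N : csum (fun i => c * u i)%C N = (c * csum u N)%C.
Proof. induction N as [| N IH]; simpl; [ring | rewrite IH; ring]. Qed.

Lemma csum_minus u v N : csum (fun i => u i - v i)%C N = (csum u N - csum v N)%C.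
Proof. induction N as [| N IH]; simpl; [ring | rewrite IH; ring]. Qed.

Lemma is_cseries_ext u v l : (forall i, u i = v i) -> is_cseries u l -> is_cseries v l.
Proof. apply (is_series_ext (V := C_R_NormedModule)). Qed.

Lemma is_cseries_scal c u l : is_cseries u l -> is_cseries (fun i => c * u i)%C (c * l)%C.
Proof.
intros H; apply is_cseries_intro; intros eta He.
assert (Hc := Cmod_ge_0 c).
destruct (is_cseries_close u l H (eta / (Cmod c + 1))) as [N HN].
{ apply Rdiv_lt_0_compat; lra. }
exists N; intros n Hn; specialize (HN n Hn).
rewrite csum_scal; replace (_ - _)%C with (c * (csum u n - l))%C by ring.
rewrite Cmod_mult; apply Rle_trans with ((Cmod c + 1) * (eta / (Cmod c + 1))); [| right; field; lra].
apply Rmult_le_compat; auto using Cmod_ge_0; lra.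
Qed.

Lemma csum_bound u r K N : 0 <= r < 1 -> 0 <= K -> (forall i, Cmod (u i) <= K * r ^ i) ->
  Cmod (csum u N) <= K / (1 - r).
Proof.
intros Hr HK H.
(* The factor [1 - r ^ N] strengthens the bound enough for the induction. *)
assert (G : Cmod (csum u N) <= K / (1 - r) * (1 - r ^ N)).
{ induction N as [| N IH]; simpl; [rewrite Cmod_0; lra |].
  eapply Rle_trans; [apply Cmod_triangle |]; specialize (H N).
  replace (K / (1 - r) * (1 - r * r ^ N)) with (K / (1 - r) * (1 - r ^ N) + K * r ^ N)
    by (field; lra); lra. }
assert (0 <= r ^ N) by (apply pow_le; lra).
assert (0 <= K / (1 - r)) by (apply Rmult_le_pos; [lra | left; apply Rinv_0_lt_compat; lra]).
nra.
Qed.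

Lemma ex_cseries_geom u r K : 0 <= r < 1 -> (forall i, Cmod (u i) <= K * r ^ i) ->
  exists l, is_cseries u l.
Proof.
intros Hr H.
apply (ex_series_le (V := C_R_CompleteNormedModule) u (fun i => K * r ^ i)).
- intros i; change (norm (V := C_R_NormedModule) (u i) <= K * r ^ i); rewrite norm_Cmod; apply H.
- apply (ex_series_scal (V := R_NormedModule)), ex_series_geom; rewrite Rabs_pos_eq; lra.
Qed.

Lemma is_cseries_close_bound u v l m r K : 0 <= r < 1 -> 0 <= K ->
  is_cseries u l -> is_cseries v m -> (forall i, Cmod (u i - v i) <= K * r ^ i) ->
  Cmod (l - m) <= K / (1 - r).
Proof.
intros Hr HK Hu Hv H; apply le_epsilon; intros eta He.
destruct (is_cseries_close u l Hu (eta / 2)) as [N1 H1]; [lra |].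
destruct (is_cseries_close v m Hv (eta / 2)) as [N2 H2]; [lra |].
set (N := max N1 N2); specialize (H1 N ltac:(lia)); specialize (H2 N ltac:(lia)).
pose proof (csum_bound (fun i => u i - v i)%C r K N Hr HK H) as B; rewrite csum_minus in B.
replace (l - m)%C with ((csum u N - csum v N) + ((csum v N - m) - (csum u N - l)))%C by ring.
eapply Rle_trans; [apply Cmod_triangle |].
pose proof (Cmod_triangle (csum v N - m) (- (csum u N - l))) as T; rewrite Cmod_opp in T.
change (csum v N - m + - (csum u N - l))%C with (csum v N - m - (csum u N - l))%C in T; lra.
Qed.

(** The size [x ^ g] at [0] compensates the pole of the kernel there. The Lipschitz condition
    concerns [f / dpsi], the density in the phase variable, over distances at most one cell; its
    exponential weight turns the sum over the cells into a geometric series. *)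
Definition admissible (p b g kap K : R) (f : R -> C) : Prop :=
  (forall x, 0 < x -> ccont f x) /\
  (forall x, 0 < x -> Cmod (f x) <= K * (Rpower x g * exp (- (kap * x)))) /\
  (forall x, cell b 0 <= x -> Cmod (f x) <= K * exp (- (kap * x))) /\
  (forall x y, cell b 0 <= x -> cell b 0 <= y -> Rabs (x - y) <= / b ->
     Cmod (f x / RtoC (dpsi p b x) - f y / RtoC (dpsi p b y)) <=
       K * exp (- (kap * x)) * Rabs (x - y)).

Definition is_poles (p b : R) (mu : nat -> R) : Prop :=
  forall i, cell b i + / (4 * b) <= mu i <= cell b (S i) - / (4 * b) /\
    psi p b (mu i) = INR (S i) * PI.

Lemma excise_in f a e x i : Rabs (x - a i) < e -> excise f a e x = 0%C.
Proof.
intros H; unfold excise; destruct (excluded_middle_informative _) as [_ | N]; [reflexivity |].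
exfalso; apply N; now exists i.
Qed.

Lemma excise_out f a e x : (forall i, e <= Rabs (x - a i)) -> excise f a e x = f x.
Proof.
intros H; unfold excise; destruct (excluded_middle_informative _) as [[i Hi] | N]; [| reflexivity].
specialize (H i); lra.
Qed.

(** With a radius below [/ (4 * b)], a cell meets no excised interval but its own. *)
Lemma poles_far p b mu i j x : 0 < b -> is_poles p b mu -> i <> j ->
  cell b i <= x <= cell b (S i) -> / (4 * b) <= Rabs (x - mu j).
Proof.
intros Hb Hmu N Hx; destruct (Hmu j) as [Hj _].
assert (0 < / (4 * b)) by (apply Rinv_0_lt_compat; lra).
destruct (Nat.lt_ge_cases j i) as [L | L].
- pose proof (cell_le b (S j) i Hb L); rewrite Rabs_pos_eq; lra.
- pose proof (cell_le b (S i) j Hb ltac:(lia)); rewrite Rabs_left; lra.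
Qed.

Lemma poles_far_zero p b mu j x : 0 < b -> is_poles p b mu -> x <= cell b 0 ->
  / (4 * b) <= Rabs (x - mu j).
Proof.
intros Hb Hmu Hx; destruct (Hmu j) as [Hj _].
assert (0 < / (4 * b)) by (apply Rinv_0_lt_compat; lra).
pose proof (cell_le b 0 j Hb ltac:(lia)); rewrite Rabs_left; lra.
Qed.

Lemma cell_find b x : 0 < b -> cell b 0 <= x -> exists i, cell b i <= x <= cell b (S i).
Proof.
intros Hb Hx.
assert (G : forall N, x < cell b N -> exists i, cell b i <= x <= cell b (S i)).
{ induction N as [| N IH]; intros H; [lra |].
  destruct (Rlt_dec x (cell b N)) as [L | L]; [now apply IH |].
  exists N; lra. }
destruct (INR_unbounded (b * x)) as [N HN]; apply (G N).
apply Rmult_lt_reg_l with b; [exact Hb |]; rewrite cell_mult by exact Hb; lra.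
Qed.

Lemma is_RInt_Rpower g K x y : 0 < g -> 0 < x -> x <= y ->
  is_RInt (fun t => K * Rpower t (g - 1)) x y (K * ((Rpower y g - Rpower x g) / g)).
Proof.
intros Hg Hx Hxy; apply (is_RInt_scal (V := R_NormedModule)).
replace ((Rpower y g - Rpower x g) / g) with (/ g * Rpower y g - / g * Rpower x g) by (field; lra).
apply (is_RInt_derive (V := R_CompleteNormedModule) (fun t => / g * Rpower t g)); intros t Ht;
  rewrite Rmin_left, Rmax_right in Ht by assumption.
- pose proof (is_derive_Rpower t g ltac:(lra)) as D.
  replace (Rpower t (g - 1)) with (/ g * (g * Rpower t (g - 1))) by (field; lra).
  apply is_derive_scal, D.
- apply (ex_derive_continuous (V := R_NormedModule) (fun t => Rpower t (g - 1))).
  eexists; apply is_derive_Rpower; lra.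
Qed.

(** * Limits of the kernels *)

Definition kfun (p b : R) (k : R -> R) (f : R -> C) (x : R) : C :=
  (f x * RtoC (k (psi p b x)))%C.

Lemma admissible_nonneg p b g kap K f : admissible p b g kap K f -> 0 <= K.
Proof.
intros (_ & H & _); specialize (H 1 Rlt_0_1); pose proof (Cmod_ge_0 (f 1)).
assert (0 < Rpower 1 g * exp (- (kap * 1))) by (apply Rmult_lt_0_compat; apply exp_pos); nra.
Qed.

Lemma ker_le_inv (k : R) (s m : R) : 0 < m -> m <= s -> Rabs k * s <= 1 -> Rabs k <= / m.
Proof.
intros Hm Hs H; apply Rmult_le_reg_r with m; [exact Hm |]; rewrite Rinv_l by lra.
eapply Rle_trans; [| exact H]; apply Rmult_le_compat_l; [apply Rabs_pos | exact Hs].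
Qed.

Section Kernel.

Context (k : R -> R -> R) (k1 : R -> R) (c : R) (KK : is_kernel k k1 c).
Context (p b : R) (Hp : 0 < p) (Hb : 0 < b) (mu : nat -> R) (Hmu : is_poles p b mu).
Context (g kap K : R) (Hg : 0 < g) (Hkap : 0 < kap) (f : R -> C).
Context (Hf : admissible p b g kap K f).

Let k0 := c0 * PI * b.

Local Lemma k0_pos : 0 < k0.
Proof.
pose proof c0_pos; pose proof PI_RGT_0.
apply Rmult_lt_0_compat; [apply Rmult_lt_0_compat |]; lra.
Qed.

Local Lemma X_ccont rho x : 0 < rho < 1 -> 0 < x -> ccont (kfun p b (k rho) f) x.
Proof.
intros Hr Hx; apply ccont_mult; [now apply Hf |].
apply ccont_RtoC, continuity_pt_kpsi; [exact Hp | now apply (ker_cont _ _ _ KK)].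
Qed.

Local Lemma Y_ccont_zero x : 0 < x <= cell b 0 -> ccont (kfun p b k1 f) x.
Proof.
intros Hx; apply ccont_mult; [now apply Hf |].
apply ccont_RtoC, continuity_pt_kpsi; [exact Hp |].
apply (ker_cont1 _ _ _ KK); intros Z.
pose proof (sin_psi_zero p b x Hp Hb Hx) as S; rewrite Z, Rabs_R0 in S.
pose proof k0_pos; fold k0 in S; assert (0 < k0 * x) by (apply Rmult_lt_0_compat; lra); lra.
Qed.

Local Lemma X_loc_int rho : 0 < rho < 1 -> loc_int (kfun p b (k rho) f).
Proof. intros Hr; apply loc_int_ccont; intros; now apply X_ccont. Qed.

Lemma kernel_improper_exists rho : 0 < rho < 1 -> exists V, improper (kfun p b (k rho) f) V.
Proof.
intros Hr; pose proof (admissible_nonneg _ _ _ _ _ _ Hf) as HK.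
destruct (Rpower_exp_env g 1 kap Hg ltac:(lra) Hkap) as [K' [HK' B]].
apply (improper_exists _ g (K * (4 / (1 - rho) ^ 2) * K') Hg (X_loc_int rho Hr)).
intros x Hx; unfold kfun; rewrite Cmod_mult, Cmod_R.
pose proof (proj1 (proj2 Hf) x Hx) as F1; specialize (B x Hx).
replace (g - 1 + 1) with g in B by ring.
pose proof (ker_bounded _ _ _ KK rho (psi p b x) Hr) as B2.
assert (0 <= 4 / (1 - rho) ^ 2) by (left; apply Rdiv_lt_0_compat; [lra | apply pow_lt; lra]).
apply Rle_trans with (K * (Rpower x g * exp (- (kap * x))) * (4 / (1 - rho) ^ 2)).
- apply Rmult_le_compat; auto using Cmod_ge_0, Rabs_pos.
- replace (K * (4 / (1 - rho) ^ 2) * K' * env g x) with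
    (K * (4 / (1 - rho) ^ 2) * (K' * env g x)) by ring.
  replace (K * (Rpower x g * exp (- (kap * x))) * (4 / (1 - rho) ^ 2)) with
    (K * (4 / (1 - rho) ^ 2) * (Rpower x g * exp (- (kap * x)))) by ring.
  apply Rmult_le_compat_l; [now apply Rmult_le_pos | exact B].
Qed.

Local Lemma Rpower_pred x : 0 < x -> Rpower x g * / x = Rpower x (g - 1).
Proof.
intros Hx; unfold Rminus; rewrite Rpower_plus, Rpower_Ropp, Rpower_1; auto.
Qed.

(** Up to [e] both kernels are of size [1 / (k0 * x)], so the integrals are of size [e ^ g]
    uniformly in [rho] and in the lower end [d]. From [e] on, [ker_diff] makes the difference
    proportional to [1 - rho]. *)
Local Lemma zero_estimate rho d e : 1 / 2 <= rho < 1 -> 0 < d <= e -> e <= cell b 0 ->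
  Cmod (cint (kfun p b (k rho) f) d (cell b 0) - cint (kfun p b k1 f) d (cell b 0)) <=
  2 * K / k0 / g * Rpower e g +
  K * Rpower (cell b 0) g * (2 / (k0 * e) ^ 3) * cell b 0 * (1 - rho).
Proof.
intros Hr Hd He; pose proof (admissible_nonneg _ _ _ _ _ _ Hf) as HK; pose proof k0_pos as Hk0.
set (X := kfun p b (k rho) f); set (Y := kfun p b k1 f); set (w := cell b 0) in *.
assert (IX : forall u v, 0 < u <= v -> v <= w -> is_cint X u v (cint X u v)).
{ intros u v Hu Hv; apply cint_correct, X_loc_int; lra. }
assert (IY : forall u v, 0 < u <= v -> v <= w -> is_cint Y u v (cint Y u v)).
{ intros u v Hu Hv; apply cint_correct, ex_cint_ccont; intros t Ht.
  rewrite Rmin_left, Rmax_right in Ht by lra; apply Y_ccont_zero; fold w; lra. }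
assert (FB : forall x, 0 < x -> Cmod (f x) <= K * Rpower x g).
{ intros x Hx; eapply Rle_trans; [apply (proj1 (proj2 Hf) x Hx) |].
  apply Rmult_le_compat_l; [exact HK |]; rewrite <- (Rmult_1_r (Rpower x g)) at 2.
  apply Rmult_le_compat_l; [left; apply Rpower_pos |].
  rewrite <- exp_0; apply exp_le; nra. }
assert (SL : forall x, 0 < x <= w -> k0 * x <= Rabs (sin (psi p b x)))
  by (intros; now apply sin_psi_zero).
rewrite (cint_Chasles X d e w), (cint_Chasles Y d e w)
  by (eexists; first [apply IX; lra | apply IY; lra]).
replace (_ - _)%C with ((cint X d e - cint Y d e) + (cint X e w - cint Y e w))%C by ring.
eapply Rle_trans; [apply Cmod_triangle |]; apply Rplus_le_compat.
- apply Rle_trans with (2 * K / k0 * ((Rpower e g - Rpower d g) / g)).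
  + eapply (is_cint_bound (fun x => X x - Y x)%C (fun t => 2 * K / k0 * Rpower t (g - 1)) d e).
    * lra.
    * intros x Hx; unfold X, Y, kfun.
      replace (_ - _)%C with (f x * RtoC (k rho (psi p b x) - k1 (psi p b x)))%C
        by (rewrite RtoC_minus; ring).
      rewrite Cmod_mult, Cmod_R, <- Rpower_pred by lra.
      replace (2 * K / k0 * (Rpower x g * / x)) with (K * Rpower x g * (2 * / (k0 * x)))
        by (field; lra).
      apply Rmult_le_compat; [apply Cmod_ge_0 | apply Rabs_pos | apply FB; lra |].
      assert (Hkx : 0 < k0 * x) by (apply Rmult_lt_0_compat; lra).
      pose proof (ker_le_inv _ _ _ Hkx (SL x ltac:(lra)) (ker_sin _ _ _ KK rho (psi p b x) Hr)).
      pose proof (ker_le_inv _ _ _ Hkx (SL x ltac:(lra)) (ker_sin1 _ _ _ KK (psi p b x))).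
      unfold Rminus; eapply Rle_trans; [apply Rabs_triang |]; rewrite Rabs_Ropp; lra.
    * apply is_cint_minus; [apply IX | apply IY]; lra.
    * apply is_RInt_Rpower; lra.
  + replace (2 * K / k0 / g * Rpower e g) with (2 * K / k0 * (Rpower e g / g)) by (field; lra).
    apply Rmult_le_compat_l.
    * apply Rmult_le_pos; [lra | left; now apply Rinv_0_lt_compat].
    * apply Rmult_le_compat_r; [left; now apply Rinv_0_lt_compat |].
      pose proof (Rpower_pos d g); lra.
- assert (Hke : 0 < k0 * e) by (apply Rmult_lt_0_compat; lra).
  assert (P3 : 0 < (k0 * e) ^ 3) by now apply pow_lt.
  assert (Q0 : 0 <= 2 / (k0 * e) ^ 3) by (left; apply Rdiv_lt_0_compat; lra).
  apply Rle_trans with (K * Rpower w g * (2 / (k0 * e) ^ 3 * (1 - rho)) * (w - e)).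
  + eapply (is_cint_bound_const (fun x => X x - Y x)%C); [lra | |
      apply is_cint_minus; [apply IX | apply IY]; lra].
    intros x Hx; unfold X, Y, kfun.
    replace (_ - _)%C with (f x * RtoC (k rho (psi p b x) - k1 (psi p b x)))%C
      by (rewrite RtoC_minus; ring).
    rewrite Cmod_mult, Cmod_R.
    apply Rmult_le_compat; [apply Cmod_ge_0 | apply Rabs_pos | |].
    * eapply Rle_trans; [apply FB; lra |]; apply Rmult_le_compat_l; [exact HK |].
      apply Rpower_le_base; lra.
    * pose proof (ker_diff _ _ _ KK rho (psi p b x) Hr) as D.
      assert (S : (k0 * e) ^ 3 <= Rabs (sin (psi p b x)) ^ 3).
      { apply pow_incr; split; [lra |]; eapply Rle_trans; [| apply SL; lra].
        apply Rmult_le_compat_l; lra. }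
      apply Rmult_le_reg_r with ((k0 * e) ^ 3); [exact P3 |].
      replace (2 / (k0 * e) ^ 3 * (1 - rho) * (k0 * e) ^ 3) with (2 * (1 - rho)) by (field; lra).
      eapply Rle_trans; [| exact D]; apply Rmult_le_compat_l; [apply Rabs_pos | exact S].
  + pose proof (Rpower_pos w g).
    replace (K * Rpower w g * (2 / (k0 * e) ^ 3) * w * (1 - rho)) with
      (K * Rpower w g * (2 / (k0 * e) ^ 3 * (1 - rho)) * w) by ring.
    apply Rmult_le_compat_l; [| lra].
    apply Rmult_le_pos; [apply Rmult_le_pos; lra |]; apply Rmult_le_pos; lra.
Qed.

(** Gives convergence of the excised integral for one fixed radius, hence a constant [K'] that may
    depend on [e]. Before the first cell the pole of the kernel lowers the power of [x] by one;
    beyond it the excision keeps the sine above [k0 * e]. *)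
Local Lemma E_bound e : 0 < e < / (4 * b) -> exists K', forall x, 0 < x ->
  Cmod (excise (kfun p b k1 f) mu e x) <= K' * env g x.
Proof.
intros He; pose proof (admissible_nonneg _ _ _ _ _ _ Hf) as HK; pose proof k0_pos as Hk0.
destruct (Rpower_exp_env g 0 kap Hg ltac:(lra) Hkap) as [A0 [HA0 B0]].
destruct (Rpower_exp_env g 1 kap Hg ltac:(lra) Hkap) as [A1 [HA1 B1]].
assert (Hke : 0 < k0 * e) by (apply Rmult_lt_0_compat; lra).
assert (Ik : 0 < / k0) by now apply Rinv_0_lt_compat.
assert (Ike : 0 < / (k0 * e)) by now apply Rinv_0_lt_compat.
exists (K * / k0 * A0 + K * / (k0 * e) * A1); intros x Hx.
pose proof (env_pos g x Hg) as HE; specialize (B0 x Hx); specialize (B1 x Hx).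
pose proof (proj1 (proj2 Hf) x Hx) as F1.
assert (N0 : 0 <= K * / k0 * (A0 * env g x))
  by (apply Rmult_le_pos; apply Rmult_le_pos; lra).
assert (N1 : 0 <= K * / (k0 * e) * (A1 * env g x))
  by (apply Rmult_le_pos; apply Rmult_le_pos; lra).
rewrite Rmult_plus_distr_r, !(Rmult_assoc _ _ (env g x)).
destruct (Rle_dec x (cell b 0)) as [L | L].
- rewrite excise_out.
  2:{ intros i; pose proof (poles_far_zero p b mu i x Hb Hmu L); lra. }
  unfold kfun; rewrite Cmod_mult, Cmod_R.
  assert (Hkx : 0 < k0 * x) by (apply Rmult_lt_0_compat; lra).
  pose proof (ker_le_inv _ _ _ Hkx (sin_psi_zero p b x Hp Hb (conj Hx L))
    (ker_sin1 _ _ _ KK (psi p b x))) as KB.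
  apply Rle_trans with (K * / k0 * (A0 * env g x)); [| lra].
  apply Rle_trans with (K * (Rpower x g * exp (- (kap * x))) * / (k0 * x)).
  + apply Rmult_le_compat; auto using Cmod_ge_0, Rabs_pos.
  + replace (K * (Rpower x g * exp (- (kap * x))) * / (k0 * x)) with
      (K * / k0 * ((Rpower x g * / x) * exp (- (kap * x)))) by (field; lra).
    rewrite Rpower_pred by exact Hx; rewrite Rplus_0_r in B0.
    apply Rmult_le_compat_l; [apply Rmult_le_pos; lra | exact B0].
- destruct (cell_find b x Hb ltac:(lra)) as [i Hi].
  destruct (Rlt_dec (Rabs (x - mu i)) e) as [N | N].
  { rewrite (excise_in _ _ _ _ i N), Cmod_0; lra. }
  rewrite excise_out.
  2:{ intros j; destruct (Nat.eq_dec i j) as [<- | Nij]; [lra |].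
      pose proof (poles_far p b mu i j x Hb Hmu Nij Hi); lra. }
  unfold kfun; rewrite Cmod_mult, Cmod_R.
  assert (SL : k0 * e <= Rabs (sin (psi p b x))).
  { eapply Rle_trans; [| apply (sin_psi_cell p b i (mu i) x Hp Hb (proj2 (Hmu i)) Hi)].
    fold k0; apply Rmult_le_compat_l; lra. }
  pose proof (ker_le_inv _ _ _ Hke SL (ker_sin1 _ _ _ KK (psi p b x))) as KB.
  apply Rle_trans with (K * / (k0 * e) * (A1 * env g x)); [| lra].
  apply Rle_trans with (K * (Rpower x g * exp (- (kap * x))) * / (k0 * e)).
  + apply Rmult_le_compat; auto using Cmod_ge_0, Rabs_pos.
  + replace (K * (Rpower x g * exp (- (kap * x))) * / (k0 * e)) with
      (K * / (k0 * e) * (Rpower x g * exp (- (kap * x)))) by ring.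
    replace (g - 1 + 1) with g in B1 by ring.
    apply Rmult_le_compat_l; [apply Rmult_le_pos; lra | exact B1].
Qed.

Let r := exp (- (kap / b)).

Local Lemma r_bounds : 0 <= r < 1.
Proof.
unfold r; split; [left; apply exp_pos |]; rewrite <- exp_0; apply exp_increasing.
assert (0 < kap / b) by now apply Rdiv_lt_0_compat; lra. lra.
Qed.

Local Lemma exp_cell i x : cell b i <= x -> exp (- (kap * x)) <= r ^ i.
Proof.
intros Hx; unfold r.
replace (exp (- (kap / b)) ^ i) with (exp (- (kap * (INR i / b)))).
- apply exp_le; apply Ropp_le_contravar, Rmult_le_compat_l; [lra |].
  eapply Rle_trans; [| exact Hx]; unfold cell.
  apply Rmult_le_compat_r; [left; now apply Rinv_0_lt_compat | lra].
- induction i as [| i IH]; [simpl; rewrite <- exp_0; f_equal; field; lra |].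
  rewrite <- tech_pow_Rmult, <- IH, <- exp_plus, S_INR; [f_equal; field; lra |].
  eapply Rle_trans; [| exact Hx]; apply cell_le; [exact Hb | lia].
Qed.

Local Lemma amplitude_series : exists Hs,
  is_cseries (fun i => f (mu i) / RtoC (dpsi p b (mu i)))%C Hs.
Proof.
pose proof (admissible_nonneg _ _ _ _ _ _ Hf) as HK; pose proof PI_RGT_0.
assert (Hpb : 0 < PI * b) by (apply Rmult_lt_0_compat; lra).
apply (ex_cseries_geom _ r (K * / (PI * b)) r_bounds); intros i.
destruct (Hmu i) as [Hi _]; assert (0 < / (4 * b)) by (apply Rinv_0_lt_compat; lra).
pose proof (dpsi_bounds p b (mu i) Hp Hb) as DB.
rewrite Cmod_div, Cmod_R, Rabs_pos_eq by (try lra; injection; lra).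
pose proof (cell_le b 0 i Hb ltac:(lia)).
pose proof (proj1 (proj2 (proj2 Hf)) (mu i) ltac:(lra)) as F2.
pose proof (exp_cell i (mu i) ltac:(lra)) as E.
replace (K * / (PI * b) * r ^ i) with (K * r ^ i * / (PI * b)) by ring.
apply Rmult_le_compat; [apply Cmod_ge_0 | left; apply Rinv_0_lt_compat; lra | |].
- eapply Rle_trans; [exact F2 |]; now apply Rmult_le_compat_l.
- apply Rinv_le_contravar; lra.
Qed.

(** The cell estimates telescope, with constants [K * r ^ i] decaying geometrically, and
    [zero_estimate] covers what precedes the first cell. [C2] is chosen before [e], and [J] does not
    depend on [rho]: the error can be made small by taking [e] small and then [rho] close to [1]. *)
Lemma kernel_limit : exists Hs,
  is_cseries (fun i => f (mu i) / RtoC (dpsi p b (mu i)))%C Hs /\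
  exists C2 (K2 : R -> R) e0, 0 < e0 /\ forall e, 0 < e < e0 ->
  exists J, improper (excise (kfun p b k1 f) mu e) J /\
  forall rho V, 1 / 2 <= rho < 1 -> improper (kfun p b (k rho) f) V ->
  Cmod (V - J - RtoC c * Hs) <= C2 * (e + Rpower e g) + K2 e * (1 - rho).
Proof.
pose proof (admissible_nonneg _ _ _ _ _ _ Hf) as HK; pose proof k0_pos as Hk0.
pose proof PI_RGT_0 as Hpi; pose proof r_bounds as Hr.
destruct amplitude_series as [Hs HHs]; exists Hs; split; [exact HHs |].
destruct (cell_estimate k k1 c p b KK Hp Hb) as [C1 [K1 [HC1 [HK1 CE]]]].
set (Dm := b * (PI + / p)).
assert (HDm : 0 < Dm) by (apply Rmult_lt_0_compat; [exact Hb |]; pose proof (Rinv_0_lt_compat p Hp); lra).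
assert (H4b : 0 < / (4 * b)) by (apply Rinv_0_lt_compat; lra).
set (w := cell b 0).
assert (Hw : w = / (4 * b)) by (unfold w, cell; simpl; field; lra).
set (QK := K / (1 - r)).
assert (HQK : 0 <= QK) by (apply Rmult_le_pos; [exact HK | left; apply Rinv_0_lt_compat; lra]).
assert (Hkg : 0 <= 2 * K / k0 / g).
{ apply Rmult_le_pos; [| left; now apply Rinv_0_lt_compat].
  apply Rmult_le_pos; [lra | left; now apply Rinv_0_lt_compat]. }
exists (QK * C1 + 2 * K / k0 / g).
exists (fun e => QK * K1 e + K * Rpower w g * (2 / (k0 * e) ^ 3) * w).
exists (Rmin (/ (4 * b)) (/ Dm)); split; [apply Rmin_glb_lt; [exact H4b | now apply Rinv_0_lt_compat] |].
intros e He.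
assert (He1 : e < / (4 * b)) by (eapply Rlt_le_trans; [apply He | apply Rmin_l]).
assert (He2 : Dm * e <= 1).
{ assert (e < / Dm) by (eapply Rlt_le_trans; [apply He | apply Rmin_r]).
  apply Rmult_le_reg_l with (/ Dm); [now apply Rinv_0_lt_compat |].
  rewrite <- Rmult_assoc, Rinv_l, Rmult_1_l, Rmult_1_r by lra; lra. }
set (E := excise (kfun p b k1 f) mu e).
assert (CE' : forall rho i, 1 / 2 <= rho < 1 -> ex_cint E (cell b i) (cell b (S i)) /\
  Cmod (cint (kfun p b (k rho) f) (cell b i) (cell b (S i)) - cint E (cell b i) (cell b (S i)) -
    RtoC c * (f (mu i) / RtoC (dpsi p b (mu i)))) <= K * r ^ i * (C1 * e + K1 e * (1 - rho))).
{ intros rho i Hrho; destruct (Hmu i) as [Hi Hi'].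
  pose proof (cell_le b 0 i Hb ltac:(lia)) as L0; fold w in L0.
  apply (CE f E i (mu i) (K * r ^ i) e rho); auto; try lra.
  - intros x Hx; split; [apply Hf; pose proof (cell_pos b i Hb); lra |].
    pose proof (exp_cell i x ltac:(lra)) as EX; split.
    + eapply Rle_trans; [apply (proj1 (proj2 (proj2 Hf))); fold w; lra |].
      now apply Rmult_le_compat_l.
    + eapply Rle_trans; [apply (proj2 (proj2 (proj2 Hf))); fold w; try lra |].
      * rewrite cell_S in * by exact Hb; apply Rabs_le; lra.
      * apply Rmult_le_compat_r; [apply Rabs_pos |]; now apply Rmult_le_compat_l.
  - intros x Hx Hxe; now apply excise_in with i.
  - intros x Hx Hxe; unfold E; rewrite excise_out; [reflexivity |].
    intros j; destruct (Nat.eq_dec i j) as [<- | Nij]; [exact Hxe |].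
    pose proof (poles_far p b mu i j x Hb Hmu Nij Hx); lra. }
assert (EE : forall N, ex_cint E w (cell b N)).
{ induction N as [| N IH]; [apply ex_RInt_point |].
  eapply ex_RInt_Chasles; [exact IH |]; apply (CE' (1 / 2)); lra. }
assert (EZ : forall x, 0 < x <= w -> E x = kfun p b k1 f x).
{ intros x Hx; unfold E; apply excise_out; intros i.
  pose proof (poles_far_zero p b mu i x Hb Hmu (proj2 Hx)); lra. }
assert (EY : forall d, 0 < d <= w -> is_cint E d w (cint (kfun p b k1 f) d w)).
{ intros d Hd; apply is_cint_ext with (kfun p b k1 f).
  - intros t Ht; rewrite Rmin_left, Rmax_right in Ht by lra; symmetry; apply EZ; lra.
  - apply cint_correct, ex_cint_ccont; intros t Ht.
    rewrite Rmin_left, Rmax_right in Ht by lra; apply Y_ccont_zero; fold w; lra. }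
(* Any compact interval of the half-line lies in [[d, cell b N]], glued from the initial piece and
   whole cells, and integrability passes to subintervals. *)
assert (EL : loc_int E).
{ assert (G : forall x y, 0 < x <= y -> ex_cint E x y).
  { intros x y Hxy; set (d := Rmin x w).
    assert (Hd : 0 < d) by (apply Rmin_glb_lt; [lra |]; rewrite Hw; exact H4b).
    assert (Hdw : d <= w) by apply Rmin_r; assert (Hdx : d <= x) by apply Rmin_l.
    destruct (INR_unbounded (b * y)) as [N HN].
    assert (HN' : y <= cell b N).
    { apply Rmult_le_reg_l with b; [exact Hb |]; rewrite cell_mult by exact Hb; lra. }
    apply (ex_RInt_Chasles_2 (V := C_R_CompleteNormedModule)) with d; [lra |].
    apply (ex_RInt_Chasles_1 (V := C_R_CompleteNormedModule)) with (cell b N); [lra |].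
    apply (ex_RInt_Chasles (V := C_R_NormedModule)) with w; [| apply EE].
    eexists; apply EY; lra. }
  intros x y Hx Hy; destruct (Rle_dec x y); [apply G; lra |].
  apply ex_RInt_swap, G; lra. }
destruct (E_bound e ltac:(lra)) as [K' EB].
destruct (improper_exists E g K' Hg EL EB) as [J HJ]; exists J; split; [exact HJ |].
intros rho V Hrho HV; set (X := kfun p b (k rho) f) in *.
set (h := fun i => (f (mu i) / RtoC (dpsi p b (mu i)))%C) in *.
set (T := C1 * e + K1 e * (1 - rho)).
assert (HT : 0 <= T).
{ assert (0 <= C1 * e) by (apply Rmult_le_pos; lra).
  assert (0 <= K1 e * (1 - rho)) by (apply Rmult_le_pos; [apply HK1 |]; lra).
  unfold T; lra. }
assert (XL : loc_int X) by (apply X_loc_int; lra).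
assert (Hw0 : 0 < w) by lra.
(* The bound is independent of [N], so the truncation can be removed afterwards. *)
assert (CS : forall N, Cmod (cint X w (cell b N) - cint E w (cell b N) - RtoC c * csum h N) <= QK * T).
{ intros N.
  assert (EQ : (cint X w (cell b N) - cint E w (cell b N) - RtoC c * csum h N)%C =
    csum (fun i => cint X (cell b i) (cell b (S i)) - cint E (cell b i) (cell b (S i)) -
      RtoC c * h i)%C N).
  { induction N as [| N IH].
    - simpl; fold w; rewrite !(is_cint_unique _ w w _ (is_RInt_point _ _)).
      unfold zero; simpl; apply injective_projections; simpl; ring.
    - cbn [csum]; rewrite <- IH.
      rewrite (cint_Chasles X w (cell b N) (cell b (S N))), (cint_Chasles E w (cell b N) (cell b (S N)));
        [ring | apply EE | apply (CE' (1 / 2)); lra | |]; apply XL; auto using cell_pos. }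
  rewrite EQ; replace (QK * T) with (K * T / (1 - r)) by (unfold QK; field; lra).
  apply csum_bound; [exact Hr | now apply Rmult_le_pos |].
  intros i; eapply Rle_trans; [apply CE', Hrho |]; right; unfold T; ring. }
assert (Hc := Rabs_pos c).
apply Rle_trans with (QK * T + (2 * K / k0 / g * Rpower e g +
  K * Rpower w g * (2 / (k0 * e) ^ 3) * w * (1 - rho))).
2:{ unfold T; pose proof (Rpower_pos e g).
    assert (0 <= QK * C1 * Rpower e g) by (apply Rmult_le_pos; [apply Rmult_le_pos |]; lra).
    assert (0 <= 2 * K / k0 / g * e) by (apply Rmult_le_pos; lra).
    lra. }
apply le_epsilon; intros eta Heta.
(* One share for each of the two truncated integrals, and [Rabs c] shares for the partial sum of the
   series. *)
set (n := eta / (2 + Rabs c)).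
assert (Hn : 0 < n) by (apply Rdiv_lt_0_compat; lra).
assert (En : n * (2 + Rabs c) = eta) by (unfold n; field; lra).
destruct (proj2 HV n Hn) as [d1 [Hd1 B1]], (proj2 HJ n Hn) as [d2 [Hd2 B2]].
destruct (is_cseries_close h Hs HHs n Hn) as [N0 HN0].
set (d := Rmin (Rmin (d1 / 2) (d2 / 2)) e).
assert (Hd : 0 < d) by (repeat apply Rmin_glb_lt; lra).
assert (Ld1 : d <= d1 / 2) by (eapply Rle_trans; [apply Rmin_l | apply Rmin_l]).
assert (Ld2 : d <= d2 / 2) by (eapply Rle_trans; [apply Rmin_l | apply Rmin_r]).
assert (Lde : d <= e) by apply Rmin_r.
pose proof (Rinv_0_lt_compat _ Hd1); pose proof (Rinv_0_lt_compat _ Hd2).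
destruct (INR_unbounded (b * (/ d1 + / d2))) as [N1 HN1].
set (N := max N0 N1).
assert (HN : / d1 + / d2 < cell b N).
{ eapply Rlt_le_trans; [| apply (cell_le b N1 N Hb); lia].
  apply Rmult_lt_reg_l with b; [exact Hb |]; rewrite cell_mult by exact Hb; lra. }
specialize (B1 d (cell b N) ltac:(lra) ltac:(lra)).
specialize (B2 d (cell b N) ltac:(lra) ltac:(lra)).
specialize (HN0 N ltac:(lia)); specialize (CS N).
pose proof (zero_estimate rho d e Hrho ltac:(lra) ltac:(fold w; lra)) as Z; fold w in Z; fold X in Z.
rewrite (cint_Chasles X d w) in B1 by (apply XL; auto using cell_pos).
rewrite (cint_Chasles E d w) in B2 by (try apply EE; apply EL; auto).
rewrite (is_cint_unique _ _ _ _ (EY d ltac:(lra))) in B2.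
set (x1 := cint X d w) in *; set (x2 := cint X w (cell b N)) in *.
set (y1 := cint (kfun p b k1 f) d w) in *; set (y2 := cint E w (cell b N)) in *.
set (sN := csum h N) in *.
replace (V - J - RtoC c * Hs)%C with
  ((x2 - y2 - RtoC c * sN) + (x1 - y1) + (RtoC c * (sN - Hs)) +
   (- (x1 + x2 - V)) + (y1 + y2 - J))%C by ring.
eapply Rle_trans; [apply Cmod_triangle |].
eapply Rle_trans; [apply Rplus_le_compat_r, Cmod_triangle |].
eapply Rle_trans; [apply Rplus_le_compat_r, Rplus_le_compat_r, Cmod_triangle |].
eapply Rle_trans; [apply Rplus_le_compat_r, Rplus_le_compat_r, Rplus_le_compat_r, Cmod_triangle |].
rewrite Cmod_opp, (Cmod_mult (RtoC c)), Cmod_R.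
assert (Rabs c * Cmod (sN - Hs) <= Rabs c * n) by (apply Rmult_le_compat_l; lra).
lra.
Qed.

End Kernel.

(** * The amplitudes *)

Lemma cder_lipschitz f df x y M :
  (forall t, Rmin x y <= t <= Rmax x y -> cder f t (df t) /\ ccont df t /\ Cmod (df t) <= M) ->
  Cmod (f x - f y) <= M * Rabs (x - y).
Proof.
assert (G : forall x y, x <= y ->
  (forall t, x <= t <= y -> cder f t (df t) /\ ccont df t /\ Cmod (df t) <= M) ->
  Cmod (f y - f x) <= M * (y - x)).
{ intros u v Huv H; apply (is_cint_bound_const df); [exact Huv | intros; now apply H |].
  apply is_cint_derive; intros t Ht; rewrite Rmin_left, Rmax_right in Ht by exact Huv; now apply H. }
intros H; destruct (Rle_dec x y) as [L | L].
- rewrite Rmin_left, Rmax_right in H by exact L.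
  rewrite Cmod_minus_sym, Rabs_minus_sym, Rabs_pos_eq by lra; now apply G.
- rewrite Rmin_right, Rmax_left in H by lra.
  rewrite Rabs_pos_eq by lra; apply G; [lra | exact H].
Qed.

(** Rates add up under products, and [kap] may have either sign: a power takes a small positive
    rate, [/ dpsi] the rate [0] and [G] a negative one. Staying beyond [w] avoids the singularity of
    [G] at [0]. *)
Definition lip_exp (w d kap K : R) (h : R -> C) : Prop :=
  0 <= K /\ (forall x, w <= x -> Cmod (h x) <= K * exp (kap * x)) /\
  (forall x y, w <= x -> w <= y -> Rabs (x - y) <= d ->
     Cmod (h x - h y) <= K * exp (kap * x) * Rabs (x - y)).

Lemma exp_shift kap d x y : Rabs (x - y) <= d -> exp (kap * y) <= exp (Rabs kap * d) * exp (kap * x).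
Proof.
intros H; rewrite <- exp_plus; apply exp_le.
assert (kap * (y - x) <= Rabs kap * d); [| lra].
eapply Rle_trans; [apply Rle_abs |]; rewrite Rabs_mult, (Rabs_minus_sym y).
apply Rmult_le_compat_l; [apply Rabs_pos | exact H].
Qed.

Lemma lip_exp_mult w d a b K1 K2 h1 h2 : lip_exp w d a K1 h1 -> lip_exp w d b K2 h2 ->
  exists K, lip_exp w d (a + b) K (fun x => h1 x * h2 x)%C.
Proof.
intros (P1 & B1 & L1) (P2 & B2 & L2).
set (S := exp (Rabs b * d)); assert (HS : 0 < S) by apply exp_pos.
exists (K1 * K2 + K1 * K2 * S).
assert (PP : 0 <= K1 * K2) by now apply Rmult_le_pos.
assert (PPS : 0 <= K1 * K2 * S) by (apply Rmult_le_pos; lra).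
split; [lra | split].
- intros x Hx; rewrite Cmod_mult, Rmult_plus_distr_r.
  rewrite (Rmult_plus_distr_r a b x), exp_plus, <- Rmult_plus_distr_r.
  apply Rle_trans with (K1 * K2 * (exp (a * x) * exp (b * x))).
  + replace (K1 * K2 * (exp (a * x) * exp (b * x))) with
      ((K1 * exp (a * x)) * (K2 * exp (b * x))) by ring.
    apply Rmult_le_compat; auto using Cmod_ge_0.
  + apply Rmult_le_compat_r; [left; apply Rmult_lt_0_compat; apply exp_pos | lra].
- intros x y Hx Hy Hd.
  replace (_ - _)%C with (h1 x * (h2 x - h2 y) + (h1 x - h1 y) * h2 y)%C by ring.
  eapply Rle_trans; [apply Cmod_triangle |]; rewrite !Cmod_mult.
  rewrite (Rmult_plus_distr_r a b x), exp_plus.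
  pose proof (exp_pos (a * x)); pose proof (exp_pos (b * x)); pose proof (Rabs_pos (x - y)).
  apply Rle_trans with
    ((K1 * exp (a * x)) * (K2 * exp (b * x) * Rabs (x - y)) +
     (K1 * exp (a * x) * Rabs (x - y)) * (K2 * (S * exp (b * x)))); [| right; ring].
  apply Rplus_le_compat; apply Rmult_le_compat; auto using Cmod_ge_0.
  eapply Rle_trans; [now apply B2 |]; apply Rmult_le_compat_l; [exact P2 |].
  apply exp_shift, Hd.
Qed.

(** A power and its derivative grow more slowly than any increasing exponential; the factor [S]
    moves the weight from an intermediate point back to [x]. *)
Lemma lip_exp_Rcpow w d kap n : 0 < w -> 0 < kap -> 2 < Re n ->
  exists K, lip_exp w d kap K (fun x => Rcpow x (n - 1)).
Proof.
intros Hw Hk Hn.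
destruct (Rpower_exp_bounded (Re n - 1) kap ltac:(lra) Hk) as [K1 [HK1 B1]].
destruct (Rpower_exp_bounded (Re n - 2) kap ltac:(lra) Hk) as [K2 [HK2 B2]].
assert (U : forall m K x, Rpower x m * exp (- (kap * x)) <= K -> Rpower x m <= K * exp (kap * x)).
{ intros m K x H; rewrite exp_Ropp in H; pose proof (exp_pos (kap * x)).
  apply Rmult_le_reg_r with (/ exp (kap * x)); [now apply Rinv_0_lt_compat |].
  rewrite (Rmult_assoc K), Rinv_r, Rmult_1_r by lra; exact H. }
set (S := exp (Rabs kap * d)); assert (HS : 0 < S) by apply exp_pos.
pose proof (Cmod_ge_0 (n - 1)) as Hn1.
assert (P : 0 <= Cmod (n - 1) * K2 * S) by (repeat apply Rmult_le_pos; lra).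
exists (K1 + Cmod (n - 1) * K2 * S); split; [lra | split].
- intros x Hx; rewrite Cmod_Rcpow; replace (Re (n - 1)%C) with (Re n - 1) by (destruct n; simpl; ring).
  rewrite Rmult_plus_distr_r.
  pose proof (U _ _ _ (B1 x ltac:(lra))); pose proof (exp_pos (kap * x)).
  assert (0 <= Cmod (n - 1) * K2 * S * exp (kap * x)) by (apply Rmult_le_pos; lra); lra.
- intros x y Hx Hy Hd.
  apply Rle_trans with (Cmod (n - 1) * K2 * S * exp (kap * x) * Rabs (x - y)).
  + apply (cder_lipschitz (fun t => Rcpow t (n - 1)) (fun t => (n - 1) * Rcpow t (n - 1 - 1))%C);
      intros t Ht.
    assert (Ht0 : 0 < t) by (eapply Rlt_le_trans; [| apply Ht]; apply Rmin_glb_lt; lra).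
    split; [now apply cder_Rcpow | split].
    * apply ccont_mult; [apply ccont_const | now apply ccont_Rcpow].
    * rewrite Cmod_mult, Cmod_Rcpow, !Rmult_assoc; apply Rmult_le_compat_l; [exact Hn1 |].
      replace (Re (n - 1 - 1)%C) with (Re n - 2) by (destruct n; simpl; ring).
      eapply Rle_trans; [apply U, B2, Ht0 |]; apply Rmult_le_compat_l; [lra |].
      apply exp_shift; eapply Rle_trans; [| exact Hd].
      destruct (Rle_dec x y) as [L | L].
      -- rewrite Rmin_left, Rmax_right in Ht by exact L.
         rewrite !Rabs_left1 by lra; lra.
      -- rewrite Rmin_right, Rmax_left in Ht by lra.
         rewrite !Rabs_pos_eq by lra; lra.
  + apply Rmult_le_compat_r; [apply Rabs_pos |].
    apply Rmult_le_compat_r; [left; apply exp_pos | lra].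
Qed.

Lemma lip_exp_inv_dpsi p b w d : 0 < p -> 0 < b -> exists K,
  lip_exp w d 0 K (fun x => RtoC (/ dpsi p b x)).
Proof.
intros Hp Hb; pose proof PI_RGT_0; assert (Hpb : 0 < PI * b) by (apply Rmult_lt_0_compat; lra).
set (L := b ^ 2 / p ^ 2).
assert (HL : 0 < L) by (apply Rdiv_lt_0_compat; apply pow_lt; assumption).
assert (I1 : 0 < / (PI * b)) by now apply Rinv_0_lt_compat.
assert (Z : 0 <= L * (/ (PI * b) * / (PI * b))) by (left; apply Rmult_lt_0_compat; [exact HL | now apply Rmult_lt_0_compat]).
exists (/ (PI * b) + L * (/ (PI * b) * / (PI * b))); split; [lra | split].
- intros x _; pose proof (dpsi_bounds p b x Hp Hb).
  rewrite Rmult_0_l, exp_0, Rmult_1_r, Cmod_R, Rabs_pos_eq by (left; apply Rinv_0_lt_compat; lra).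
  assert (/ dpsi p b x <= / (PI * b)) by (apply Rinv_le_contravar; lra); lra.
- intros x y _ _ _; pose proof (dpsi_bounds p b x Hp Hb); pose proof (dpsi_bounds p b y Hp Hb).
  rewrite Rmult_0_l, exp_0, Rmult_1_r, <- RtoC_minus, Cmod_R.
  replace (/ dpsi p b x - / dpsi p b y) with
    ((dpsi p b y - dpsi p b x) * (/ dpsi p b x * / dpsi p b y)) by (field; lra).
  pose proof (Rabs_pos (x - y)).
  apply Rle_trans with (L * Rabs (x - y) * (/ (PI * b) * / (PI * b))).
  + rewrite Rabs_mult, Rabs_minus_sym.
    apply Rmult_le_compat; try apply Rabs_pos; [now apply dpsi_lipschitz |].
    rewrite Rabs_pos_eq by (left; apply Rmult_lt_0_compat; apply Rinv_0_lt_compat; lra).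
    apply Rmult_le_compat; try (left; apply Rinv_0_lt_compat; lra); apply Rinv_le_contravar; lra.
  + assert (0 <= / (PI * b) * Rabs (x - y)) by (apply Rmult_le_pos; lra); lra.
Qed.

Lemma q_lipschitz p x y : 0 < p -> 0 < x -> 0 < y ->
  Rabs (q p x - q p y) <= (2 * PI + 2 / p) * exp (- (2 * PI * Rmin x y)) * Rabs (x - y).
Proof.
intros Hp Hx Hy; pose proof PI_RGT_0.
set (m := Rmin x y); assert (Hm : 0 < m) by now apply Rmin_glb_lt.
assert (Hmx : m <= x) by apply Rmin_l; assert (Hmy : m <= y) by apply Rmin_r.
unfold q.
replace (_ - _) with ((exp (- (2 * PI * x)) - exp (- (2 * PI * y))) * ((p - x) / (p + x)) +
  exp (- (2 * PI * y)) * (2 * p * (y - x) / ((p + x) * (p + y)))) by (field; lra).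
eapply Rle_trans; [apply Rabs_triang |].
rewrite (Rmult_plus_distr_r (2 * PI) (2 / p)), (Rmult_plus_distr_r (2 * PI * _)).
apply Rplus_le_compat; rewrite Rabs_mult.
- rewrite <- (Rmult_1_r (2 * PI * exp (- (2 * PI * m)) * Rabs (x - y))).
  apply Rmult_le_compat; try apply Rabs_pos.
  + assert (D : forall t, is_derive (fun t => exp (- (2 * PI * t))) t (- (2 * PI) * exp (- (2 * PI * t)))).
    { intros t; auto_derive; [exact I | ring]. }
    assert (M : forall u v, m <= u -> u <= v -> Rabs (exp (- (2 * PI * u)) - exp (- (2 * PI * v))) <=
      2 * PI * exp (- (2 * PI * m)) * (v - u)).
    { intros u v Hu [Huv | ->].
      2:{ rewrite !Rminus_diag, Rabs_R0; lra. }
      destruct (MVT_cor2 (fun t => exp (- (2 * PI * t))) (fun t => - (2 * PI) * exp (- (2 * PI * t))) u v Huv)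
        as [c [E Hc]]; [intros c _; apply is_derive_Reals, D |].
      rewrite Rabs_minus_sym, E, Rabs_mult, (Rabs_pos_eq (v - u)) by lra.
      apply Rmult_le_compat_r; [lra |].
      rewrite Rabs_mult, Rabs_Ropp, !Rabs_pos_eq by (try (left; apply exp_pos); lra).
      apply Rmult_le_compat_l; [lra |]; apply exp_le; nra. }
    destruct (Rle_dec x y) as [L | L].
    * rewrite (Rabs_left1 (x - y)) by lra; replace (- (x - y)) with (y - x) by ring; now apply M.
    * rewrite Rabs_minus_sym, (Rabs_pos_eq (x - y)) by lra; apply M; lra.
  + apply Rabs_div_le; [lra |]; apply Rabs_le; lra.
- rewrite (Rabs_pos_eq (exp _)) by (left; apply exp_pos).
  replace (2 / p * exp (- (2 * PI * m)) * Rabs (x - y)) with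
    (exp (- (2 * PI * m)) * (2 / p * Rabs (x - y))) by ring.
  apply Rmult_le_compat; [left; apply exp_pos | apply Rabs_pos | apply exp_le; nra |].
  apply Rabs_div_le; [nra |].
  rewrite !Rabs_mult, (Rabs_pos_eq 2), (Rabs_pos_eq p), (Rabs_minus_sym y) by lra.
  replace (2 / p * Rabs (x - y) * ((p + x) * (p + y))) with
    (2 * Rabs (x - y) * ((p + x) * (p + y) / p)) by (field; lra).
  replace (2 * p * Rabs (x - y)) with (2 * Rabs (x - y) * p) by ring.
  apply Rmult_le_compat_l; [pose proof (Rabs_pos (x - y)); lra |].
  apply Rmult_le_reg_r with p; [exact Hp |].
  replace ((p + x) * (p + y) / p * p) with ((p + x) * (p + y)) by (field; lra); nra.
Qed.

(** * Bounds for the factor [G], uniform in the regularisation *)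

Lemma one_minus_exp_ge Y : 0 < Y -> Y / (1 + Y) <= 1 - exp (- Y).
Proof.
intros H; rewrite exp_Ropp; pose proof (exp_ineq1_le Y).
assert (/ exp Y <= / (1 + Y)) by (apply Rinv_le_contravar; lra).
replace (Y / (1 + Y)) with (1 - / (1 + Y)) by (field; lra); lra.
Qed.

(** Uniform up to [tau = 1], where [G] has a simple pole at [0]. With [Y = 2 PI t] the denominator
    is at least [Y / (1 + Y)], and half of the decay [exp (- Y)] is spent on the factor [1 + Y]. *)
Lemma G_bound p tau t : 0 < p -> 0 <= tau <= 1 -> 0 < t ->
  Rabs (G p tau t) <= exp (- (PI * t)) / (PI * t).
Proof.
intros Hp Htau Ht; pose proof PI_RGT_0.
destruct (one_minus_q_pos p tau t Hp Htau Ht) as [D1 D2].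
pose proof (q_abs_lt p t Hp Ht) as Q; set (Y := 2 * PI * t) in *.
assert (HY : 0 < Y) by (apply Rmult_lt_0_compat; lra).
pose proof (one_minus_exp_ge Y HY) as O.
unfold G; apply Rabs_div_le; [exact D2 |].
rewrite Rabs_mult, (Rabs_pos_eq tau) by lra.
apply Rle_trans with (exp (- Y)); [pose proof (Rabs_pos (q p t)); nra |].
replace (PI * t) with (Y / 2) by (unfold Y; field).
replace (- Y) with (- (Y / 2) + - (Y / 2)) by field; rewrite exp_plus.
pose proof (exp_pos (- (Y / 2))) as E1.
unfold Rdiv at 3; rewrite (Rmult_assoc (exp (- (Y / 2)))); apply Rmult_le_compat_l; [lra |].
pose proof (exp_ineq1_le (Y / 2)).
assert (E2 : exp (- (Y / 2)) <= / (1 + Y / 2)).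
{ rewrite exp_Ropp; apply Rinv_le_contravar; lra. }
eapply Rle_trans; [exact E2 |].
apply Rle_trans with (/ (Y / 2) * (Y / (1 + Y))).
- replace (/ (Y / 2) * (Y / (1 + Y))) with (/ ((1 + Y) / 2)) by (field; lra).
  apply Rinv_le_contravar; lra.
- apply Rmult_le_compat_l; [left; apply Rinv_0_lt_compat; lra | lra].
Qed.

(** The difference carries the explicit factor [1 - tau], over a product of two denominators, each
    of which may vanish to first order at [0]: hence the double pole. The [16] comes from
    [exp (- Y / 4) <= 4 / (1 + Y)], squared. *)
Lemma G_close p tau t : 0 < p -> 0 <= tau <= 1 -> 0 < t ->
  Rabs (G p tau t - G p 1 t) <= (1 - tau) * (16 * exp (- (PI * t)) / (2 * PI * t) ^ 2).
Proof.
intros Hp Htau Ht; pose proof PI_RGT_0.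
destruct (one_minus_q_pos p tau t Hp Htau Ht) as [D1 D2].
destruct (one_minus_q_pos p 1 t Hp ltac:(lra) Ht) as [D3 D4].
pose proof (q_abs_lt p t Hp Ht) as Q; set (Y := 2 * PI * t) in *.
assert (HY : 0 < Y) by (apply Rmult_lt_0_compat; lra).
pose proof (one_minus_exp_ge Y HY) as O.
assert (OY : 0 < Y / (1 + Y)) by (apply Rdiv_lt_0_compat; lra).
replace (G p tau t - G p 1 t) with
  ((1 - tau) * (- q p t / ((1 - tau * q p t) * (1 - 1 * q p t)))) by (unfold G; field; lra).
rewrite Rabs_mult, Rabs_pos_eq by lra; apply Rmult_le_compat_l; [lra |].
apply Rabs_div_le; [nra |]; rewrite Rabs_Ropp.
eapply Rle_trans; [exact Q |].
apply Rle_trans with (16 * exp (- (PI * t)) / Y ^ 2 * (Y / (1 + Y) * (Y / (1 + Y)))).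
2:{ apply Rmult_le_compat_l.
    - pose proof (exp_pos (- (PI * t))); left; apply Rdiv_lt_0_compat; [lra | now apply pow_lt].
    - apply Rmult_le_compat; lra. }
replace (16 * exp (- (PI * t)) / Y ^ 2 * (Y / (1 + Y) * (Y / (1 + Y)))) with
  (exp (- (PI * t)) * (16 / (1 + Y) ^ 2)) by (field; lra).
replace (- Y) with (- (PI * t) + - (Y / 2)) by (unfold Y; field); rewrite exp_plus.
apply Rmult_le_compat_l; [left; apply exp_pos |].
replace (- (Y / 2)) with (- (Y / 4) + - (Y / 4)) by field; rewrite exp_plus.
pose proof (exp_ineq1_le (Y / 4)); pose proof (exp_pos (- (Y / 4))).
assert (E2 : exp (- (Y / 4)) <= 4 / (1 + Y)).
{ rewrite exp_Ropp; replace (4 / (1 + Y)) with (/ ((1 + Y) / 4)) by (field; lra).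
  apply Rinv_le_contravar; lra. }
replace (16 / (1 + Y) ^ 2) with (4 / (1 + Y) * (4 / (1 + Y))) by (field; lra).
apply Rmult_le_compat; lra.
Qed.

Lemma lip_exp_G p tau s w d : 0 < p -> 0 <= tau <= 1 -> 0 < s -> 0 < w -> exists K,
  lip_exp w d (- (PI * s)) K (fun x => RtoC (G p tau (s * x))).
Proof.
intros Hp Htau Hs Hw; pose proof PI_RGT_0.
assert (Hsw : 0 < s * w) by now apply Rmult_lt_0_compat.
set (m := 1 - exp (- (2 * PI * (s * w)))).
assert (Hm : 0 < m) by (unfold m; pose proof (exp_neg_lt_1 _ Hsw); lra).
set (S := exp (PI * s * Rabs d)); assert (HS : 0 < S) by apply exp_pos.
assert (Hip : 0 < 2 / p) by (apply Rdiv_lt_0_compat; lra).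
set (A := / (PI * (s * w))).
assert (HA : 0 < A) by (apply Rinv_0_lt_compat, Rmult_lt_0_compat; lra).
set (B := (2 * PI + 2 / p) * s * / m ^ 2 * S).
assert (Hm2 : 0 < / m ^ 2) by now apply Rinv_0_lt_compat, pow_lt.
assert (HB : 0 < B).
{ apply Rmult_lt_0_compat; [| exact HS]; apply Rmult_lt_0_compat; [| exact Hm2].
  apply Rmult_lt_0_compat; lra. }
exists (A + B); split; [lra | split].
- intros x Hx; rewrite Cmod_R.
  assert (Hsx : s * w <= s * x) by (apply Rmult_le_compat_l; lra).
  eapply Rle_trans; [apply G_bound; auto; lra |].
  replace (- (PI * s) * x) with (- (PI * (s * x))) by ring.
  unfold Rdiv; rewrite Rmult_comm; apply Rmult_le_compat_r; [left; apply exp_pos |].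
  apply Rle_trans with A; [| lra].
  apply Rinv_le_contravar; [apply Rmult_lt_0_compat; lra | apply Rmult_le_compat_l; lra].
- intros x y Hx Hy Hd; rewrite <- RtoC_minus, Cmod_R.
  assert (Hsx : s * w <= s * x) by (apply Rmult_le_compat_l; lra).
  assert (Hsy : s * w <= s * y) by (apply Rmult_le_compat_l; lra).
  destruct (one_minus_q_pos p tau (s * x) Hp Htau ltac:(lra)) as [D1 D2].
  destruct (one_minus_q_pos p tau (s * y) Hp Htau ltac:(lra)) as [D3 D4].
  assert (M1 : m <= 1 - tau * q p (s * x)).
  { unfold m; assert (exp (- (2 * PI * (s * x))) <= exp (- (2 * PI * (s * w)))) by (apply exp_le; nra); lra. }
  assert (M2 : m <= 1 - tau * q p (s * y)).
  { unfold m; assert (exp (- (2 * PI * (s * y))) <= exp (- (2 * PI * (s * w)))) by (apply exp_le; nra); lra. }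
  replace (G p tau (s * x) - G p tau (s * y)) with
    (tau * (q p (s * x) - q p (s * y)) / ((1 - tau * q p (s * x)) * (1 - tau * q p (s * y))))
    by (unfold G; field; lra).
  assert (Dn : m ^ 2 <= (1 - tau * q p (s * x)) * (1 - tau * q p (s * y))).
  { simpl; rewrite Rmult_1_r; apply Rmult_le_compat; lra. }
  apply Rabs_div_le; [nra |].
  rewrite Rabs_mult, (Rabs_pos_eq tau) by lra.
  pose proof (q_lipschitz p (s * x) (s * y) Hp ltac:(lra) ltac:(lra)) as QL.
  assert (E : exp (- (2 * PI * Rmin (s * x) (s * y))) <= S * exp (- (PI * s) * x)).
  { unfold S; rewrite <- exp_plus; apply exp_le.
    assert (Rd : d <= Rabs d) by apply Rle_abs.
    assert (s * x - s * Rabs d <= Rmin (s * x) (s * y)).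
    { apply Rmin_glb.
      - assert (0 <= s * Rabs d) by (apply Rmult_le_pos; [lra | apply Rabs_pos]); lra.
      - apply Rabs_le_between in Hd.
        assert (s * (x - y) <= s * Rabs d) by (apply Rmult_le_compat_l; lra); lra. }
    assert (0 < Rmin (s * x) (s * y)) by (apply Rmin_glb_lt; lra).
    nra. }
  replace (s * x - s * y) with (s * (x - y)) in QL by ring.
  rewrite (Rabs_mult s), (Rabs_pos_eq s) in QL by lra.
  pose proof (Rabs_pos (x - y)) as Rxy; pose proof (exp_pos (- (PI * s) * x)) as EP.
  apply Rle_trans with ((2 * PI + 2 / p) * (S * exp (- (PI * s) * x)) * (s * Rabs (x - y))).
  + apply Rle_trans with (1 * Rabs (q p (s * x) - q p (s * y))).
    * apply Rmult_le_compat_r; [apply Rabs_pos | lra].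
    * rewrite Rmult_1_l; eapply Rle_trans; [exact QL |].
      apply Rmult_le_compat_r; [apply Rmult_le_pos; lra |].
      apply Rmult_le_compat_l; lra.
  + apply Rle_trans with (B * exp (- (PI * s) * x) * Rabs (x - y) * m ^ 2).
    * right; unfold B; field; lra.
    * assert (0 <= exp (- (PI * s) * x) * Rabs (x - y)) by (apply Rmult_le_pos; lra).
      apply Rmult_le_compat; [| apply pow_le; lra | | exact Dn].
      -- apply Rmult_le_pos; [apply Rmult_le_pos |]; lra.
      -- rewrite !Rmult_assoc; apply Rmult_le_compat_r; lra.
Qed.

(** * Admissibility of the amplitudes *)

Definition amp (p : R) (n : C) (tau s x : R) : C :=
  (Rcpow x (n - 1) * RtoC (G p tau (s * x)))%C.

Lemma G_continuity p tau t : 0 < p -> 0 <= tau <= 1 -> 0 < t -> continuity_pt (G p tau) t.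
Proof.
intros Hp Htau Ht; destruct (one_minus_q_pos p tau t Hp Htau Ht) as [_ N].
unfold G, q in *; eapply is_derive_cont; auto_derive; [| reflexivity].
repeat split; lra.
Qed.

Lemma amp_ccont p n tau s x : 0 < p -> 0 <= tau <= 1 -> 0 < s -> 0 < x -> ccont (amp p n tau s) x.
Proof.
intros Hp Htau Hs Hx; apply ccont_mult; [now apply ccont_Rcpow |].
apply ccont_RtoC, (continuity_pt_comp (fun x => s * x) (G p tau)).
- apply continuity_pt_mult; [apply continuity_pt_const; now intros u v |].
  apply derivable_continuous_pt, derivable_pt_id.
- apply G_continuity; auto; now apply Rmult_lt_0_compat.
Qed.

Lemma Cmod_amp_le p n tau s x : 0 < p -> 0 <= tau <= 1 -> 0 < s -> 0 < x ->
  Cmod (amp p n tau s x) <= / (PI * s) * (Rpower x (Re n - 2) * exp (- (PI * s * x))).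
Proof.
intros Hp Htau Hs Hx; pose proof PI_RGT_0; unfold amp; rewrite Cmod_mult, Cmod_Rcpow, Cmod_R.
replace (Re (n - 1)%C) with (Re n - 2 + 1) by (destruct n; simpl; ring).
rewrite Rpower_plus, Rpower_1, Rmult_assoc by exact Hx.
assert (Hsx : 0 < s * x) by now apply Rmult_lt_0_compat.
replace (/ (PI * s) * (Rpower x (Re n - 2) * exp (- (PI * s * x)))) with
  (Rpower x (Re n - 2) * (x * (exp (- (PI * (s * x))) / (PI * (s * x))))).
2:{ rewrite Rmult_assoc; field; lra. }
apply Rmult_le_compat_l; [left; apply Rpower_pos |].
apply Rmult_le_compat_l; [lra | now apply G_bound].
Qed.

(** The simple pole of [G] lowers [x ^ (Re n - 1)] to [x ^ (Re n - 2)], so [2 < Re n] makes the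
    exponent positive. Half of the rate [PI * s] is given up to absorb the power of [x] at
    infinity. *)
Lemma amp_admissible p b n tau s : 0 < p -> 0 < b -> 0 <= tau <= 1 -> 0 < s -> 2 < Re n ->
  exists K, admissible p b (Re n - 2) (PI * s / 2) K (amp p n tau s).
Proof.
intros Hp Hb Htau Hs Hn; pose proof PI_RGT_0.
assert (Hps : 0 < PI * s) by (apply Rmult_lt_0_compat; lra).
pose proof (cell_pos b 0 Hb) as Hw.
destruct (lip_exp_Rcpow (cell b 0) (/ b) (PI * s / 2) n Hw ltac:(lra) Hn) as [KP LP].
destruct (lip_exp_G p tau s (cell b 0) (/ b) Hp Htau Hs Hw) as [KG LG].
destruct (lip_exp_inv_dpsi p b (cell b 0) (/ b) Hp Hb) as [KD LD].
destruct (lip_exp_mult _ _ _ _ _ _ _ _ LP LG) as [K1 L1].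
destruct (lip_exp_mult _ _ _ _ _ _ _ _ L1 LD) as [K2 L2].
assert (I1 : 0 < / (PI * s)) by now apply Rinv_0_lt_compat.
pose proof L1 as (P1 & B1 & _); pose proof L2 as (P2 & _ & B2).
exists (/ (PI * s) + K1 + K2); split; [| split; [| split]].
- intros; now apply amp_ccont.
- intros x Hx; eapply Rle_trans; [now apply Cmod_amp_le |].
  apply Rmult_le_compat; [lra | left; apply Rmult_lt_0_compat; apply exp_pos | lra |].
  apply Rmult_le_compat_l; [left; apply Rpower_pos |]; apply exp_le.
  assert (0 < PI * s * x) by now apply Rmult_lt_0_compat.
  replace (PI * s / 2 * x) with (PI * s * x / 2) by field; lra.
- intros x Hx; eapply Rle_trans; [now apply B1 |].
  replace ((PI * s / 2 + - (PI * s)) * x) with (- (PI * s / 2 * x)) by field.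
  apply Rmult_le_compat_r; [left; apply exp_pos | lra].
- intros x y Hx Hy Hd; specialize (B2 x y Hx Hy Hd).
  assert (E : forall t, (amp p n tau s t / RtoC (dpsi p b t) =
    Rcpow t (n - 1) * RtoC (G p tau (s * t)) * RtoC (/ dpsi p b t))%C).
  { intros t; pose proof (dpsi_pos p b t Hp Hb); unfold amp, Cdiv; now rewrite RtoC_inv by lra. }
  rewrite !E; eapply Rle_trans; [exact B2 |].
  replace ((PI * s / 2 + - (PI * s) + 0) * x) with (- (PI * s / 2 * x)) by field.
  apply Rmult_le_compat_r; [apply Rabs_pos |].
  apply Rmult_le_compat_r; [left; apply exp_pos | lra].
Qed.

(** * Limits of improper integrals *)

Lemma is_PV_unique f a l m : is_PV_Int_0_infty f a l -> is_PV_Int_0_infty f a m -> l = m.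
Proof.
intros [J1 [A1 L1]] [J2 [A2 L2]].
apply (filterlim_locally_unique (F := at_right 0) (V := C_R_NormedModule) J2 l m); [| exact L2].
apply (filterlim_ext_loc J1); [| exact L1].
eapply filter_imp; [| exact (filter_and _ _ A1 A2)]; intros e [H1 H2].
now rewrite <- (CInt_0_infty_unique _ _ H1), <- (CInt_0_infty_unique _ _ H2).
Qed.

Lemma PV_Int_unique f a l : is_PV_Int_0_infty f a l -> PV_Int_0_infty f a = l.
Proof.
intros H; unfold PV_Int_0_infty; apply (iota_unique (V := C_R_CompleteNormedModule)); [| exact H].
intros y Hy; exact (is_PV_unique f a y l Hy H).
Qed.

Lemma at_right_0_interval d : 0 < d -> at_right 0 (fun e => 0 < e < d).
Proof.
intros Hd; exists (mkposreal d Hd); intros x Hx Hx0; split; [exact Hx0 |].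
unfold ball in Hx; simpl in Hx; unfold AbsRing_ball, abs, minus, plus, opp in Hx; simpl in Hx.
apply Rabs_lt_between in Hx; lra.
Qed.

Lemma is_PV_ext f h a l : (forall x, 0 < x -> f x = h x) ->
  is_PV_Int_0_infty f a l -> is_PV_Int_0_infty h a l.
Proof.
intros E [J [A L]]; exists J; split; [| exact L].
eapply filter_imp; [| exact A]; intros e H; unfold is_CInt_0_infty in *.
eapply (is_RInt_gen_ext (V := C_R_NormedModule)); [| exact H].
apply Filter_prod with (fun x => 0 < x < 1) (fun y => 0 < y).
- apply at_right_0_interval; lra.
- exists 0; auto.
- intros u v Hu Hv x [Hx _]; simpl in Hx.
  assert (0 < x) by (eapply Rlt_trans; [| exact Hx]; apply Rmin_glb_lt; lra).
  unfold excise; destruct (excluded_middle_informative _); auto.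
Qed.

(** Quantifying over every value [V] of the integral separates the limit from existence, which
    [ilim_rlim] takes as a separate hypothesis. *)
Definition ilim (F : R -> R -> C) (l : C) : Prop :=
  forall eta, 0 < eta -> exists d, 0 < d /\
    forall rho V, 1 - d < rho < 1 -> 0 < rho -> improper (F rho) V -> Cmod (V - l) <= eta.

Definition rlim (u : R -> C) (l : C) : Prop :=
  forall eta, 0 < eta -> exists d, 0 < d /\
    forall rho, 1 - d < rho < 1 -> 0 < rho -> Cmod (u rho - l) <= eta.

Lemma rlim_lipschitz u l K : (forall rho, 0 < rho < 1 -> Cmod (u rho - l) <= K * (1 - rho)) -> rlim u l.
Proof.
intros H eta He; assert (HK : 0 <= K).
{ specialize (H (1 / 2) ltac:(lra)); pose proof (Cmod_ge_0 (u (1 / 2) - l)); lra. }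
exists (eta / (K + 1)); assert (E : 0 < eta / (K + 1)) by (apply Rdiv_lt_0_compat; lra).
split; [exact E |]; intros rho Hr Hr0; eapply Rle_trans; [apply H; lra |].
apply Rle_trans with ((K + 1) * (eta / (K + 1))); [| right; field; lra].
apply Rmult_le_compat; lra.
Qed.

Lemma rlim_const c : rlim (fun _ => c) c.
Proof.
apply rlim_lipschitz with 0; intros rho _.
replace (c - c)%C with (RtoC 0) by ring; rewrite Cmod_0; lra.
Qed.

Lemma rlim_plus u v l m : rlim u l -> rlim v m -> rlim (fun r => u r + v r)%C (l + m)%C.
Proof.
intros H1 H2 eta He; destruct (H1 (eta / 2)) as [d1 [Hd1 B1]]; [lra |].
destruct (H2 (eta / 2)) as [d2 [Hd2 B2]]; [lra |].
exists (Rmin d1 d2); split; [now apply Rmin_glb_lt |]; intros rho Hr Hr0.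
pose proof (Rmin_l d1 d2); pose proof (Rmin_r d1 d2).
specialize (B1 rho ltac:(lra) Hr0); specialize (B2 rho ltac:(lra) Hr0).
replace (_ - _)%C with ((u rho - l) + (v rho - m))%C by ring.
eapply Rle_trans; [apply Cmod_triangle | lra].
Qed.

Lemma rlim_scal c u l : rlim u l -> rlim (fun r => c * u r)%C (c * l)%C.
Proof.
intros H eta He; pose proof (Cmod_ge_0 c) as Hc.
destruct (H (eta / (Cmod c + 1))) as [d [Hd B]]; [apply Rdiv_lt_0_compat; lra |].
exists d; split; [exact Hd |]; intros rho Hr Hr0; specialize (B rho Hr Hr0).
replace (_ - _)%C with (c * (u rho - l))%C by ring; rewrite Cmod_mult.
apply Rle_trans with ((Cmod c + 1) * (eta / (Cmod c + 1))); [| right; field; lra].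
apply Rmult_le_compat; auto using Cmod_ge_0; lra.
Qed.

Lemma rlim_unique u v l m : (forall rho, 0 < rho < 1 -> u rho = v rho) ->
  rlim u l -> rlim v m -> l = m.
Proof.
intros E H1 H2; apply Ceq_minus, Cmod_eq_0, Rle_antisym; [| apply Cmod_ge_0].
apply le_epsilon; intros eta He; rewrite Rplus_0_l.
destruct (H1 (eta / 2)) as [d1 [Hd1 B1]]; [lra |].
destruct (H2 (eta / 2)) as [d2 [Hd2 B2]]; [lra |].
set (d := Rmin (Rmin d1 d2) 1).
assert (Hd : 0 < d) by (repeat apply Rmin_glb_lt; lra).
assert (L1 : d <= d1) by (eapply Rle_trans; [apply Rmin_l | apply Rmin_l]).
assert (L2 : d <= d2) by (eapply Rle_trans; [apply Rmin_l | apply Rmin_r]).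
assert (L3 : d <= 1) by apply Rmin_r.
specialize (B1 (1 - d / 2) ltac:(lra) ltac:(lra)); specialize (B2 (1 - d / 2) ltac:(lra) ltac:(lra)).
rewrite <- (E (1 - d / 2) ltac:(lra)) in B2.
replace (l - m)%C with ((u (1 - d / 2)%R - m) - (u (1 - d / 2)%R - l))%C by ring.
eapply Rle_trans; [apply Cmod_triangle |]; rewrite Cmod_opp; lra.
Qed.

Lemma ilim_rlim F u l : ilim F l -> (forall rho, 0 < rho < 1 -> improper (F rho) (u rho)) -> rlim u l.
Proof.
intros H Hu eta He; destruct (H eta He) as [d [Hd B]]; exists d; split; [exact Hd |].
intros rho Hr Hr0; apply (B rho); auto; apply Hu; lra.
Qed.

Lemma power_small g K eta : 0 < g -> 0 < eta -> exists d, 0 < d /\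
  forall e, 0 < e < d -> K * (e + Rpower e g) <= eta.
Proof.
intros Hg He; set (t := eta / (2 * (Rabs K + 1))); pose proof (Rabs_pos K).
assert (Ht : 0 < t) by (apply Rdiv_lt_0_compat; lra).
exists (Rmin t (Rpower t (/ g))); split; [apply Rmin_glb_lt; [exact Ht | apply Rpower_pos] |].
intros e Hed; pose proof (Rmin_l t (Rpower t (/ g))); pose proof (Rmin_r t (Rpower t (/ g))).
assert (E : Rpower e g <= t).
{ replace t with (Rpower (Rpower t (/ g)) g) by (rewrite Rpower_mult, Rinv_l, Rpower_1; lra).
  apply Rpower_le_base; lra. }
pose proof (Rpower_pos e g); pose proof (Rle_abs K).
apply Rle_trans with ((Rabs K + 1) * (2 * t)); [| right; unfold t; field; lra].
apply Rle_trans with ((Rabs K + 1) * (e + Rpower e g)); [apply Rmult_le_compat_r; lra |].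
apply Rmult_le_compat_l; lra.
Qed.

(** Turns the quantitative estimate into two limits: that of the excised integrals as [e -> 0],
    which is the principal value, and that of the kernel integrals as [rho -> 1-]. *)
Lemma kernel_pv k k1 c p b mu g kap K f : is_kernel k k1 c -> 0 < p -> 0 < b ->
  is_poles p b mu -> 0 < g -> 0 < kap -> admissible p b g kap K f ->
  exists Hs L, is_cseries (fun i => f (mu i) / RtoC (dpsi p b (mu i)))%C Hs /\
    is_PV_Int_0_infty (kfun p b k1 f) mu L /\
    ilim (fun rho => kfun p b (k rho) f) (L + RtoC c * Hs)%C.
Proof.
intros KK Hp Hb Hmu Hg Hkap Hf.
destruct (kernel_limit k k1 c KK p b Hp Hb mu Hmu g kap K Hg Hkap f Hf)
  as [Hs [HHs [C2 [K2 [e0 [He0 KL]]]]]].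
set (J := fun e => CInt_0_infty (excise (kfun p b k1 f) mu e)).
assert (HJ : forall e, 0 < e < e0 -> improper (excise (kfun p b k1 f) mu e) (J e) /\
  forall rho V, 1 / 2 <= rho < 1 -> improper (kfun p b (k rho) f) V ->
  Cmod (V - J e - RtoC c * Hs) <= C2 * (e + Rpower e g) + K2 e * (1 - rho)).
{ intros e He; destruct (KL e He) as [J' [HJ' B]].
  unfold J; rewrite (improper_CInt _ _ HJ'); now split. }
assert (Close : forall e eta, 0 < e < e0 -> 0 < eta -> exists d, 0 < d <= 1 / 2 /\ forall rho V,
  1 - d <= rho < 1 -> improper (kfun p b (k rho) f) V ->
  Cmod (V - J e - RtoC c * Hs) <= C2 * (e + Rpower e g) + eta).
{ intros e eta He Heta; destruct (HJ e He) as [_ B].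
  set (d := Rmin (1 / 2) (eta / (Rabs (K2 e) + 1))); pose proof (Rabs_pos (K2 e)).
  assert (Hd1 : 0 < eta / (Rabs (K2 e) + 1)) by (apply Rdiv_lt_0_compat; lra).
  assert (Hd : 0 < d) by (apply Rmin_glb_lt; lra).
  assert (L1 : d <= 1 / 2) by apply Rmin_l; assert (L2 : d <= eta / (Rabs (K2 e) + 1)) by apply Rmin_r.
  exists d; split; [lra |]; intros rho V Hr HV.
  eapply Rle_trans; [apply (B rho V); [lra | exact HV] |]; apply Rplus_le_compat_l.
  apply Rle_trans with ((Rabs (K2 e) + 1) * (eta / (Rabs (K2 e) + 1))); [| right; field; lra].
  pose proof (Rle_abs (K2 e)).
  apply Rle_trans with ((Rabs (K2 e) + 1) * (1 - rho)); [apply Rmult_le_compat_r; lra |].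
  apply Rmult_le_compat_l; lra. }
(* Excised integrals for two radii are not compared directly: both are close to [V - c * Hs] for one
   common regularised integral [V], with [rho] chosen after the radii. *)
assert (Cau : forall eta, 0 < eta -> exists d, 0 < d <= e0 /\ forall e e', 0 < e < d -> 0 < e' < d ->
  Cmod (J e' - J e) <= eta).
{ intros eta Heta; destruct (power_small g C2 (eta / 4) Hg ltac:(lra)) as [d [Hd B]].
  exists (Rmin d e0); split; [split; [now apply Rmin_glb_lt | apply Rmin_r] |].
  pose proof (Rmin_l d e0); pose proof (Rmin_r d e0).
  intros e e' He He'.
  destruct (Close e (eta / 4) ltac:(lra) ltac:(lra)) as [d1 [Hd1 B1]].
  destruct (Close e' (eta / 4) ltac:(lra) ltac:(lra)) as [d2 [Hd2 B2]].
  set (d3 := Rmin d1 d2); assert (Hd3 : 0 < d3) by (apply Rmin_glb_lt; lra).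
  assert (L1 : d3 <= d1) by apply Rmin_l; assert (L2 : d3 <= d2) by apply Rmin_r.
  destruct (kernel_improper_exists k k1 c KK p b Hp g kap K Hg Hkap f Hf (1 - d3) ltac:(lra)) as [V HV].
  specialize (B1 (1 - d3) V ltac:(lra) HV); specialize (B2 (1 - d3) V ltac:(lra) HV).
  pose proof (B e ltac:(lra)); pose proof (B e' ltac:(lra)).
  replace (J e' - J e)%C with ((V - J e - RtoC c * Hs) - (V - J e' - RtoC c * Hs))%C by ring.
  eapply Rle_trans; [apply Cmod_triangle |]; rewrite Cmod_opp; lra. }
destruct (proj1 (filterlim_locally_cauchy (U := C_R_CompleteNormedModule) (F := at_right 0) J))
  as [L HL].
{ intros eps; destruct (Cau (eps / 2)) as [d [Hd B]]; [destruct eps; simpl; lra |].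
  exists (fun e => 0 < e < d); split; [now apply at_right_0_interval |].
  intros u v Hu Hv; specialize (B u v Hu Hv).
  assert (Hbd : forall r : R, Rabs r <= Cmod (J v - J u) -> Rabs r < eps).
  { intros r Hr; destruct eps; simpl in *; lra. }
  split; apply Hbd; [apply (Re_le_Cmod (_ - _)%C) | apply (Im_le_Cmod (_ - _)%C)]. }
exists Hs, L; split; [exact HHs | split].
- exists J; split; [| exact HL].
  eapply filter_imp; [| exact (at_right_0_interval e0 He0)].
  intros e He; now apply improper_is, HJ.
- intros eta Heta.
  destruct (power_small g C2 (eta / 3) Hg ltac:(lra)) as [d [Hd B]].
  assert (Heta' : 0 < eta / 6) by lra.
  assert (N : at_right 0 (fun e => ball (L : C_R_CompleteNormedModule) (eta / 6) (J e))).
  { exact (HL _ (locally_ball (L : C_R_CompleteNormedModule) (mkposreal _ Heta'))). }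
  assert (NN : at_right 0 (fun e => ball (L : C_R_CompleteNormedModule) (eta / 6) (J e) /\
    0 < e < Rmin d e0)).
  { apply (filter_and (F := at_right 0)); [exact N | apply at_right_0_interval].
    now apply Rmin_glb_lt. }
  destruct (filter_ex _ NN) as [e [NB He]].
  pose proof (Rmin_l d e0); pose proof (Rmin_r d e0).
  assert (T1 : Rabs (fst (J e - L)%C) < eta / 6) by exact (proj1 NB).
  assert (T2 : Rabs (snd (J e - L)%C) < eta / 6) by exact (proj2 NB).
  pose proof (Cmod_le_sum (J e - L)) as T3.
  destruct (Close e (eta / 3) ltac:(lra) ltac:(lra)) as [d1 [Hd1 B1]].
  exists d1; split; [lra |]; intros rho V Hr _ HV.
  specialize (B1 rho V ltac:(lra) HV); specialize (B e ltac:(lra)).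
  replace (V - (L + RtoC c * Hs))%C with ((V - J e - RtoC c * Hs) + (J e - L))%C by ring.
  eapply Rle_trans; [apply Cmod_triangle |]; lra.
Qed.

Lemma improper_zero (f : R -> C) : (forall x, f x = 0%C) -> improper f 0.
Proof.
intros H; assert (Z : forall x y, is_cint f x y (RtoC 0)).
{ intros x y; apply is_cint_ext with (fun _ => RtoC 0); [intros; now rewrite H |].
  apply (is_cint_RtoC (fun _ => 0)).
  refine (eq_ind _ (is_RInt _ x y) (is_RInt_const (V := R_NormedModule) x y 0) 0 _).
  unfold scal; simpl; unfold mult; simpl; ring. }
split; [intros x y _ _; eexists; apply Z |].
intros eta He; exists 1; split; [lra |]; intros x y _ _.
rewrite (is_cint_unique _ _ _ _ (Z x y)).
replace (0 - 0)%C with (RtoC 0) by ring; rewrite Cmod_0; lra.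
Qed.

(** Away from the zeros the Poisson kernel tends to [0], so the principal value is that of the zero
    function and only the masses survive. *)
Lemma Pk_limit p b mu g kap K f : 0 < p -> 0 < b ->
  is_poles p b mu -> 0 < g -> 0 < kap -> admissible p b g kap K f ->
  exists Hs, is_cseries (fun i => f (mu i) / RtoC (dpsi p b (mu i)))%C Hs /\
    ilim (fun rho => kfun p b (Pk rho) f) (RtoC PI * Hs)%C.
Proof.
intros Hp Hb Hmu Hg Hkap Hf.
destruct (kernel_pv _ _ _ p b mu g kap K f Pk_kernel Hp Hb Hmu Hg Hkap Hf) as [Hs [L [H1 [H2 H3]]]].
exists Hs; split; [exact H1 |].
replace (RtoC PI * Hs)%C with (L + RtoC PI * Hs)%C; [exact H3 |].
assert (L = 0)%C as ->; [| ring].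
apply (is_PV_unique _ _ _ _ H2); exists (fun _ => 0%C); split.
- apply filter_forall; intros e; apply improper_is, improper_zero; intros x.
  unfold excise, kfun; destruct (excluded_middle_informative _); [reflexivity |]; ring.
- apply filterlim_const.
Qed.

Lemma Qk_limit p b mu g kap K f : 0 < p -> 0 < b ->
  is_poles p b mu -> 0 < g -> 0 < kap -> admissible p b g kap K f ->
  exists L, is_PV_Int_0_infty (kfun p b (fun y => cos y / sin y) f) mu L /\
    ilim (fun rho => kfun p b (Qk rho) f) L.
Proof.
intros Hp Hb Hmu Hg Hkap Hf.
destruct (kernel_pv _ _ _ p b mu g kap K f Qk_kernel Hp Hb Hmu Hg Hkap Hf) as [Hs [L [H1 [H2 H3]]]].
exists L; split; [exact H2 |].
replace L with (L + RtoC 0 * Hs)%C by ring; exact H3.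
Qed.

(** The double pole in [G_close] removes two powers of [x]. The exponent keeps the shape [g - 1 + k]
    of [Rpower_exp_env], with [g = Re n - 2] and [k = 0]. *)
Lemma amp_close p n tau s x : 0 < p -> 0 <= tau <= 1 -> 0 < s -> 0 < x ->
  Cmod (amp p n tau s x - amp p n 1 s x) <=
    (1 - tau) * (16 / (2 * PI * s) ^ 2 * (Rpower x (Re n - 2 - 1 + 0) * exp (- (PI * s * x)))).
Proof.
intros Hp Htau Hs Hx; pose proof PI_RGT_0; unfold amp.
replace (_ - _)%C with (Rcpow x (n - 1) * RtoC (G p tau (s * x) - G p 1 (s * x)))%C
  by (rewrite RtoC_minus; ring).
rewrite Cmod_mult, Cmod_Rcpow, Cmod_R.
replace (Re (n - 1)%C) with (Re n - 2 - 1 + 0 + (1 + 1)) by (destruct n; simpl; ring).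
rewrite (Rpower_plus _ (1 + 1)), (Rpower_plus 1 1), Rpower_1 by exact Hx.
assert (Hsx : 0 < s * x) by now apply Rmult_lt_0_compat.
replace ((1 - tau) * (16 / (2 * PI * s) ^ 2 * (Rpower x (Re n - 2 - 1 + 0) * exp (- (PI * s * x)))))
  with (Rpower x (Re n - 2 - 1 + 0) * (x * x) *
    ((1 - tau) * (16 * exp (- (PI * (s * x))) / (2 * PI * (s * x)) ^ 2))).
2:{ rewrite (Rmult_assoc PI s x); field; lra. }
apply Rmult_le_compat_l; [| now apply G_close].
apply Rmult_le_pos; [left; apply Rpower_pos | nra].
Qed.

(** The rate [1 - tau] costs a factor [1 / x ^ 2] at [0], integrable because [2 < Re n]. *)
Lemma amp_kernel_close p n s (w : R -> C) M : 0 < p -> 0 < s -> 2 < Re n -> 0 <= M ->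
  (forall x, 0 < x -> Cmod (w x) <= M) -> exists K, forall tau V1 V2, 0 <= tau <= 1 ->
  improper (fun x => amp p n tau s x * w x)%C V1 -> improper (fun x => amp p n 1 s x * w x)%C V2 ->
  Cmod (V1 - V2) <= K * (1 - tau).
Proof.
intros Hp Hs Hn HM Hw; pose proof PI_RGT_0.
assert (Hps : 0 < PI * s) by (apply Rmult_lt_0_compat; lra).
destruct (Rpower_exp_env (Re n - 2) 0 (PI * s) ltac:(lra) ltac:(lra) Hps) as [K' [HK' B]].
assert (P2 : 0 < 16 / (2 * PI * s) ^ 2) by (apply Rdiv_lt_0_compat; [lra | apply pow_lt; lra]).
exists (16 / (2 * PI * s) ^ 2 * K' * M); intros tau V1 V2 Htau H1 H2.
apply (improper_close _ _ _ _ (Re n - 2) _ ltac:(lra) H1 H2); intros x Hx.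
replace (_ - _)%C with ((amp p n tau s x - amp p n 1 s x) * w x)%C by ring.
rewrite Cmod_mult; specialize (B x Hx).
pose proof (env_pos (Re n - 2) x ltac:(lra)) as HE.
replace (16 / (2 * PI * s) ^ 2 * K' * M * (1 - tau) * env (Re n - 2) x) with
  ((1 - tau) * (16 / (2 * PI * s) ^ 2 * (K' * env (Re n - 2) x)) * M) by ring.
apply Rmult_le_compat; auto using Cmod_ge_0.
eapply Rle_trans; [now apply amp_close |].
apply Rmult_le_compat_l; [lra |]; apply Rmult_le_compat_l; [lra | exact B].
Qed.

Lemma amp_kernel_exists p n tau s (w : R -> C) M : 0 < p -> 0 <= tau <= 1 -> 0 < s -> 2 < Re n ->
  (forall x, 0 < x -> ccont w x) -> 0 <= M ->
  (forall x, 0 < x -> Cmod (w x) <= M) -> exists V, improper (fun x => amp p n tau s x * w x)%C V.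
Proof.
intros Hp Htau Hs Hn Hc HM Hw; pose proof PI_RGT_0.
assert (Hps : 0 < PI * s) by (apply Rmult_lt_0_compat; lra).
destruct (Rpower_exp_env (Re n - 2) 1 (PI * s) ltac:(lra) ltac:(lra) Hps) as [K' [HK' B]].
assert (I1 : 0 < / (PI * s)) by now apply Rinv_0_lt_compat.
apply (improper_exists _ (Re n - 2) (/ (PI * s) * K' * M) ltac:(lra)).
- apply loc_int_ccont; intros x Hx; apply ccont_mult; [now apply amp_ccont | now apply Hc].
- intros x Hx; rewrite Cmod_mult; specialize (B x Hx).
  replace (Re n - 2 - 1 + 1) with (Re n - 2) in B by ring.
  pose proof (env_pos (Re n - 2) x ltac:(lra)) as HE.
  replace (/ (PI * s) * K' * M * env (Re n - 2) x) with
    (/ (PI * s) * (K' * env (Re n - 2) x) * M) by ring.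
  apply Rmult_le_compat; auto using Cmod_ge_0.
  eapply Rle_trans; [now apply Cmod_amp_le |]; apply Rmult_le_compat_l; [lra | exact B].
Qed.

(** * Non-vanishing of the Gamma function *)

Definition gint (s : C) (x : R) : C := (RtoC (exp (- x)) * Rcpow x (s - 1))%C.

Lemma gint_ccont s x : 0 < x -> ccont (gint s) x.
Proof.
intros Hx; apply ccont_mult; [| now apply ccont_Rcpow].
apply ccont_RtoC; eapply is_derive_cont; auto_derive; [exact I | reflexivity].
Qed.

Lemma improper_gint s : 0 < Re s -> exists V, improper (gint s) V.
Proof.
intros Hs; destruct (Rpower_exp_env (Re s) 0 1 Hs ltac:(lra) ltac:(lra)) as [K [HK B]].
apply (improper_exists _ (Re s) K Hs); [apply loc_int_ccont; intros; now apply gint_ccont |].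
intros x Hx; eapply Rle_trans; [| now apply B]; unfold gint.
rewrite Cmod_mult, Cmod_R, Cmod_Rcpow, Rabs_pos_eq, Rmult_comm by (left; apply exp_pos).
right; f_equal; f_equal; [destruct s; simpl; ring | ring].
Qed.

Lemma improper_derivative f df :
  (forall x, 0 < x -> cder f x (df x)) -> (forall x, 0 < x -> ccont df x) ->
  (forall eta, 0 < eta -> exists d, 0 < d /\ forall v, 0 < v -> v < d \/ / d < v -> Cmod (f v) <= eta) ->
  improper df 0.
Proof.
intros D Dc H; split; [now apply loc_int_ccont |]; intros eta He.
destruct (H (eta / 2)) as [d [Hd B]]; [lra |].
pose proof (Rinv_0_lt_compat _ Hd).
exists d; split; [exact Hd |]; intros x y Hx Hy.
assert (Z : is_cint df x y (f y - f x)%C).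
{ apply is_cint_derive; intros t [Ht _];
    assert (0 < t) by (eapply Rlt_le_trans; [| exact Ht]; apply Rmin_glb_lt; lra); auto. }
rewrite (is_cint_unique _ _ _ _ Z).
pose proof (B x ltac:(lra) ltac:(lra)); pose proof (B y ltac:(lra) ltac:(lra)).
replace (f y - f x - 0)%C with (f y - f x)%C by ring.
eapply Rle_trans; [apply Cmod_triangle |]; rewrite Cmod_opp; lra.
Qed.

(** The functional equation of Gamma: [exp (- x) * x ^ s] vanishes at both ends, so its derivative
    integrates to [0]. *)
Lemma gint_recurrence s V W : 0 < Re s -> improper (gint s) V -> improper (gint (s + 1)) W ->
  W = (s * V)%C.
Proof.
intros Hs HV HW.
assert (Z : improper (fun x => s * gint s x - gint (s + 1) x)%C 0).
{ apply improper_derivative with (fun x => RtoC (exp (- x)) * Rcpow x s)%C.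
  - intros x Hx; eapply cder_eq.
    + apply cder_mult; [apply cder_RtoC; auto_derive; [exact I | reflexivity] | now apply cder_Rcpow].
    + unfold gint; replace (s + 1 - 1)%C with s by ring.
      replace (RtoC (- (1) * exp (- x))) with (- RtoC (exp (- x)))%C
        by (apply injective_projections; simpl; ring).
      ring.
  - intros x Hx; apply ccont_minus; [apply ccont_mult; [apply ccont_const |] |]; now apply gint_ccont.
  - intros eta He; destruct (Rpower_exp_ends (Re s) 1 eta Hs ltac:(lra) He) as [d [Hd B]].
    exists d; split; [exact Hd |]; intros v Hv Hvd.
    rewrite Cmod_mult, Cmod_R, Cmod_Rcpow, Rabs_pos_eq, Rmult_comm by (left; apply exp_pos).
    eapply Rle_trans; [| apply (B v Hv Hvd)]; right; now rewrite Rmult_1_l. }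
pose proof (improper_unique _ _ _ Z (improper_minus _ _ _ _ (improper_scal s _ _ HV) HW)) as E.
apply Ceq_minus; replace (W - s * V)%C with (- (s * V - W))%C by ring; rewrite <- E; ring.
Qed.

Lemma fst_close (z w : C) eta : Cmod (z - w) <= eta -> Rabs (fst z - fst w) <= eta.
Proof. intros H; eapply Rle_trans; [apply (Re_le_Cmod (z - w)%C) | exact H]. Qed.

Lemma improper_fst_nonneg f l : improper f l -> (forall x, 0 < x -> 0 <= fst (f x)) -> 0 <= fst l.
Proof.
intros [L H] P; apply le_epsilon; intros eta He.
destruct (H eta He) as [d [Hd B]]; pose proof (Rinv_0_lt_compat _ Hd).
set (x := Rmin (d / 2) 1); set (y := / d + 1).
assert (Hx : 0 < x) by (apply Rmin_glb_lt; lra).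
assert (x <= d / 2) by apply Rmin_l; assert (x <= 1) by apply Rmin_r.
specialize (B x y ltac:(lra) ltac:(unfold y; lra)).
pose proof (is_cint_fst _ _ _ _ (cint_correct _ _ _ (L x y Hx ltac:(unfold y; lra)))) as I.
assert (G : 0 <= fst (cint f x y)).
{ rewrite <- (is_RInt_unique _ _ _ _ I); apply RInt_ge_0; [unfold y; lra | eexists; exact I |].
  intros t Ht; apply P; lra. }
apply fst_close, Rabs_le_between in B; lra.
Qed.

Lemma gint_real A x : gint (RtoC A) x = RtoC (exp (- x) * Rpower x (A - 1)).
Proof.
unfold gint, Rcpow, Rpower.
replace ((RtoC A - 1) * RtoC (ln x))%C with (RtoC ((A - 1) * ln x))
  by (rewrite RtoC_mult, RtoC_minus; ring).
now rewrite Cexp_RtoC, RtoC_mult.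
Qed.

Lemma gint_real_pos A V : 1 <= A -> improper (gint (RtoC A)) V -> 0 < fst V.
Proof.
intros HA HV.
apply Rlt_le_trans with (exp (- (2)) * (2 - 1)); [pose proof (exp_pos (- (2))); lra |].
destruct HV as [L H]; apply le_epsilon; intros eta He.
destruct (H eta He) as [d [Hd B]]; pose proof (Rinv_0_lt_compat _ Hd).
set (x := Rmin (d / 2) 1); set (y := / d + 2).
assert (Hx : 0 < x) by (apply Rmin_glb_lt; lra).
assert (Hxd : x <= d / 2) by apply Rmin_l; assert (Hx1 : x <= 1) by apply Rmin_r.
assert (Hy : 2 < y) by (unfold y; lra).
specialize (B x y ltac:(lra) ltac:(unfold y; lra)).
assert (Nn : forall t, 0 <= fst (gint (RtoC A) t)).
{ intros t; rewrite gint_real; simpl; left; apply Rmult_lt_0_compat; apply exp_pos. }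
assert (I : forall u v, 0 < u <= v -> 0 <= fst (cint (gint (RtoC A)) u v)).
{ intros u v Huv.
  pose proof (is_cint_fst _ _ _ _ (cint_correct _ _ _ (L u v ltac:(lra) ltac:(lra)))) as I.
  rewrite <- (is_RInt_unique _ _ _ _ I); apply RInt_ge_0; [lra | eexists; exact I |]; intros; apply Nn. }
rewrite (cint_Chasles _ x 1 y), (cint_Chasles _ 1 2 y) in B by (apply L; lra).
pose proof (I x 1 ltac:(lra)); pose proof (I 2 y ltac:(lra)).
pose proof (is_cint_fst _ _ _ _ (cint_correct _ _ _ (L 1 2 ltac:(lra) ltac:(lra)))) as I12.
assert (G : exp (- (2)) * (2 - 1) <= fst (cint (gint (RtoC A)) 1 2)).
{ refine (is_RInt_le (fun _ => exp (- (2))) (fun t => fst (gint (RtoC A) t)) 1 2 _ _ _ _ I12 _).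
  - lra.
  - refine (eq_ind _ (is_RInt _ 1 2) (is_RInt_const (V := R_NormedModule) 1 2 (exp (- (2)))) _ _).
    unfold scal; simpl; unfold mult; simpl; ring.
  - intros t Ht; rewrite gint_real; simpl; rewrite <- (Rmult_1_r (exp (- (2)))).
    apply Rmult_le_compat; [left; apply exp_pos | lra | apply exp_le; lra |].
    apply Rle_trans with (Rpower t 0); [rewrite Rpower_O | apply Rle_Rpower]; lra. }
apply fst_close in B.
change (Rabs (fst (cint (gint (RtoC A)) x 1) + (fst (cint (gint (RtoC A)) 1 2) +
  fst (cint (gint (RtoC A)) 2 y)) - fst V) <= eta) in B.
apply Rabs_le_between in B; lra.
Qed.

(** With [v = ln y / 2] the right side is [(exp v - exp (- v)) ^ 2], so the claim is that the
    hyperbolic sine dominates its argument. *)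
Lemma ln_sqr_le y : 0 < y -> ln y ^ 2 <= (y - 1) ^ 2 / y.
Proof.
intros Hy.
assert (G : forall u, 0 <= u -> 2 * u <= exp u - exp (- u)).
{ intros u [Hu | <-]; [| rewrite Ropp_0; lra].
  destruct (MVT_cor2 (fun t => exp t - exp (- t) - 2 * t) (fun t => exp t + exp (- t) - 2) 0 u Hu)
    as [c [E Hc]].
  - intros c _; apply is_derive_Reals; auto_derive; [exact I | ring].
  - rewrite Ropp_0, exp_0 in E.
    assert (0 <= exp c + exp (- c) - 2).
    { rewrite exp_Ropp; pose proof (exp_pos c) as P.
      apply Rmult_le_reg_r with (exp c); [exact P |].
      replace ((exp c + / exp c - 2) * exp c) with ((exp c - 1) ^ 2) by (field; lra).
      rewrite Rmult_0_l; apply pow2_ge_0. }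
    nra. }
set (v := ln y / 2).
assert (Ey : y = exp v * exp v) by (rewrite <- exp_plus; unfold v; replace (ln y / 2 + ln y / 2) with (ln y) by field; now rewrite exp_ln).
pose proof (exp_pos v) as Pv.
replace ((y - 1) ^ 2 / y) with ((exp v - exp (- v)) ^ 2) by (rewrite exp_Ropp, Ey; field; lra).
replace (ln y ^ 2) with ((2 * v) ^ 2) by (unfold v; field).
destruct (Rle_dec 0 v) as [P | P].
- apply pow_incr; split; [lra | now apply G].
- pose proof (G (- v) ltac:(lra)) as H; rewrite Ropp_involutive in H.
  replace ((2 * v) ^ 2) with ((2 * - v) ^ 2) by ring.
  replace ((exp v - exp (- v)) ^ 2) with ((exp (- v) - exp v) ^ 2) by ring.
  apply pow_incr; split; [lra | exact H].
Qed.

Lemma cos_ge_quadratic u : 1 - u ^ 2 / 2 <= cos u.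
Proof.
assert (C : cos u = 1 - 2 * sin (u / 2) * sin (u / 2))
  by (rewrite <- cos_2a_sin; f_equal; field).
assert (S : Rabs (sin (u / 2)) <= Rabs (u / 2)).
{ assert (G : forall t, 0 <= t -> Rabs (sin t) <= t).
  { intros t Ht; pose proof (bounded_variation sin cos 1 0 t) as B.
    rewrite sin_0, !Rminus_0_r, Rmult_1_l, (Rabs_pos_eq t) in B by exact Ht; apply B.
    intros x _; split; [auto_derive; [exact I | ring] | apply Rabs_cos_le_1]. }
  destruct (Rle_dec 0 (u / 2)) as [P | P].
  - rewrite (Rabs_pos_eq (u / 2)) by exact P; now apply G.
  - rewrite <- Rabs_Ropp, <- sin_neg, <- (Rabs_Ropp (u / 2)).
    rewrite (Rabs_pos_eq (- (u / 2))) by lra; apply G; lra. }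
apply Rsqr_le_abs_1 in S; unfold Rsqr in S; nra.
Qed.

(** The Gamma density of shape [A] concentrates around [A]: since
    [ln (x / A) ^ 2 <= (x - A) ^ 2 / (A x)], its moments show that the phase
    [x ^ (i t)] barely oscillates when [t ^ 2 < A - 1]. *)
Lemma gint_nonzero_large s V : 2 < Re s -> Im s ^ 2 < Re s - 1 -> improper (gint s) V -> V <> 0%C.
Proof.
intros Hs Ht HV E0.
remember (Re s) as A eqn:EA; remember (Im s) as t eqn:Et.
destruct (improper_gint (RtoC (A - 1)) ltac:(simpl; lra)) as [V0 H0].
destruct (improper_gint (RtoC A) ltac:(simpl; lra)) as [V1 H1].
destruct (improper_gint (RtoC (A + 1)) ltac:(simpl; lra)) as [V2 H2].
assert (E1 : V1 = (RtoC (A - 1) * V0)%C).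
{ apply gint_recurrence; [simpl; lra | exact H0 |].
  rewrite <- RtoC_plus; replace (A - 1 + 1) with A by ring; exact H1. }
assert (E2 : V2 = (RtoC A * V1)%C).
{ apply gint_recurrence; [simpl; lra | exact H1 |]; rewrite <- RtoC_plus; exact H2. }
pose proof (gint_real_pos (A - 1) V0 ltac:(lra) H0) as P0.
(* This rotation makes the phase of the integrand zero at [x = A], leaving [t * ln (x / A)]. *)
set (w := Cexp (- (Ci * RtoC (t * ln A)))).
(* The integrand assembled here is [w * gint s], minus its modulus, plus [t ^ 2 / (2 A)] times
   [(x - A) ^ 2] against the density of shape [A - 1]. Its real part is nonnegative by the quadratic
   bound on the cosine and [ln_sqr_le]. *)
assert (HI := improper_plus _ _ _ _ (improper_minus _ _ _ _ (improper_scal w _ _ HV) H1)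
  (improper_scal (RtoC (t ^ 2 / (2 * A))) _ _
    (improper_plus _ _ _ _ (improper_minus _ _ _ _ H2 (improper_scal (RtoC (2 * A)) _ _ H1))
      (improper_scal (RtoC (A ^ 2)) _ _ H0)))).
set (r := fun x => - (exp (- x) * Rpower x (A - 1)) + t ^ 2 / (2 * A) *
  (exp (- x) * Rpower x (A + 1 - 1) - 2 * A * (exp (- x) * Rpower x (A - 1)) +
   A ^ 2 * (exp (- x) * Rpower x (A - 1 - 1)))).
apply improper_ext with (g := fun x => (w * gint s x + RtoC (r x))%C) in HI.
2:{ intros x _; rewrite !gint_real; unfold r.
    set (r1 := exp (- x) * Rpower x (A - 1)); set (r2 := exp (- x) * Rpower x (A + 1 - 1)).
    set (r0 := exp (- x) * Rpower x (A - 1 - 1)); set (c := t ^ 2 / (2 * A)); set (d := A ^ 2).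
    generalize (w * gint s x)%C; intros [z1 z2]; apply injective_projections; simpl; ring. }
apply improper_fst_nonneg in HI.
- rewrite E0, E2, E1 in HI.
  (* The second moment about [A] equals [A * V0]. If [V] were [0], the integral would be this
     multiple of [V0], negative because [t ^ 2 < A - 1]. *)
  replace (_ + _)%C with (RtoC (t ^ 2 / 2 - (A - 1)) * V0)%C in HI.
  2:{ destruct V0 as [v1 v2]; apply injective_projections; simpl; field; lra. }
  assert (Z : 0 <= (t ^ 2 / 2 - (A - 1)) * fst V0) by (simpl in *; lra).
  nra.
- intros x Hx.
  set (P := exp (- x) * Rpower x (A - 2)).
  assert (HP : 0 < P) by (apply Rmult_lt_0_compat; apply exp_pos).
  assert (R1 : exp (- x) * Rpower x (A - 1) = P * x).
  { unfold P; replace (A - 1) with (A - 2 + 1) by ring; rewrite Rpower_plus, Rpower_1 by exact Hx; ring. }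
  assert (R2 : exp (- x) * Rpower x (A + 1 - 1) = P * x * x).
  { unfold P; replace (A + 1 - 1) with (A - 2 + 1 + 1) by ring.
    rewrite !Rpower_plus, Rpower_1 by exact Hx; ring. }
  assert (R0 : exp (- x) * Rpower x (A - 1 - 1) = P) by (unfold P; f_equal; f_equal; ring).
  assert (W : (w * gint s x)%C = (P * x * cos (t * ln (x / A)), P * x * sin (t * ln (x / A)))).
  { unfold w, gint, Rcpow.
    replace (Cexp (- (Ci * RtoC (t * ln A))) * (RtoC (exp (- x)) * Cexp ((s - 1) * RtoC (ln x))))%C
      with (RtoC (exp (- x)) * (Cexp (- (Ci * RtoC (t * ln A))) * Cexp ((s - 1) * RtoC (ln x))))%C by ring.
    rewrite <- Cexp_add, <- R1, ln_div by lra.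
    replace (- (Ci * RtoC (t * ln A)) + (s - 1) * RtoC (ln x))%C with
      ((A - 1) * ln x, t * (ln x - ln A)).
    - unfold Cexp, Rpower; apply injective_projections; simpl; ring.
    - rewrite EA, Et; destruct s; apply injective_projections; simpl; ring. }
  change (0 <= fst (w * gint s x)%C + (- (exp (- x) * Rpower x (A - 1)) + t ^ 2 / (2 * A) *
    (exp (- x) * Rpower x (A + 1 - 1) - 2 * A * (exp (- x) * Rpower x (A - 1)) +
     A ^ 2 * (exp (- x) * Rpower x (A - 1 - 1))))).
  rewrite W, R0, R1, R2; cbn [fst].
  pose proof (cos_ge_quadratic (t * ln (x / A))) as Cq.
  assert (HxA : 0 < x / A) by (apply Rdiv_lt_0_compat; lra).
  pose proof (ln_sqr_le (x / A) HxA) as Lq.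
  replace ((x / A - 1) ^ 2 / (x / A)) with ((x - A) ^ 2 / (A * x)) in Lq by (field; lra).
  assert (Cq' : 1 - t ^ 2 / 2 * ((x - A) ^ 2 / (A * x)) <= cos (t * ln (x / A))).
  { eapply Rle_trans; [| exact Cq].
    replace ((t * ln (x / A)) ^ 2 / 2) with (t ^ 2 / 2 * ln (x / A) ^ 2) by field.
    pose proof (pow2_ge_0 t); nra. }
  assert (HPx : 0 < P * x) by now apply Rmult_lt_0_compat.
  apply Rmult_le_compat_l with (r := P * x) in Cq'; [| lra].
  replace (P * x * (1 - t ^ 2 / 2 * ((x - A) ^ 2 / (A * x)))) with
    (P * x - t ^ 2 / (2 * A) * (P * x * x - 2 * A * (P * x) + A ^ 2 * P)) in Cq' by (field; lra).
  lra.
Qed.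

(** Adding [1] to [s] often enough, with the imaginary part fixed, reaches the region of
    [gint_nonzero_large]; the recurrence brings the conclusion back, since a zero at [s] would force
    one at [s + 1]. *)
Lemma CGamma_neq_0 s : 2 < Re s -> CGamma s <> 0%C.
Proof.
intros Hs; destruct (improper_gint s ltac:(lra)) as [V HV].
change (CInt_0_infty (gint s) <> 0%C); rewrite (improper_CInt _ _ HV).
destruct (INR_unbounded (Im s ^ 2)) as [N HN].
assert (G : forall m s V, 2 < Re s -> Im s ^ 2 < Re s + INR m - 1 -> improper (gint s) V -> V <> 0%C).
{ induction m as [| m IH]; intros s' V' Hs' Ht HV'.
  - apply (gint_nonzero_large s'); auto; simpl in Ht; lra.
  - assert (R1 : Re (s' + 1) = Re s' + 1) by (destruct s'; simpl; ring).
    assert (I1 : Im (s' + 1) = Im s') by (destruct s'; simpl; ring).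
    destruct (improper_gint (s' + 1)) as [W HW]; [lra |].
    rewrite S_INR in Ht.
    assert (HW0 : W <> 0%C) by (apply (IH (s' + 1)%C); auto; rewrite ?R1, ?I1; lra).
    intros E; apply HW0; rewrite (gint_recurrence s' V' W ltac:(lra) HV' HW), E; ring. }
apply (G N s V Hs); [lra | exact HV].
Qed.

(** * The eta function *)

Lemma exp_pow_INR x k : exp x ^ k = exp (INR k * x).
Proof.
induction k as [| k IH]; [simpl; now rewrite Rmult_0_l, exp_0 |].
rewrite <- tech_pow_Rmult, IH, <- exp_plus, S_INR; f_equal; ring.
Qed.

Lemma q_continuity p t : 0 < p -> 0 < t -> continuity_pt (q p) t.
Proof.
intros Hp Ht; unfold q; eapply is_derive_cont; auto_derive; [| reflexivity]; lra.
Qed.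

Lemma q_pow_bound p t k : 0 < p -> 0 < t -> Rabs (q p t ^ k) <= exp (- (2 * PI * INR k * t)).
Proof.
intros Hp Ht; rewrite <- RPow_abs.
replace (- (2 * PI * INR k * t)) with (INR k * - (2 * PI * t)) by ring; rewrite <- exp_pow_INR.
apply pow_incr; split; [apply Rabs_pos | now apply q_abs_lt].
Qed.

Lemma improper_q_pow p n k : 0 < p -> 2 < Re n -> exists U,
  improper (fun t => Rcpow t (n - 1) * RtoC (q p t ^ S k))%C U.
Proof.
intros Hp Hn; pose proof PI_RGT_0.
destruct (Rpower_exp_env (Re n - 2) 2 (2 * PI) ltac:(lra) ltac:(lra) ltac:(lra)) as [K [HK B]].
apply (improper_exists _ (Re n - 2) K ltac:(lra)).
- apply loc_int_ccont; intros x Hx; apply ccont_mult; [now apply ccont_Rcpow |].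
  apply ccont_RtoC, (continuity_pt_comp (q p) (fun y => y ^ S k)).
  + now apply q_continuity.
  + apply derivable_continuous_pt, derivable_pt_pow.
- intros x Hx; specialize (B x Hx).
  rewrite Cmod_mult, Cmod_Rcpow, Cmod_R.
  replace (Re (n - 1)%C) with (Re n - 2 - 1 + 2) by (destruct n; simpl; ring).
  eapply Rle_trans; [| exact B]; apply Rmult_le_compat_l; [left; apply Rpower_pos |].
  eapply Rle_trans; [now apply q_pow_bound |]; apply exp_le.
  rewrite S_INR; pose proof (pos_INR k); assert (0 <= 2 * PI * INR k * x).
  { apply Rmult_le_pos; [apply Rmult_le_pos |]; lra. }
  lra.
Qed.

Definition qmoment (p : R) (n : C) (i : nat) : C :=
  CInt_0_infty (fun t => Rcpow t (n - 1) * RtoC (q p t ^ S i))%C.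

Lemma improper_qmoment p n i : 0 < p -> 2 < Re n ->
  improper (fun t => Rcpow t (n - 1) * RtoC (q p t ^ S i))%C (qmoment p n i).
Proof.
intros Hp Hn; destruct (improper_q_pow p n i Hp Hn) as [U HU].
unfold qmoment; now rewrite (improper_CInt _ _ HU).
Qed.

(** [q + ... + q ^ N = q / (1 - q) * (1 - q ^ N)]. *)
Lemma qmoment_csum p n N : 0 < p -> 2 < Re n ->
  improper (fun t => amp p n 1 1 t * RtoC (1 - q p t ^ N))%C (csum (qmoment p n) N).
Proof.
intros Hp Hn; induction N as [| N IH]; simpl csum.
- apply improper_ext with (fun _ => RtoC 0); [| now apply improper_zero].
  intros x _; simpl; rewrite Rminus_diag; ring.
- eapply improper_ext; [| exact (improper_plus _ _ _ _ IH (improper_qmoment p n N Hp Hn))].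
  intros x Hx; simpl; unfold amp; rewrite Rmult_1_l.
  destruct (one_minus_q_pos p 1 x Hp ltac:(lra) Hx) as [_ N1].
  rewrite <- !Cmult_assoc, <- !RtoC_mult, <- Cmult_plus_distr_l, <- RtoC_plus.
  f_equal; f_equal; unfold G; field; lra.
Qed.

(** Near [0] the values of [q] approach [1], so the remainder [amp * q ^ N] has no uniform geometric
    bound. Instead [exp (- y) <= 1 / y] trades one power of [x] for a factor [1 / N], and what is
    left is integrable because [2 < Re n]. *)
Lemma qmoment_series p n M : 0 < p -> 2 < Re n -> improper (amp p n 1 1) M ->
  is_cseries (qmoment p n) M.
Proof.
intros Hp Hn HM; pose proof PI_RGT_0.
destruct (Rpower_exp_env (Re n - 2) 0 PI ltac:(lra) ltac:(lra) ltac:(lra)) as [K [HK B]].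
set (K' := / PI * (/ (2 * PI) * K)).
assert (HK' : 0 < K').
{ unfold K'; apply Rmult_lt_0_compat; [apply Rinv_0_lt_compat; lra |].
  apply Rmult_lt_0_compat; [apply Rinv_0_lt_compat |]; lra. }
assert (Bd : forall N, Cmod (csum (qmoment p n) (S N) - M) <= K' * / INR (S N)).
{ intros N; set (m := INR (S N)); assert (Hm : 0 < m) by (apply lt_0_INR; lia).
  apply (improper_close _ _ _ _ (Re n - 2) _ ltac:(lra) (qmoment_csum p n (S N) Hp Hn) HM).
  intros x Hx; specialize (B x Hx).
  replace (_ - _)%C with (- (amp p n 1 1 x * RtoC (q p x ^ S N)))%C by (rewrite RtoC_minus; ring).
  rewrite Cmod_opp, Cmod_mult, Cmod_R.
  pose proof (Cmod_amp_le p n 1 1 x Hp ltac:(lra) ltac:(lra) Hx) as A; rewrite Rmult_1_r in A.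
  assert (Q : Rabs (q p x ^ S N) <= / (2 * PI * m * x)).
  { eapply Rle_trans; [now apply q_pow_bound |]; fold m.
    assert (P : 0 < 2 * PI * m * x) by (apply Rmult_lt_0_compat; [apply Rmult_lt_0_compat |]; lra).
    rewrite exp_Ropp; apply Rinv_le_contravar; [exact P |].
    pose proof (exp_ineq1_le (2 * PI * m * x)); lra. }
  apply Rle_trans with (/ PI * (Rpower x (Re n - 2) * exp (- (PI * x))) * / (2 * PI * m * x)).
  - apply Rmult_le_compat; auto using Cmod_ge_0, Rabs_pos.
  - assert (E : Rpower x (Re n - 2) = Rpower x (Re n - 2 - 1 + 0) * x).
    { rewrite <- (Rpower_1 x) at 3 by exact Hx; rewrite <- Rpower_plus; f_equal; ring. }
    rewrite E; replace (K' * / m * env (Re n - 2) x) with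
      (/ PI * / (2 * PI) * / m * (K * env (Re n - 2) x)) by (unfold K'; ring).
    replace (/ PI * (Rpower x (Re n - 2 - 1 + 0) * x * exp (- (PI * x))) * / (2 * PI * m * x)) with
      (/ PI * / (2 * PI) * / m * (Rpower x (Re n - 2 - 1 + 0) * exp (- (PI * x)))) by (field; lra).
    apply Rmult_le_compat_l; [| exact B].
    left; apply Rmult_lt_0_compat; [apply Rmult_lt_0_compat |]; apply Rinv_0_lt_compat; lra. }
apply is_cseries_intro; intros eta He.
destruct (INR_unbounded (K' / eta)) as [N HN].
exists (S N); intros m Hm; destruct m as [| m]; [lia |].
eapply Rle_trans; [apply Bd |].
assert (L : INR N <= INR (S m)) by (apply le_INR; lia).
assert (P : 0 < K' / eta) by now apply Rdiv_lt_0_compat.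
apply Rmult_le_reg_r with (INR (S m)); [lra |].
rewrite Rmult_assoc, Rinv_l, Rmult_1_r by lra.
apply Rle_trans with (eta * (K' / eta)); [right; field; lra |].
apply Rmult_le_compat_l; lra.
Qed.

(** The substitution [x = 2 PI k t] with [k = i + 1] turns [exp (- x)] times the rational factor to
    the power [k] into [q p t ^ k]. *)
Lemma kosh_symbol_qmoment p n i : 0 < p -> 2 < Re n ->
  kosh_symbol n (2 * PI * p * INR (S i)) (S i) =
  (/ CGamma n * (Rcpow (2 * PI * INR (S i)) n * qmoment p n i))%C.
Proof.
intros Hp Hn; pose proof PI_RGT_0.
set (m := INR (S i)); assert (Hm : 0 < m) by (apply lt_0_INR; lia).
set (c := 2 * PI * m); assert (Hc : 0 < c) by (unfold c; apply Rmult_lt_0_compat; lra).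
unfold kosh_symbol; f_equal; apply improper_CInt.
assert (Ic : 0 < / c) by now apply Rinv_0_lt_compat.
pose proof (improper_scal (Rcpow c (n - 1)) _ _
  (improper_comp_scale _ _ _ Ic (improper_qmoment p n i Hp Hn))) as Z.
replace (Rcpow c n * qmoment p n i)%C with
  (Rcpow c (n - 1) * (qmoment p n i / RtoC (/ c)))%C.
- eapply improper_ext; [| exact Z]; intros x Hx; cbv beta.
  assert (Hcx : 0 < / c * x) by now apply Rmult_lt_0_compat.
  replace (Rcpow x (n - 1)) with (Rcpow c (n - 1) * Rcpow (/ c * x) (n - 1))%C
    by (rewrite <- Rcpow_mult_base by assumption; f_equal; field; lra).
  rewrite <- RtoC_mult.
  replace (exp (- x) * ((2 * PI * p * m - x) / (2 * PI * p * m + x)) ^ S i) with (q p (/ c * x) ^ S i).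
  + ring.
  + unfold q; rewrite Rpow_mult_distr; f_equal.
    * transitivity (exp (- (/ m * x)) ^ S i).
      { f_equal; f_equal; unfold c; field; lra. }
      rewrite exp_pow_INR; fold m; f_equal; field; lra.
    * f_equal; unfold c; field; repeat split; try lra.
      apply Rgt_not_eq; assert (0 < 2 * PI * p * m) by
        (apply Rmult_lt_0_compat; [apply Rmult_lt_0_compat |]; lra).
      assert (0 < p * (2 * PI * m)) by
        (apply Rmult_lt_0_compat; [| apply Rmult_lt_0_compat]; lra); lra.
- rewrite <- (Rcpow_pred c n Hc), RtoC_inv by lra; field.
  injection; lra.
Qed.

Lemma eta_identity p n M : 0 < p -> 2 < Re n -> improper (amp p n 1 1) M ->
  (CGamma n * eta p n / Rcpow (2 * PI) n)%C = M.
Proof.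
intros Hp Hn HM; pose proof PI_RGT_0; pose proof (CGamma_neq_0 n Hn) as G0.
assert (E : eta p n = (/ CGamma n * Rcpow (2 * PI) n * M)%C).
{ apply CSeries_unique.
  eapply is_cseries_ext; [| apply is_cseries_scal, (qmoment_series p n M Hp Hn HM)].
  intros i; cbv beta zeta; rewrite kosh_symbol_qmoment by assumption.
  assert (Hm : 0 < INR (S i)) by (apply lt_0_INR; lia).
  rewrite (Rcpow_mult_base (2 * PI)) by lra; match goal with |- ?u = ?v => change (@eq C u v) end.
  field; repeat split; first [exact G0 | apply Rcpow_neq_0]. }
rewrite E; field; repeat split; first [exact G0 | apply Rcpow_neq_0].
Qed.

(** * Passage to the limit *)

Lemma tan_shift j y : tan (y + INR j * PI) = tan y.
Proof.
induction j as [| j IH]; [simpl INR; f_equal; ring |].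
rewrite S_INR, Rmult_plus_distr_r, Rmult_1_l, <- Rplus_assoc, <- IH.
unfold tan; rewrite neg_sin, neg_cos; unfold Rdiv; rewrite Rinv_opp; ring.
Qed.

(** The interval prescribed for the root places [PI * l - j * PI] between [- PI / 2] and [0], where
    [atan] inverts [tan]. *)
Lemma phase_root p l j : 0 < p -> INR j - 1 / 2 < l < INR j -> tan (PI * l) = - l / p ->
  phase p l = INR j * PI.
Proof.
intros Hp Hl Ht; pose proof PI_RGT_0.
assert (E : tan (PI * l - INR j * PI) = - l / p).
{ rewrite <- Ht, <- (tan_shift j (PI * l - INR j * PI)); f_equal; ring. }
assert (A : atan (- l / p) = PI * l - INR j * PI) by (rewrite <- E; apply atan_tan; nra).
unfold phase; replace (l / p) with (- (- l / p)) by (field; lra); rewrite atan_opp, A; ring.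
Qed.

Definition roots (p : R) (lam : nat -> R) : Prop := forall j : nat, (1 <= j)%nat ->
  INR j - 1 / 2 < lam j < INR j /\ tan (PI * lam j) = - lam j / p.

Lemma roots_bounds p lam i : roots p lam -> INR i + 1 / 2 < lam (S i) < INR i + 1.
Proof. intros H; destruct (H (S i) ltac:(lia)) as [B _]; rewrite S_INR in B; lra. Qed.

Lemma roots_poles p b lam : 0 < p -> 0 < b -> roots p lam -> is_poles p b (fun i => lam (S i) / b).
Proof.
intros Hp Hb H i; pose proof (roots_bounds p lam i H) as B.
destruct (H (S i) ltac:(lia)) as [B' T]; split.
- assert (E : / (4 * b) = / 4 / b) by (field; lra).
  rewrite E; unfold cell; rewrite S_INR; pose proof (Rinv_0_lt_compat b Hb).
  split; unfold Rdiv; nra.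
- unfold psi; replace (b * (lam (S i) / b)) with (lam (S i)) by (field; lra).
  now apply phase_root.
Qed.

(** Written with [q], the quotient is regular at [t = p] and vanishes there, in agreement with the
    value [0] given to [inv_sigma_exp]. *)
Lemma G_inv_sigma_exp p t : 0 < p -> 0 < t -> G p 1 t = inv_sigma_exp p t (2 * PI * t).
Proof.
intros Hp Ht; destruct (one_minus_q_pos p 1 t Hp ltac:(lra) Ht) as [_ N].
unfold G, inv_sigma_exp, q in *; rewrite exp_Ropp in *.
pose proof (exp_pos (2 * PI * t)) as E; set (e := exp (2 * PI * t)) in *.
assert (N' : (p + t) * e - (p - t) <> 0).
{ intros Z; apply (Rgt_not_eq _ _ N).
  replace (1 - 1 * (/ e * ((p - t) / (p + t)))) with (((p + t) * e - (p - t)) / ((p + t) * e))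
    by (field; lra).
  rewrite Z; unfold Rdiv; ring. }
field; repeat split; lra.
Qed.

Lemma weight_dpsi p b l : 0 < p -> 0 < b -> PI / dpsi p b (l / b) = weight p l / b.
Proof.
intros Hp Hb; pose proof PI_RGT_0; unfold dpsi, weight.
replace (b * (l / b)) with l by (field; lra).
pose proof (psi_den_pos p l Hp) as D.
assert (0 < PI * (p ^ 2 + l ^ 2)) by (apply Rmult_lt_0_compat; lra).
assert (0 < p * (p * PI + 1) + PI * l ^ 2) by lra.
simpl in *; field; repeat split; try lra; apply Rgt_not_eq; lra.
Qed.

Lemma pv_integrand_kfun p b n z : 0 < p -> 0 < b -> 0 < z ->
  pv_integrand p (2 * PI * b) n z =
  kfun p b (fun y => cos y / sin y) (fun x => - Ci * amp p n 1 1 x)%C z.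
Proof.
intros Hp Hb Hz; pose proof PI_RGT_0; unfold pv_integrand, kfun, amp.
rewrite Rmult_1_l, G_inv_sigma_exp by assumption.
assert (P0 : RtoC PI <> 0%C) by (injection; lra).
assert (T0 : RtoC 2 <> 0%C) by (injection; lra).
assert (U : forall y, (Defs.sigma p (Ci * RtoC (2 * PI * y) / RtoC (2 * PI)) * Cexp (Ci * RtoC (2 * PI * y)))%C
  = qC p (- Ci * RtoC y)).
{ intros y; unfold qC, Defs.sigma; rewrite Cmult_comm; f_equal.
  - f_equal; rewrite !RtoC_mult; ring.
  - replace (Ci * RtoC (2 * PI * y) / RtoC (2 * PI))%C with (Ci * RtoC y)%C
      by (rewrite !RtoC_mult; field; repeat split; assumption).
    unfold Cdiv; f_equal; [ring | f_equal; ring]. }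
replace (- (Ci * RtoC (2 * PI * b * z)))%C with (Ci * RtoC (2 * PI * - (b * z)))%C
  by (apply injective_projections; simpl; ring).
replace (2 * PI * b * z) with (2 * PI * (b * z)) by ring.
rewrite !U, !qC_imag, phase_opp by exact Hp; unfold psi.
set (f := phase p (b * z)).
replace (2 * - f) with (- (2 * f)) by ring; rewrite cos_neg, sin_neg.
rewrite <- Cmult_assoc; set (A := (Rcpow z (n - 1) * RtoC (inv_sigma_exp p z (2 * PI * z)))%C).
transitivity (A * (- Ci * RtoC (cos f / sin f)))%C; [| unfold A; ring].
unfold A; rewrite <- !Cmult_assoc; f_equal; f_equal.
(* At a zero of the sine both sides are [0]: the numerator [v - u] vanishes on the left, and on the
   right [/ 0] is [0]. *)
destruct (Req_dec (sin f) 0) as [Z | Z].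
- rewrite sin_2a, Z; unfold Rdiv; rewrite Rinv_0.
  apply injective_projections; simpl; ring.
- rewrite cos_2a_sin, sin_2a.
  assert (CC : cos f * cos f = 1 - sin f * sin f)
    by (pose proof (sin2_cos2 f) as T; unfold Rsqr in T; lra).
  set (s := sin f) in *; set (c := cos f) in *.
  assert (D : ((((1 - 2 * s * s)%R, (2 * s * c)%R) - 1) * (((1 - 2 * s * s)%R, (- (2 * s * c))%R) - 1) =
    RtoC (4 * (s * s)))%C).
  { apply injective_projections; simpl; [| ring].
    transitivity (4 * (s * s) * (s * s) + 4 * (s * s) * (c * c)); [ring | rewrite CC; ring]. }
  rewrite D; unfold Cdiv; rewrite <- RtoC_inv by nra.
  apply injective_projections; simpl; field; exact Z.
Qed.

Lemma admissible_scal p b g kap K f (c : C) : 0 < p -> 0 < b ->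
  admissible p b g kap K f -> admissible p b g kap (Cmod c * K) (fun x => c * f x)%C.
Proof.
intros Hp Hb (H1 & H2 & H3 & H4); pose proof (Cmod_ge_0 c) as Hc; split; [| split; [| split]].
- intros; apply ccont_mult; [apply ccont_const | now apply H1].
- intros; rewrite Cmod_mult, Rmult_assoc; apply Rmult_le_compat_l; auto.
- intros; rewrite Cmod_mult, Rmult_assoc; apply Rmult_le_compat_l; auto.
- intros x y Hx Hy Hd.
  replace (_ - _)%C with (c * (f x / RtoC (dpsi p b x) - f y / RtoC (dpsi p b y)))%C
    by (unfold Cdiv; ring).
  rewrite Cmod_mult, !(Rmult_assoc (Cmod c)); apply Rmult_le_compat_l; auto.
Qed.

(** The masses left on the imaginary axis. The phase is unscaled there, hence [dpsi p 1]; [b]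
    survives only in the amplitude. *)
Definition limit_term (p : R) (n : C) (lam : nat -> R) (b rho : R) (i : nat) : C :=
  (amp p n rho b (lam (S i)) / RtoC (dpsi p 1 (lam (S i))))%C.

Lemma is_poles_ext p b mu nu : (forall i, mu i = nu i) -> is_poles p b mu -> is_poles p b nu.
Proof. intros E H i; rewrite <- E; apply H. Qed.

Lemma roots_poles_1 p lam : 0 < p -> roots p lam -> is_poles p 1 (fun i => lam (S i)).
Proof.
intros Hp H; apply is_poles_ext with (fun i => lam (S i) / 1); [intros; field |].
apply roots_poles; auto; lra.
Qed.

(** The limit [tau -> 1-] at fixed [rho]. On the real axis the combined kernel [w] is bounded, so
    only the amplitude moves; on the imaginary axis [Pk tau] concentrates on the roots. *)
Lemma half_regularised_identity p lam b n rho VP VQ M N : 0 < p -> 0 < b -> roots p lam ->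
  2 < Re n -> 0 < rho < 1 ->
  improper (kfun p b (Pk rho) (amp p n 1 1)) VP -> improper (kfun p b (Qk rho) (amp p n 1 1)) VQ ->
  improper (amp p n 1 1) M -> improper (amp p n rho b) N ->
  exists Hs, is_cseries (limit_term p n lam b rho) Hs /\
  (Ccos (RtoC PI * n / 2) * (VP - M) + Csin (RtoC PI * n / 2) * VQ = RtoC PI * Hs - N)%C.
Proof.
intros Hp Hb Hlam Hn Hr HVP HVQ HM HN.
set (c := Ccos (RtoC PI * n / 2)); set (s := Csin (RtoC PI * n / 2)).
destruct (amp_admissible p 1 n rho b Hp ltac:(lra) ltac:(lra) Hb Hn) as [K HK].
pose proof PI_RGT_0.
assert (Hkap : 0 < PI * b / 2) by (assert (0 < PI * b) by (apply Rmult_lt_0_compat; lra); lra).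
destruct (Pk_limit p 1 _ (Re n - 2) _ K _ Hp ltac:(lra) (roots_poles_1 p lam Hp Hlam) ltac:(lra) Hkap HK)
  as [Hs [HHs Hlim]].
exists Hs; split; [exact HHs |].
set (w := fun x => (c * RtoC (Pk rho (phase p (b * x)) - 1) + s * RtoC (Qk rho (phase p (b * x))))%C).
set (R := fun tau => CInt_0_infty (fun x => amp p n tau 1 x * w x)%C).
set (B := 4 / (1 - rho) ^ 2).
assert (HB : 0 <= B) by (left; apply Rdiv_lt_0_compat; [lra | apply pow_lt; lra]).
assert (Hw : forall x, 0 < x -> Cmod (w x) <= Cmod c * (B + 1) + Cmod s * B).
{ intros x _; unfold w; eapply Rle_trans; [apply Cmod_triangle |]; rewrite !Cmod_mult, !Cmod_R.
  pose proof (ker_bounded _ _ _ Pk_kernel rho (phase p (b * x)) Hr) as B1.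
  pose proof (ker_bounded _ _ _ Qk_kernel rho (phase p (b * x)) Hr) as B2; fold B in B1, B2.
  apply Rplus_le_compat; apply Rmult_le_compat_l; auto using Cmod_ge_0.
  unfold Rminus; eapply Rle_trans; [apply Rabs_triang |]; rewrite Rabs_Ropp, Rabs_R1; lra. }
assert (HBw : 0 <= Cmod c * (B + 1) + Cmod s * B).
{ pose proof (Cmod_ge_0 c); pose proof (Cmod_ge_0 s); nra. }
assert (HV1 : improper (fun x => amp p n 1 1 x * w x)%C (c * (VP - M) + s * VQ)%C).
{ eapply improper_ext; [| exact (improper_plus _ _ _ _
    (improper_scal c _ _ (improper_minus _ _ _ _ HVP HM)) (improper_scal s _ _ HVQ))].
  intros x _; unfold w, kfun, psi; simpl; rewrite RtoC_minus; ring. }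
assert (HR : forall tau, 0 < tau < 1 -> improper (fun x => amp p n tau 1 x * w x)%C (R tau) /\
  improper (fun y => Rcpow y (n - 1) * RtoC (G p rho (b * y)) * RtoC (Pk tau (phase p y) - 1))%C (R tau)).
{ intros tau Htau; destruct (regularised_identity p tau rho b n Hp Htau Hr Hb Hn) as [I [H1 H2]].
  apply improper_ext with (g := fun x => (amp p n tau 1 x * w x)%C) in H1.
  2:{ intros x _; unfold amp; now rewrite Rmult_1_l. }
  unfold R; rewrite (improper_CInt _ _ H1); now split. }
assert (HR1 : rlim R (c * (VP - M) + s * VQ)%C).
{ destruct (amp_kernel_close p n 1 w _ Hp ltac:(lra) Hn HBw Hw) as [K' HK'].
  apply rlim_lipschitz with K'; intros tau Htau.
  exact (HK' tau _ _ ltac:(lra) (proj1 (HR tau Htau)) HV1). }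
(* Adding [N] turns the kernel [Pk tau - 1] into [Pk tau], to which the kernel limit applies. *)
assert (HR2 : rlim (fun tau => R tau + N)%C (RtoC PI * Hs)%C).
{ apply (ilim_rlim _ _ _ Hlim); intros tau Htau.
  eapply improper_ext; [| exact (improper_plus _ _ _ _ (proj2 (HR tau Htau)) HN)].
  intros x _; unfold kfun, amp, psi; simpl; rewrite Rmult_1_l, RtoC_minus; ring. }
assert (HR3 : rlim (fun tau => R tau + N)%C (c * (VP - M) + s * VQ + N)%C).
{ apply rlim_plus; [exact HR1 | apply rlim_const]. }
rewrite <- (rlim_unique _ _ _ _ (fun _ _ => eq_refl) HR3 HR2); ring.
Qed.

(** Geometric domination of the differences, with the factor [1 - rho] split off, carries the limit
    [rho -> 1-] through the series. *)
Lemma limit_term_close p n lam b : 0 < p -> 0 < b -> roots p lam -> 2 < Re n ->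
  exists K r, 0 <= r < 1 /\ 0 <= K /\ forall rho i, 0 < rho < 1 ->
  Cmod (limit_term p n lam b rho i - limit_term p n lam b 1 i) <= K * (1 - rho) * r ^ i.
Proof.
intros Hp Hb Hlam Hn; pose proof PI_RGT_0.
assert (Hpb : 0 < PI * b) by (apply Rmult_lt_0_compat; lra).
destruct (Rpower_exp_bounded (Re n - 2) (PI * b / 2) ltac:(lra) ltac:(lra)) as [K1 [HK1 B]].
set (C := 16 / (2 * PI * b) ^ 2).
assert (HC : 0 < C) by (apply Rdiv_lt_0_compat; [lra | apply pow_lt; lra]).
exists (C * (2 * K1) / PI), (exp (- (PI * b / 2))); split; [split | split].
- left; apply exp_pos.
- rewrite <- exp_0; apply exp_increasing; lra.
- left; apply Rdiv_lt_0_compat; [| lra]; apply Rmult_lt_0_compat; lra.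
- intros rho i Hr; unfold limit_term; set (l := lam (S i)).
  pose proof (roots_bounds p lam i Hlam) as Hl; fold l in Hl; pose proof (pos_INR i).
  pose proof (dpsi_bounds p 1 l Hp ltac:(lra)) as D.
  replace (_ - _)%C with ((amp p n rho b l - amp p n 1 b l) / RtoC (dpsi p 1 l))%C
    by (unfold Cdiv; ring).
  rewrite Cmod_div, Cmod_R, Rabs_pos_eq by (try lra; injection; lra).
  replace (C * (2 * K1) / PI * (1 - rho) * exp (- (PI * b / 2)) ^ i) with
    ((1 - rho) * (C * (2 * K1 * exp (- (PI * b / 2)) ^ i)) * / PI) by (field; lra).
  apply Rmult_le_compat; [apply Cmod_ge_0 | left; apply Rinv_0_lt_compat; lra | |
    apply Rinv_le_contravar; lra].
  eapply Rle_trans; [apply amp_close; auto; lra |].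
  apply Rmult_le_compat_l; [lra |]; fold C; apply Rmult_le_compat_l; [lra |].
  rewrite exp_pow_INR; specialize (B l ltac:(lra)).
  replace (Re n - 2 - 1 + 0) with (Re n - 2 + - (1)) by ring.
  rewrite Rpower_plus, Rpower_Ropp, Rpower_1 by lra.
  replace (- (PI * b * l)) with (- (PI * b / 2 * l) + - (PI * b / 2 * l)) by field.
  rewrite exp_plus.
  set (E := exp (- (PI * b / 2 * l))) in *; assert (HE : 0 < E) by apply exp_pos.
  pose proof (Rpower_pos l (Re n - 2)) as HP.
  (* Every root exceeds [1 / 2]; this is the [2] in [2 * K1]. *)
  assert (Il : 0 < / l <= 2).
  { split; [apply Rinv_0_lt_compat; lra |].
    replace 2 with (/ (1 / 2)) by field; apply Rinv_le_contravar; lra. }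
  assert (HEi : E <= exp (INR i * - (PI * b / 2))) by (apply exp_le; nra).
  replace (Rpower l (Re n - 2) * / l * (E * E)) with ((/ l * (Rpower l (Re n - 2) * E)) * E) by ring.
  apply Rmult_le_compat; [| lra | | exact HEi].
  + apply Rmult_le_pos; [lra | left; now apply Rmult_lt_0_compat].
  + apply Rmult_le_compat; try lra; left; now apply Rmult_lt_0_compat.
Qed.

Lemma lambda_term_alpha p b n l : 0 < p -> 0 < b -> 0 < l ->
  lambda_term p (2 * PI / b) n l =
  (RtoC PI * Rcpow b n * (amp p n 1 1 (l / b)%R / RtoC (dpsi p b (l / b))))%C.
Proof.
intros Hp Hb Hl; pose proof PI_RGT_0; assert (Hlb : 0 < l / b) by now apply Rdiv_lt_0_compat.
pose proof (dpsi_pos p b (l / b) Hp Hb) as D; unfold lambda_term, amp.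
rewrite Rmult_1_l, G_inv_sigma_exp by assumption.
replace (2 * PI / b * l / (2 * PI)) with (l / b) by (field; lra).
replace (2 * PI / b * l) with (2 * PI * (l / b)) by (field; lra).
set (I := RtoC (inv_sigma_exp p (l / b) (2 * PI * (l / b)))).
replace (RtoC (weight p l)) with (RtoC b * (RtoC PI / RtoC (dpsi p b (l / b))))%C.
2:{ rewrite <- RtoC_div, weight_dpsi, <- RtoC_mult by (assumption || lra); f_equal; field; lra. }
replace (Rcpow l (n - 1)) with (Rcpow b (n - 1) * Rcpow (l / b) (n - 1))%C.
2:{ rewrite <- Rcpow_mult_base by assumption; f_equal; field; lra. }
rewrite <- (Rcpow_pred b n Hb); unfold Cdiv; ring.
Qed.

Lemma lambda_term_beta p b n l : 0 < p -> 0 < b -> 0 < l ->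
  lambda_term p (2 * PI * b) n l = (RtoC PI * (amp p n 1 b l / RtoC (dpsi p 1 l)))%C.
Proof.
intros Hp Hb Hl; pose proof PI_RGT_0; pose proof (dpsi_pos p 1 l Hp ltac:(lra)) as D.
assert (Hbl : 0 < b * l) by now apply Rmult_lt_0_compat.
unfold lambda_term, amp; rewrite G_inv_sigma_exp by assumption.
replace (2 * PI * b * l / (2 * PI)) with (b * l) by (field; lra).
replace (2 * PI * b * l) with (2 * PI * (b * l)) by ring.
replace (RtoC (weight p l)) with (RtoC PI / RtoC (dpsi p 1 l))%C; [unfold Cdiv; ring |].
pose proof (weight_dpsi p 1 l Hp ltac:(lra)) as W; replace (l / 1) with l in W by field.
rewrite <- RtoC_div, W by lra; f_equal; field.
Qed.

Lemma amp_scale p n b M : 0 < p -> 0 < b -> improper (amp p n 1 1) M ->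
  improper (amp p n 1 b) (M / Rcpow b n)%C.
Proof.
intros Hp Hb HM.
pose proof (improper_scal (/ Rcpow b (n - 1))%C _ _ (improper_comp_scale _ _ b Hb HM)) as Z.
replace (M / Rcpow b n)%C with (/ Rcpow b (n - 1) * (M / RtoC b))%C.
- eapply improper_ext; [| exact Z]; intros x Hx; cbv beta; unfold amp.
  rewrite Rmult_1_l, Rcpow_mult_base by assumption; field; apply Rcpow_neq_0.
- rewrite <- (Rcpow_pred b n Hb); field; split; [apply Rcpow_neq_0 | injection; lra].
Qed.

(** The limit [rho -> 1-]. The Poisson part yields the series at the points [lam j / b], the
    conjugate part the principal value, and the series from the imaginary axis only sees its
    amplitude move from [rho] to [1]. *)
Lemma transformation p lam b n M : 0 < p -> 0 < b -> roots p lam -> 2 < Re n ->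
  improper (amp p n 1 1) M -> exists Sa Sb L,
  is_cseries (fun i => lambda_term p (2 * PI / b) n (lam (S i))) Sa /\
  is_cseries (fun i => lambda_term p (2 * PI * b) n (lam (S i))) Sb /\
  is_PV_Int_0_infty (pv_integrand p (2 * PI * b) n) (fun i => lam (S i) / b) L /\
  (Ccos (RtoC PI * n / 2) * (Sa / Rcpow b n - M) + Csin (RtoC PI * n / 2) * (Ci * L) =
   Sb - M / Rcpow b n)%C.
Proof.
intros Hp Hb Hlam Hn HM; pose proof PI_RGT_0.
set (c := Ccos (RtoC PI * n / 2)); set (s := Csin (RtoC PI * n / 2)).
assert (HB : Rcpow b n <> 0%C) by apply Rcpow_neq_0.
assert (Hl : forall i, 0 < lam (S i)).
{ intros i; pose proof (roots_bounds p lam i Hlam); pose proof (pos_INR i); lra. }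
destruct (amp_admissible p b n 1 1 Hp Hb ltac:(lra) ltac:(lra) Hn) as [K HK].
assert (Hkap : 0 < PI * 1 / 2) by lra.
pose proof (roots_poles p b lam Hp Hb Hlam) as HP.
destruct (Pk_limit p b _ (Re n - 2) _ K _ Hp Hb HP ltac:(lra) Hkap HK) as [Ha [HHa LimP]].
(* [pv_integrand] is [- i cot psi] times the amplitude, so the constant goes into the amplitude;
   undoing it later gives the limit [Ci * L] for [VQ]. *)
destruct (Qk_limit p b _ (Re n - 2) _ _ _ Hp Hb HP ltac:(lra) Hkap
  (admissible_scal _ _ _ _ _ _ (- Ci)%C Hp Hb HK)) as [L [HL LimQ]].
assert (IP : forall rho, 0 < rho < 1 ->
  improper (kfun p b (Pk rho) (amp p n 1 1)) (CInt_0_infty (kfun p b (Pk rho) (amp p n 1 1)))).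
{ intros rho Hr.
  destruct (kernel_improper_exists _ _ _ Pk_kernel p b Hp (Re n - 2) _ _ ltac:(lra) Hkap _ HK rho Hr) as [V HV].
  now rewrite (improper_CInt _ _ HV). }
assert (IQ : forall rho, 0 < rho < 1 ->
  improper (kfun p b (Qk rho) (amp p n 1 1)) (CInt_0_infty (kfun p b (Qk rho) (amp p n 1 1)))).
{ intros rho Hr.
  destruct (kernel_improper_exists _ _ _ Qk_kernel p b Hp (Re n - 2) _ _ ltac:(lra) Hkap _ HK rho Hr) as [V HV].
  now rewrite (improper_CInt _ _ HV). }
assert (IN : forall rho, 0 < rho < 1 -> improper (amp p n rho b) (CInt_0_infty (amp p n rho b))).
{ intros rho Hr.
  destruct (amp_kernel_exists p n rho b (fun _ => 1%C) 1 Hp ltac:(lra) Hb Hn) as [V HV].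
  - intros; apply ccont_const.
  - lra.
  - intros; rewrite Cmod_1; lra.
  - apply improper_ext with (g := amp p n rho b) in HV; [| intros; ring].
    now rewrite (improper_CInt _ _ HV). }
set (VP := fun rho => CInt_0_infty (kfun p b (Pk rho) (amp p n 1 1))) in *.
set (VQ := fun rho => CInt_0_infty (kfun p b (Qk rho) (amp p n 1 1))) in *.
set (N := fun rho => CInt_0_infty (amp p n rho b)) in *.
pose proof (amp_scale p n b M Hp Hb HM) as HN1.
assert (RP : rlim VP (RtoC PI * Ha)%C) by (apply (ilim_rlim _ _ _ LimP); exact IP).
assert (RQ : rlim VQ (Ci * L)%C).
{ assert (Z : rlim (fun rho => - Ci * VQ rho)%C L).
  { apply (ilim_rlim _ _ _ LimQ); intros rho Hr.
    eapply improper_ext; [| exact (improper_scal (- Ci)%C _ _ (IQ rho Hr))].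
    intros x _; unfold kfun; ring. }
  assert (CI : forall z, (Ci * (- Ci * z) = z)%C)
    by (intros; apply injective_projections; simpl; ring).
  intros eta He; destruct (rlim_scal Ci _ _ Z eta He) as [d [Hd B]]; exists d; split; [exact Hd |].
  intros rho Hr Hr0; specialize (B rho Hr Hr0); cbv beta in B; now rewrite CI in B. }
assert (RN : rlim N (M / Rcpow b n)%C).
{ destruct (amp_kernel_close p n b (fun _ => 1%C) 1 Hp Hb Hn ltac:(lra)) as [K' HK'].
  { intros; rewrite Cmod_1; lra. }
  apply rlim_lipschitz with K'; intros rho Hr; apply (HK' rho); [lra | |];
    (eapply improper_ext; [| first [exact (IN rho Hr) | exact HN1]]); intros; cbv beta; ring. }
destruct (amp_admissible p 1 n 1 b Hp ltac:(lra) ltac:(lra) Hb Hn) as [K1 HK1].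
assert (Hkap1 : 0 < PI * b / 2) by (assert (0 < PI * b) by (apply Rmult_lt_0_compat; lra); lra).
(* Only the convergence of the series at [rho = 1] is taken from this instance. *)
destruct (Pk_limit p 1 _ (Re n - 2) _ K1 _ Hp ltac:(lra) (roots_poles_1 p lam Hp Hlam)
  ltac:(lra) Hkap1 HK1) as [H1 [HH1 _]].
fold (limit_term p n lam b 1) in HH1.
set (Hs := fun rho => CSeries (limit_term p n lam b rho)).
assert (EQ : forall rho, 0 < rho < 1 -> is_cseries (limit_term p n lam b rho) (Hs rho) /\
  (c * (VP rho - M) + s * VQ rho = RtoC PI * Hs rho - N rho)%C).
{ intros rho Hr; destruct (half_regularised_identity p lam b n rho _ _ M _ Hp Hb Hlam Hn Hr
    (IP rho Hr) (IQ rho Hr) HM (IN rho Hr)) as [h [Hh E]].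
  unfold Hs; rewrite (CSeries_unique _ _ Hh); now split. }
assert (RH : rlim Hs H1).
{ destruct (limit_term_close p n lam b Hp Hb Hlam Hn) as [K2 [r [Hr [HK2 B]]]].
  apply rlim_lipschitz with (K2 / (1 - r)); intros rho Hrho.
  replace (K2 / (1 - r) * (1 - rho)) with (K2 * (1 - rho) / (1 - r)) by (field; lra).
  apply (is_cseries_close_bound _ _ _ _ r _ Hr) with (2 := proj1 (EQ rho Hrho)) (3 := HH1).
  - apply Rmult_le_pos; lra.
  - intros i; now apply B. }
exists (RtoC PI * Rcpow b n * Ha)%C, (RtoC PI * H1)%C, L; split; [| split; [| split]].
- eapply is_cseries_ext; [| exact (is_cseries_scal (RtoC PI * Rcpow b n)%C _ _ HHa)].
  intros i; cbv beta; symmetry; now apply lambda_term_alpha.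
- eapply is_cseries_ext; [| exact (is_cseries_scal (RtoC PI) _ _ HH1)].
  intros i; cbv beta; symmetry; unfold limit_term; now apply lambda_term_beta.
- eapply is_PV_ext; [| exact HL]; intros x Hx; cbv beta; symmetry; now apply pv_integrand_kfun.
- assert (R1 := rlim_plus _ _ _ _ (rlim_plus _ _ _ _ (rlim_scal c _ _ RP) (rlim_scal s _ _ RQ)) RN).
  assert (R2 := rlim_plus _ _ _ _ (rlim_scal (RtoC PI) _ _ RH) (rlim_const (c * M)%C)).
  assert (E := fun Hext => rlim_unique _ _ _ _ Hext R1 R2).
  assert (E' : (c * (RtoC PI * Ha) + s * (Ci * L) + M / Rcpow b n = RtoC PI * H1 + c * M)%C).
  { apply E; intros rho Hr; destruct (EQ rho Hr) as [_ Z]; cbv beta.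
    replace (c * VP rho + s * VQ rho + N rho)%C with
      ((c * (VP rho - M) + s * VQ rho) + c * M + N rho)%C by ring.
    rewrite Z; ring. }
  replace (RtoC PI * H1 - M / Rcpow b n)%C with ((RtoC PI * H1 + c * M) - c * M - M / Rcpow b n)%C by ring.
  rewrite <- E'; field; exact HB.
Qed.

Open Scope C_scope.

Theorem theorem9p2 :
  forall (p : R) (lam : nat -> R) (alpha beta : R) (n : C),
    (0 < p)%R ->
    (forall j : nat, (1 <= j)%nat ->
       (INR j - 1 / 2 < lam j < INR j)%R /\
       tan (PI * lam j) = (- lam j / p)%R) ->
    (0 < alpha)%R -> (0 < beta)%R -> (alpha * beta = 4 * PI ^ 2)%R ->
    (2 < Re n)%R ->
    let Salpha := fun i : nat => lambda_term p alpha n (lam (S i)) in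
    let Sbeta := fun i : nat => lambda_term p beta n (lam (S i)) in
    let poles := fun i : nat => (2 * PI * lam (S i) / beta)%R in
    ex_CSeries Salpha /\ ex_CSeries Sbeta /\
    ex_PV_Int_0_infty (pv_integrand p beta n) poles /\
    Rcpow alpha (n / 2) *
      (CGamma n * eta p n / Rcpow (2 * PI) n
       + Ccos (RtoC PI * n / 2) * CSeries Salpha)
    = Rcpow beta (n / 2) *
      (Ccos (RtoC PI * n / 2) * (CGamma n * eta p n / Rcpow (2 * PI) n)
       + CSeries Sbeta
       - Ci * Csin (RtoC PI * n / 2) *
         PV_Int_0_infty (pv_integrand p beta n) poles).
Proof.
intros p lam alpha beta n Hp Hlam Ha Hbeta Hab Hn Salpha Sbeta poles.
pose proof PI_RGT_0 as Hpi.
set (b := (beta / (2 * PI))%R).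
assert (Hb : (0 < b)%R) by (apply Rdiv_lt_0_compat; lra).
assert (Eb : beta = (2 * PI * b)%R) by (unfold b; field; lra).
assert (Ea : alpha = (2 * PI / b)%R).
{ apply Rmult_eq_reg_r with beta; [| lra]; rewrite Hab, Eb; field; lra. }
destruct (amp_kernel_exists p n 1 1 (fun _ => RtoC 1) 1 Hp ltac:(lra) ltac:(lra) Hn) as [M HM].
{ intros; apply ccont_const. }
{ lra. }
{ intros; rewrite Cmod_1; lra. }
apply improper_ext with (g := amp p n 1 1) in HM; [| intros; ring].
destruct (transformation p lam b n M Hp Hb Hlam Hn HM) as (Sa & Sb & L & HSa & HSb & HL & E).
rewrite <- Ea in HSa; rewrite <- Eb in HSb, HL.
assert (HL' : is_PV_Int_0_infty (pv_integrand p beta n) poles L).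
{ replace poles with (fun i => (lam (S i) / b)%R); [exact HL |].
  apply functional_extensionality; intros i.
  unfold poles, b; field; lra. }
split; [now exists Sa | split; [now exists Sb | split; [now exists L |]]].
rewrite (CSeries_unique Salpha _ HSa), (CSeries_unique Sbeta _ HSb), (PV_Int_unique _ _ _ HL').
rewrite (eta_identity p n M Hp Hn HM).
set (c := Ccos (RtoC PI * n / 2)) in *; set (s := Csin (RtoC PI * n / 2)) in *.
assert (HB : Rcpow b n <> 0) by apply Rcpow_neq_0.
(* Since [beta = alpha * b ^ 2], the two prefactors differ by [b ^ n], the factor by which
   [transformation] scales [Sa] and [M]. *)
assert (EA : Rcpow beta (n / 2) = Rcpow alpha (n / 2) * Rcpow b n).
{ replace beta with (alpha * (b * b))%R by (rewrite Ea, Eb; field; lra).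
  rewrite !Rcpow_mult_base by nra; rewrite <- Rcpow_plus.
  f_equal; f_equal; field; injection; lra. }
rewrite EA.
replace (Sb) with (c * (Sa / Rcpow b n - M) + s * (Ci * L) + M / Rcpow b n)
  by (rewrite E; ring).
field; exact HB.
Qed.
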